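(* Let $\{\boldsymbol{w},p\}$, $\boldsymbol{w}=(u,v)$, be a solution in $\Omega_0$ of the Navier-Stokes equations $$\Delta \boldsymbol{w}-(\boldsymbol{w}\cdot\nabla)\boldsymbol{w}-(ay\,\partial_x+b\,\partial_y)\boldsymbol{w}-(av,0)=\nabla p,\qquad \nabla\cdot\boldsymbol{w}=0,$$ with the Navier-slip boundary condition $v(x,0)=0$, $\partial_y u(x,0)=0$ on $\Gamma$. Assume that $\boldsymbol{w}\in C^2(\overline{\Omega_0})$, that $$\int_{\Omega_0}|\nabla\boldsymbol{w}|^{2}\,dx\,dy<\infty,$$ and that $a=0$. Then $$\lim_{r\to\infty}\frac{r^{3/4}}{(\log r)^{1/8}}\,|\omega(r,\theta)|=0,$$ where $\theta\in[0,\pi]$ and $\omega=\partial_y u-\partial_x v$ is the vorticity of $\boldsymbol{w}$.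
   Context: Fix $r_0>0$ and real constants $a,b$. Points of the plane are $(x,y)$, with polar coordinates $x=r\cos\theta$, $y=r\sin\theta$, $r=\sqrt{x^2+y^2}$; a function $f$ in polar coordinates is written $f(r,\theta)$. $\Omega_0=\{(r,\theta): r>r_0,\ 0<\theta<\pi\}=\mathbb{R}^2_+\setminus\overline{B_{r_0}}$, where $\mathbb{R}^2_+=\{y>0\}$ is the upper half-plane and $B_{r_0}$ is the disc of radius $r_0$ centered at $0$. $\Gamma=\{(x,y): y=0,\ |x|>r_0\}$. $C^2(\overline{\Omega_0})$ means that all derivatives up to order 2 extend continuously to $\overline{\Omega_0}$. Here $\boldsymbol{w}$ is the velocity and $p$ the pressure. *)

(* Defs.v *)
From mathcomp Require Import all_boot all_order all_algebra.
From mathcomp Require Import all_classical all_reals all_analysis.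

Set Implicit Arguments.
Unset Strict Implicit.
Unset Printing Implicit Defensive.

Import Order.TTheory GRing.Theory Num.Theory.
Import numFieldNormedType.Exports.

Local Open Scope classical_set_scope.
Local Open Scope ring_scope.

Section Plane.
Variable R : realType.
Implicit Types (D : set (R * R)) (f u v p : R * R -> R) (z : R * R).

(** The library norm on [R * R] is the sup norm, hence the explicit radius. *)
Definition radius z : R := Num.sqrt (z.1 ^+ 2 + z.2 ^+ 2).

Definition polar (r theta : R) : R * R := (r * cos theta, r * sin theta).

Definition Omega0 (r0 : R) : set (R * R) :=
  [set z | 0 < z.2 /\ r0 < radius z].

Definition Gamma (r0 : R) : set (R * R) :=
  [set z | z.2 = 0 /\ r0 < `|z.1| ].

Definition dx f : R * R -> R := 'D_((1, 0) : R * R) f.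
Definition dy f : R * R -> R := 'D_((0, 1) : R * R) f.

Definition has_gradient f z : Prop :=
  derivable f z ((1, 0) : R * R) /\ derivable f z ((0, 1) : R * R).

Definition laplacian f z : R := dx (dx f) z + dy (dy f) z.

Definition extends_continuously D f : Prop :=
  exists g : R * R -> R,
    {within closure D, continuous g} /\ (forall z, D z -> g z = f z).

(** [C^k] up to the boundary of an open set [D]: all partial derivatives of
    order at most [k] exist in [D] and extend continuously to the closure.
    Nothing is required of the values of [f] outside [D]. *)
Fixpoint Ck_closure (k : nat) D f : Prop :=
  extends_continuously D f /\
  match k with
  | 0 => True
  | k'.+1 => [/\ forall z, D z -> has_gradient f z,
                Ck_closure k' D (dx f) & Ck_closure k' D (dy f)]
  end.

(** Value at a point of the closure of [D] of the continuous extension of the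
    restriction of [f] to [D]; meaningful when [f] extends continuously. *)
Definition closure_value D f z : R := lim (f @ within D (nbhs z)).

Definition navier_stokes (a b : R) D u v p : Prop :=
  forall z, D z ->
  [/\ has_gradient p z,
      laplacian u z - (u z * dx u z + v z * dy u z)
        - (a * z.2 * dx u z + b * dy u z) - a * v z = dx p z,
      laplacian v z - (u z * dx v z + v z * dy v z)
        - (a * z.2 * dx v z + b * dy v z) = dy p z
    & dx u z + dy v z = 0].

Definition navier_slip (r0 : R) u v : Prop :=
  forall z, Gamma r0 z ->
    closure_value (Omega0 r0) v z = 0 /\
    closure_value (Omega0 r0) (dy u) z = 0.

Definition grad_sq u v z : R :=
  dx u z ^+ 2 + dy u z ^+ 2 + dx v z ^+ 2 + dy v z ^+ 2.

Definition finite_dirichlet D u v : Prop :=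
  (\int[(@lebesgue_measure R \x @lebesgue_measure R)%E]_(z in D)
     (grad_sq u v z)%:E < +oo)%E.

Definition vorticity u v z : R := dy u z - dx v z.

End Plane.

(* Main.v *)
Require Import Defs.
From mathcomp Require Import all_boot all_order all_algebra.
From mathcomp Require Import all_classical all_reals all_analysis.
From mathcomp Require Import measurable_realfun ring lra.

Import Order.TTheory GRing.Theory Num.Theory.
Import numFieldNormedType.Exports.

Local Open Scope classical_set_scope.
Local Open Scope ring_scope.

Set Implicit Arguments.
Unset Strict Implicit.
Unset Printing Implicit Defensive.

(** Write [V := v + b], so that [(u, V)] is divergence free, [w] for the
    vorticity and [P := p + (u^2 + v^2)/2 + b v].  For [a = 0] the equations
    read [P_x = w_y - V w] and [P_y = - w_x + u w]; testing them with a rotated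
    gradient gives energy identities for [w] that need only one derivative of
    [w].  Everything is done on rectangles inside the domain.

    - A function with finite Dirichlet integral has mean squares [O(log r)] on
      boxes of size 1 at distance [r]: compare dyadic boxes, neighbouring ones
      sharing good lines, with gradient energies that are summable.
    - The Caccioppoli inequality for [w] on such boxes, followed by an estimate
      of the second derivatives of [u], gives [u^2 + V^2 = O(log r)] pointwise.
    - With [A^2 = O(log r)] bounding [u^2 + V^2], Caccioppoli on a box of size
      [l ~ r] yields [\int |grad w|^2 <= C (A/l) \int w^2].  Since
      [\int w^2 -> 0] on these boxes, there are lines on the four sides of the
      centre on which [w^2 = o(A^(1/2) l^(-3/2))], and the maximum principle
      carries this bound to the centre: [w^8 = o(A^2 r^(-6)) = o(log r / r^6)].

    Near the flat boundary [w] vanishes (slip condition), so boxes are cut at a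
    small height where the boundary terms are negligible. *)

(** * Continuity and integrals on rectangles *)

(** The first obstacle is regularity: for a C2 velocity, [w] is merely C1, so
    [Delta w = u w_x + V w_y] has no pointwise meaning. Prescribing the gradient of [P] is its
    first-order form, and Green's identity for [P] and a test function [phi] is the weak vorticity
    equation tested with [phi]. The constant [b] is absorbed because adding it to [v] changes
    neither divergence nor vorticity. The second obstacle is circularity: the velocity bound needs
    an energy estimate for [w], whose transport term contains the velocity. On boxes of fixed size
    an anisotropic product inequality controls this term by the integrals of [u^2 + u_y^2] and
    [V^2 + V_y^2], and the outcome stays linear in [log r] because the integral of [w^2] is bounded.
    The eighth power avoids roots: with [s = (A/l)^(1/2)] and [W] bounding the integral of [w^2],
    good lines give [w^2 <= C s W / l], hence [w^8 l^6 <= C A^2 W^4]. On rectangles, one-dimensional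
    calculus and Fubini's theorem are enough. *)

Section PlaneMeasure.
Variable R : realType.
Implicit Types (U : set (R * R)) (f g : R * R -> R).

(** The sigma-algebra is the product one, so an open set is written as a countable union of boxes
    with rational corners. *)
Lemma open_measurable2 U : open U -> measurable U.
Proof.
move=> oU.
pose box (q : rat * rat * (rat * rat)) : set (R * R) :=
  `](ratr q.1.1 : R), ratr q.1.2[ `*` `](ratr q.2.1 : R), ratr q.2.2[.
rewrite (_ : U = \bigcup_q (if `[< box q `<=` U >] then box q else set0)).
  apply: countable_bigcupT_measurable => // q; case: asboolP => // _.
  exact: measurableX.
apply/seteqP; split=> [[x y] Uxy|[x y] [q _]]; last first.
  by case: asboolP => // + qxy; apply.
have : nbhs (x, y) U by exact: open_nbhs_nbhs.
move=> -[[A B] /= [/nbhs_ballP[d1 /= d10 A1] /nbhs_ballP[d2 /= d20 B2]] AB].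
have /rat_in_itvoo[qa] : x - d1 < x by rewrite ltrBlDr ltrDl.
have /rat_in_itvoo[qb] : x < x + d1 by rewrite ltrDl.
have /rat_in_itvoo[qc] : y - d2 < y by rewrite ltrBlDr ltrDl.
have /rat_in_itvoo[qd] : y < y + d2 by rewrite ltrDl.
rewrite !in_itv/= => /andP[d1' d2'] /andP[c1 c2] /andP[b1 b2] /andP[a1 a2].
exists ((qa, qb), (qc, qd)) => //.
case: asboolP => [_|]; first by rewrite /box/= !in_itv/= a2 b1 c2 d1'.
case=> -[s t]; rewrite /box/= !in_itv/= => -[/andP[s1 s2] /andP[t1 t2]].
apply: AB; split => /=.
  by apply: A1; rewrite /ball/= ltr_norml; apply/andP; split; lra.
by apply: B2; rewrite /ball/= ltr_norml; apply/andP; split; lra.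
Qed.

(** Continuity in the topology of the whole plane at the points of [U], so that it restricts to sets
    that are not open, such as closed rectangles inside a domain. *)
Definition cts U f := forall z, U z -> {for z, continuous f}.

Lemma cts_measurable U f : open U -> cts U f -> measurable_fun U f.
Proof.
move=> oU cf.
apply: (measurability _ (RGenOpens.measurableE R)) => _ [_ [a [b ->]] <-].
apply: open_measurable2.
rewrite openE => z [Uz /= fz].
have Hz : nbhs z U by exact: open_nbhs_nbhs.
apply: filterI => //.
apply: (cf z Uz).
by apply: open_nbhs_nbhs; split => //; exact: interval_open.
Qed.

Lemma ctsS U W f : W `<=` U -> cts U f -> cts W f.
Proof. by move=> WU cf z /WU; exact: cf. Qed.

Lemma cts_cst U (c : R) : cts U (fun=> c).
Proof. by move=> z _; exact: cst_continuous. Qed.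

Lemma cts_fst U : cts U (fun z => z.1).
Proof. by move=> z _; exact: cvg_fst. Qed.

Lemma cts_snd U : cts U (fun z => z.2).
Proof. by move=> z _; exact: cvg_snd. Qed.

Lemma ctsD U f g : cts U f -> cts U g -> cts U (fun z => f z + g z).
Proof. by move=> cf cg z Uz; apply: cvgD; [exact: cf|exact: cg]. Qed.

Lemma ctsN U f : cts U f -> cts U (fun z => - f z).
Proof. by move=> cf z Uz; apply: cvgN; exact: cf. Qed.

Lemma ctsB U f g : cts U f -> cts U g -> cts U (fun z => f z - g z).
Proof. by move=> cf cg; apply: ctsD => //; exact: ctsN. Qed.

Lemma ctsM U f g : cts U f -> cts U g -> cts U (fun z => f z * g z).
Proof. by move=> cf cg z Uz; apply: cvgM; [exact: cf|exact: cg]. Qed.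

Lemma ctsX U f n : cts U f -> cts U (fun z => f z ^+ n).
Proof.
move=> cf; elim: n => [|n IH]; first exact: cts_cst.
rewrite (_ : (fun z => f z ^+ n.+1) = (fun z => f z * f z ^+ n)).
  exact: ctsM.
by apply/funext => z; rewrite exprS.
Qed.

Lemma cts_comp U f (h : R -> R) : continuous h -> cts U f -> cts U (h \o f).
Proof. by move=> ch cf z Uz; apply: continuous_comp; [exact: cf|exact: ch]. Qed.

Lemma cts_norm U f : cts U f -> cts U (fun z => `|f z|).
Proof. by move=> cf z Uz; apply: cvg_norm; exact: cf. Qed.

Lemma cts_slicex U f y : cts U f -> forall x, U (x, y) ->
  {for x, continuous (fun x => f (x, y))}.
Proof.
move=> cf x Uxy; apply: (@continuous_comp _ _ _ (fun x => (x, y)) f); last exact: cf.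
by apply: (@cvg_pair _ _ _ (nbhs x) (nbhs x) (nbhs y)); [exact: cvg_id|exact: cvg_cst].
Qed.

Lemma cts_slicey U f x : cts U f -> forall y, U (x, y) ->
  {for y, continuous (fun y => f (x, y))}.
Proof.
move=> cf y Uxy; apply: (@continuous_comp _ _ _ (fun y => (x, y)) f); last exact: cf.
by apply: (@cvg_pair _ _ _ (nbhs y) (nbhs x) (nbhs y)); [exact: cvg_cst|exact: cvg_id].
Qed.

Definition rect (x1 x2 y1 y2 : R) : set (R * R) := `[x1, x2] `*` `[y1, y2].

Lemma rectP x1 x2 y1 y2 (z : R * R) :
  rect x1 x2 y1 y2 z <-> (x1 <= z.1 <= x2) /\ (y1 <= z.2 <= y2).
Proof. by rewrite /rect/= !in_itv/=. Qed.

Lemma compact_rect x1 x2 y1 y2 : compact (rect x1 x2 y1 y2).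
Proof. by apply: compact_setX; exact: segment_compact. Qed.

Lemma measurable_rect x1 x2 y1 y2 : measurable (rect x1 x2 y1 y2).
Proof. exact: measurableX. Qed.

Lemma compact_cts_bounded (K : set (R * R)) f : compact K -> cts K f ->
  exists2 M : R, 0 < M & forall z, K z -> `|f z| <= M.
Proof.
move=> cK cf.
have := (iffLR (compact_near_coveringP K)) cK R (+oo%R : set_system R) (fun M z => `|f z| <= M) _.
move=> H.
have {H} : \forall M \near +oo%R, K `<=` (fun z => `|f z| <= M).
  apply: H => z Kz.
  have : \forall z' \near z, `|f z'| < `|f z| + 1.
    have /cvgr_norm_lt := cf z Kz; apply.
    by rewrite ltrDl.
  move=> nz.
  exists ([set z' | `|f z'| < `|f z| + 1], [set M | `|f z| + 1 <= M]) => /=.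
    by split => //; apply: nbhs_pinfty_ge; rewrite num_real.
  by move=> [z' M] /= [/ltW + ?] => /le_trans; apply.
move=> H.
have : \forall M \near +oo%R, (0 < M) /\ K `<=` (fun z => `|f z| <= M).
  by near=> M; split; [near: M; apply: nbhs_pinfty_gt; rewrite num_real|near: M].
by case/filter_ex => M [M0 KM]; exists M.
Unshelve. all: by end_near. Qed.

(** Heine-Cantor; the second point may leave [K], since continuity at points of [K] refers to full
    neighbourhoods. *)
Lemma compact_cts_unif (K : set (R * R)) f : compact K -> cts K f ->
  forall e : R, 0 < e -> exists2 d : R, 0 < d &
    forall z w, K z -> `|w.1 - z.1| < d -> `|w.2 - z.2| < d ->
      `|f w - f z| <= e.
Proof.
move=> cK cf e e0.
have := (iffLR (compact_near_coveringP K)) cK R (0^'+)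
  (fun d z => forall w, `|w.1 - z.1| < d -> `|w.2 - z.2| < d -> `|f w - f z| <= e) _.
move=> H.
have {H} : \forall d \near 0^'+, K `<=` (fun z => forall w, `|w.1 - z.1| < d -> `|w.2 - z.2| < d -> `|f w - f z| <= e).
  apply: H => z Kz.
  have e20 : 0 < e / 2 by rewrite divr_gt0.
  have /nbhs_ballP[r /= r0 zr] : \forall z' \near z, `|f z - f z'| < e / 2.
    by have /cvgr_dist_lt := cf z Kz; apply.
  exists (ball z (r / 2), [set d | d < r / 2]); first split => /=.
  - by apply: nbhsx_ballx; rewrite divr_gt0.
  - by apply: nbhs_right_lt; rewrite divr_gt0.
  move=> [z' d] /= [[bz1 bz2] dr] w w1 w2.
  rewrite /ball/= in bz1 bz2.
  have h1 : `|f z - f z'| < e / 2.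
    apply: zr; split; rewrite /ball/=.
      by apply: lt_trans bz1 _; lra.
    by apply: lt_trans bz2 _; lra.
  have h2 : `|f z - f w| < e / 2.
    apply: zr; split; rewrite /ball/=.
      have := ler_distD z'.1 z.1 w.1; rewrite (distrC z'.1 w.1); lra.
    have := ler_distD z'.2 z.2 w.2; rewrite (distrC z'.2 w.2); lra.
  have := ler_distD (f z) (f w) (f z'); rewrite (distrC (f w) (f z)); lra.
move=> H.
have : \forall d \near 0^'+, (0 < d) /\ K `<=` (fun z => forall w, `|w.1 - z.1| < d -> `|w.2 - z.2| < d -> `|f w - f z| <= e).
  by near=> d; split; near: d => //; exact: nbhs_right_gt.
by case/filter_ex => d [d0 Hd]; exists d => // z w Kz w1 w2; exact: Hd.
Unshelve. all: by end_near. Qed.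

End PlaneMeasure.

(** * Integrals over segments and rectangles, and Fubini's theorem *)

Section Integrals.
Variable R : realType.
Notation mu := (@lebesgue_measure R).
Notation mu2 := (@lebesgue_measure R \x @lebesgue_measure R)%E.
Implicit Types (U : set (R * R)) (f g : R * R -> R) (h : R -> R).

Definition I1 (a b : R) h : R := \int[mu]_(x in `[a, b]) h x.
Definition I2 (x1 x2 y1 y2 : R) f : R :=
  \int[mu2]_(z in rect x1 x2 y1 y2) f z.

Definition cts1 (a b : R) h := {within `[a, b], continuous h}.

Lemma cts1_at a b h : (forall x, a <= x <= b -> {for x, continuous h}) ->
  cts1 a b h.
Proof.
move=> ch; apply: continuous_in_subspaceT => x.
by rewrite inE/= in_itv/=; exact: ch.
Qed.

Lemma integrable1 a b h : cts1 a b h -> mu.-integrable `[a, b] (EFin \o h).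
Proof. by move=> ch; apply: continuous_compact_integrable => //; exact: segment_compact. Qed.

Lemma eq_I1 a b h k : (forall x, a <= x <= b -> h x = k x) ->
  I1 a b h = I1 a b k.
Proof.
by move=> hk; apply: eq_Rintegral => x; rewrite inE/= in_itv/=; exact: hk.
Qed.

Lemma I1_ge0 a b h : (forall x, a <= x <= b -> 0 <= h x) -> 0 <= I1 a b h.
Proof. by move=> h0; apply: Rintegral_ge0 => x/=; rewrite in_itv/=; exact: h0. Qed.

Lemma I1_cst a b (c : R) : a <= b -> I1 a b (fun=> c) = c * (b - a).
Proof.
move=> ab; rewrite /I1 Rintegral_cst//= lebesgue_measure_itv/= lte_fin.
by move: ab; rewrite le_eqVlt => /predU1P[->|->]; rewrite ?ltxx ?subrr.
Qed.

Section I1_integrable.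
Variables (a b : R) (h k : R -> R).
Hypothesis ih : mu.-integrable `[a, b] (EFin \o h).
Hypothesis ik : mu.-integrable `[a, b] (EFin \o k).

Lemma I1D : I1 a b (fun x => h x + k x) = I1 a b h + I1 a b k.
Proof. exact: RintegralD. Qed.

Lemma I1B : I1 a b (fun x => h x - k x) = I1 a b h - I1 a b k.
Proof. exact: RintegralB. Qed.

Lemma I1Zl (c : R) : I1 a b (fun x => c * h x) = c * I1 a b h.
Proof. exact: RintegralZl. Qed.

Lemma I1_le : (forall x, a <= x <= b -> h x <= k x) -> I1 a b h <= I1 a b k.
Proof.
by move=> hk; apply: le_Rintegral => // x/=; rewrite in_itv/=; exact: hk.
Qed.

Lemma I1_norm : `|I1 a b h| <= I1 a b (fun x => `|h x|).
Proof. exact: le_normr_Rintegral. Qed.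

End I1_integrable.

Lemma FTC (a b : R) (F dF : R -> R) : a <= b -> cts1 a b dF ->
  (forall x, a < x < b -> is_derive x 1 F (dF x)) -> cts1 a b F ->
  I1 a b dF = F b - F a.
Proof.
rewrite le_eqVlt => /predU1P[<- _ _ _|ab cdF DF cF].
  by rewrite /I1 set_itv1 Rintegral_set1 subrr.
have /continuous_within_itvP := cF => /(_ ab)[_ Fa Fb].
rewrite /I1 /Rintegral (@continuous_FTC2 _ dF F)//.
- by split => // x; rewrite in_itv/= => /DF[].
- by move=> x; rewrite in_itv/= => /DF ?; rewrite derive1E derive_val.
Qed.

Lemma FTC_at (a b : R) (F dF : R -> R) : a <= b ->
  (forall x, a <= x <= b -> {for x, continuous dF}) ->
  (forall x, a <= x <= b -> is_derive x 1 F (dF x)) ->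
  I1 a b dF = F b - F a.
Proof.
move=> ab cdF DF; apply: FTC => //.
- exact: cts1_at.
- by move=> x /andP[/ltW ? /ltW ?]; apply: DF; apply/andP.
- apply: cts1_at => x xab; have [dx _] := DF x xab.
  exact/differentiable_continuous/derivable1_diffP.
Qed.

Lemma measure_rect (x1 x2 y1 y2 : R) : x1 <= x2 -> y1 <= y2 ->
  mu2 (rect x1 x2 y1 y2) = ((x2 - x1) * (y2 - y1))%:E.
Proof.
move=> x12 y12; rewrite /rect product_measure1E//= !lebesgue_measure_itv/= !lte_fin EFinM.
congr (_ * _)%E.
  by move: x12; rewrite le_eqVlt => /predU1P[->|->]; rewrite ?ltxx ?subrr.
by move: y12; rewrite le_eqVlt => /predU1P[->|->]; rewrite ?ltxx ?subrr.
Qed.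

Section Rect.
Variable U : set (R * R).
Hypothesis oU : open U.
Variables x1 x2 y1 y2 : R.
Hypothesis KU : rect x1 x2 y1 y2 `<=` U.

Lemma integrable2 f : cts U f ->
  mu2.-integrable (rect x1 x2 y1 y2) (EFin \o f).
Proof.
move=> cf; have [M M0 fM] := compact_cts_bounded (@compact_rect _ x1 x2 y1 y2) (ctsS KU cf).
apply: measurable_bounded_integrable.
- exact: measurable_rect.
- have [x12|x12] := leP x1 x2; last by rewrite /rect [X in X `*` _]set_itv_ge ?bnd_simp -?ltNge// set0X measure0.
  have [y12|y12] := leP y1 y2; last by rewrite /rect [X in _ `*` X]set_itv_ge ?bnd_simp -?ltNge// setX0 measure0.
  by rewrite [X in (X < _)%E]measure_rect// ltry.
- by apply: measurable_funS (cts_measurable oU cf) => //; exact: open_measurable2.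
- exists M; split; first exact: num_real.
  by move=> N MN z Kz; apply: le_trans (fM z Kz) (ltW MN).
Qed.

Lemma I2D f g : cts U f -> cts U g ->
  I2 x1 x2 y1 y2 (fun z => f z + g z) = I2 x1 x2 y1 y2 f + I2 x1 x2 y1 y2 g.
Proof. by move=> cf cg; apply: RintegralD; [exact: measurable_rect|exact: integrable2..]. Qed.

Lemma I2B f g : cts U f -> cts U g ->
  I2 x1 x2 y1 y2 (fun z => f z - g z) = I2 x1 x2 y1 y2 f - I2 x1 x2 y1 y2 g.
Proof. by move=> cf cg; apply: RintegralB; [exact: measurable_rect|exact: integrable2..]. Qed.

Lemma I2Zl (c : R) f : cts U f ->
  I2 x1 x2 y1 y2 (fun z => c * f z) = c * I2 x1 x2 y1 y2 f.
Proof. by move=> cf; apply: RintegralZl; [exact: measurable_rect|exact: integrable2]. Qed.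

Lemma I2_le f g : cts U f -> cts U g ->
  (forall z, rect x1 x2 y1 y2 z -> f z <= g z) ->
  I2 x1 x2 y1 y2 f <= I2 x1 x2 y1 y2 g.
Proof. by move=> cf cg fg; rewrite /I2; apply: le_Rintegral => //; [exact: measurable_rect|exact: integrable2..]. Qed.

Lemma I2_le_integral (A : set (R * R)) g : measurable A -> A `<=` U ->
  rect x1 x2 y1 y2 `<=` A -> cts U g -> (forall z, A z -> 0 <= g z) ->
  ((I2 x1 x2 y1 y2 g)%:E <= \int[mu2]_(z in A) (g z)%:E)%E.
Proof.
move=> mA AU KA cg g0; rewrite /I2 /Rintegral fineK; last first.
  by apply: integrable_fin_num; [exact: measurable_rect|exact: integrable2].
apply: ge0_subset_integral => //; first exact: measurable_rect.
apply/measurable_EFinP; apply: (measurable_funS (open_measurable2 oU) AU).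
exact: cts_measurable.
Qed.

Lemma cts1_slicex f y : cts U f -> y1 <= y <= y2 -> cts1 x1 x2 (fun x => f (x, y)).
Proof.
move=> cf yy; apply: cts1_at => x xx.
by apply: (@cts_slicex _ U) => //; apply: KU; apply/rectP.
Qed.

Lemma cts1_slicey f x : cts U f -> x1 <= x <= x2 -> cts1 y1 y2 (fun y => f (x, y)).
Proof.
move=> cf yy; apply: cts1_at => y xx.
by apply: (@cts_slicey _ U) => //; apply: KU; apply/rectP.
Qed.

Let fK f := (EFin \o f) \_ (rect x1 x2 y1 y2).

Let ifK f : cts U f -> mu2.-integrable setT (fK f).
Proof.
move=> cf; exact: (iffLR (@integrable_mkcond _ _ _ mu2 _ (EFin \o f) (@measurable_rect _ x1 x2 y1 y2)) (integrable2 cf)).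
Qed.

(** Fubini's theorem is applied to the extension of [f] by zero to the plane; its inner integral is
    the slice integral inside the base segment and zero outside. Continuity of [f] enters as the
    second alternative. *)
Let FE f x : (\int[mu]_y fK f (x, y) =
  ((EFin \o (fun x => I1 y1 y2 (fun y => f (x, y)))) \_ `[x1, x2]) x)%E \/ ~ cts U f.
Proof.
have [cf|] := pselect (cts U f); [left|by right].
rewrite patchE; case: ifPn => [|xn].
  rewrite inE/= in_itv/= => xx.
  rewrite /I1 /Rintegral fineK; last by apply: integrable_fin_num => //; exact/integrable1/cts1_slicey.
  rewrite [RHS]integral_mkcond; apply: eq_integral => y _.
  rewrite /fK !patchE; congr (if _ then _ else _).
  by apply/idP/idP => /set_mem/= h; apply/mem_set; move: h; rewrite /rect/= !in_itv/= xx => // -[].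
rewrite (_ : (fun _ => _) = cst 0%E) ?integral_cst ?mul0e//.
apply/funext => y; rewrite /fK patchE; case: ifPn => //.
rewrite inE => -[/= xx _]; move: xn; rewrite notin_setE/= => /(_ xx).
by [].
Qed.

Let GE f y : (\int[mu]_x fK f (x, y) =
  ((EFin \o (fun y => I1 x1 x2 (fun x => f (x, y)))) \_ `[y1, y2]) y)%E \/ ~ cts U f.
Proof.
have [cf|] := pselect (cts U f); [left|by right].
rewrite patchE; case: ifPn => [|xn].
  rewrite inE/= in_itv/= => xx.
  rewrite /I1 /Rintegral fineK; last by apply: integrable_fin_num => //; exact/integrable1/cts1_slicex.
  rewrite [RHS]integral_mkcond; apply: eq_integral => x _.
  rewrite /fK !patchE; congr (if _ then _ else _).
  by apply/idP/idP => /set_mem/= h; apply/mem_set; move: h; rewrite /rect/= !in_itv/= xx => // -[].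
rewrite (_ : (fun _ => _) = cst 0%E) ?integral_cst ?mul0e//.
apply/funext => x; rewrite /fK patchE; case: ifPn => //.
rewrite inE => -[/= _ xx]; move: xn; rewrite notin_setE/= => /(_ xx).
by [].
Qed.

Lemma integrable_slicey f : cts U f ->
  mu.-integrable `[x1, x2] (EFin \o (fun x => I1 y1 y2 (fun y => f (x, y)))).
Proof.
move=> cf; apply/integrable_mkcond => //.
have := integrable_fubini_F (ifK cf).
by apply: eq_integrable => // x _; rewrite /fubini_F; case: (FE f x).
Qed.

Lemma integrable_slicex f : cts U f ->
  mu.-integrable `[y1, y2] (EFin \o (fun y => I1 x1 x2 (fun x => f (x, y)))).
Proof.
move=> cf.
have [M M0 fM] := compact_cts_bounded (@compact_rect _ x1 x2 y1 y2) (ctsS KU cf).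
apply: measurable_bounded_integrable => //.
- by rewrite /= lebesgue_measure_itv/=; case: ifP => // _; rewrite -EFinD ltry.
- apply/measurable_EFinP/measurable_restrictT => //.
  have := measurable_fubini_G (ifK cf).
  by apply: eq_measurable_fun => // y _; rewrite /fubini_G; case: (GE f y).
have [x12|x12] := leP x1 x2; last first.
  exists 1; split; first exact: num_real.
  move=> N N1 y _; rewrite /= /I1 set_itv_ge ?bnd_simp -?ltNge// Rintegral_set0 normr0.
  by rewrite (le_trans _ (ltW N1)).
exists (M * (x2 - x1)); split; first exact: num_real.
move=> N MN y; rewrite /= in_itv/= => yy; apply: le_trans (ltW MN).
have iy : mu.-integrable `[x1, x2] (EFin \o (fun x => f (x, y))) by exact/integrable1/cts1_slicex.
apply: (le_trans (I1_norm iy)); rewrite -I1_cst//; apply: I1_le.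
- exact: (integrable_norm iy).
- by apply: integrable1; apply: cts1_at => ? _; exact: cst_continuous.
- by move=> x xx; apply: fM; apply/rectP.
Qed.

Lemma I2_xy f : cts U f ->
  I2 x1 x2 y1 y2 f = I1 x1 x2 (fun x => I1 y1 y2 (fun y => f (x, y))).
Proof.
move=> cf; rewrite /I2 /Rintegral integral_mkcond -(integral12_prod_meas1 (ifK cf)).
rewrite /I1 /Rintegral [in RHS]integral_mkcond; congr fine; apply: eq_integral => x _.
by rewrite /fubini_F; case: (FE f x).
Qed.

Lemma I2_yx f : cts U f ->
  I2 x1 x2 y1 y2 f = I1 y1 y2 (fun y => I1 x1 x2 (fun x => f (x, y))).
Proof.
move=> cf; rewrite /I2 /Rintegral integral_mkcond -(integral21_prod_meas1 (ifK cf)).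
rewrite /I1 /Rintegral [in RHS]integral_mkcond; congr fine; apply: eq_integral => x _.
by rewrite /fubini_G; case: (GE f x).
Qed.

End Rect.

Lemma eq_I2 x1 x2 y1 y2 f g : (forall z, rect x1 x2 y1 y2 z -> f z = g z) ->
  I2 x1 x2 y1 y2 f = I2 x1 x2 y1 y2 g.
Proof. by move=> fg; apply: eq_Rintegral => z; rewrite inE => /fg. Qed.

Lemma I2_ge0 x1 x2 y1 y2 f : (forall z, rect x1 x2 y1 y2 z -> 0 <= f z) ->
  0 <= I2 x1 x2 y1 y2 f.
Proof. by move=> f0; apply: Rintegral_ge0. Qed.

Lemma I2_cst (x1 x2 y1 y2 c : R) : x1 <= x2 -> y1 <= y2 ->
  I2 x1 x2 y1 y2 (fun=> c) = c * ((x2 - x1) * (y2 - y1)).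
Proof. by move=> x12 y12; rewrite /I2 Rintegral_cst ?[X in fine X]measure_rect//; exact: measurable_rect. Qed.

End Integrals.

(** * Green's identity on a rectangle *)

Section C1.
Variable R : realType.
Implicit Types (U : set (R * R)) (f g : R * R -> R).

Let e1 : R * R := (1, 0).
Let e2 : R * R := (0, 1).

Lemma is_derive_slicex f z d :
  is_derive z ((1, 0) : R * R) f d <-> is_derive z.1 1 (fun x => f (x, z.2)) d.
Proof.
have E : (fun h : R => h^-1 *: (f (h *: e1 + z) - f z)) =
  (fun h : R => h^-1 *: (f (h *: (1 : R) + z.1, z.2) - f (z.1, z.2))).
  apply/funext => h; rewrite /e1; case: z => x y /=.
  by congr (_ *: (f _ - _)); congr pair => /=; rewrite scaler0 add0r.
have E1 : derivable f z e1 = derivable (fun x => f (x, z.2)) z.1 1.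
  exact: (congr1 (fun q : R -> R => cvg (q @ 0^')) E).
have E2 : 'D_e1 f z = 'D_1 (fun x => f (x, z.2)) z.1.
  exact: (congr1 (fun q : R -> R => lim (q @ 0^')) E).
by split => -[d1 d2]; split; [rewrite -E1|rewrite -E2|rewrite E1|rewrite E2].
Qed.

Lemma is_derive_slicey f z d :
  is_derive z ((0, 1) : R * R) f d <-> is_derive z.2 1 (fun y => f (z.1, y)) d.
Proof.
have E : (fun h : R => h^-1 *: (f (h *: e2 + z) - f z)) =
  (fun h : R => h^-1 *: (f (z.1, h *: (1 : R) + z.2) - f (z.1, z.2))).
  apply/funext => h; rewrite /e2; case: z => x y /=.
  by congr (_ *: (f _ - _)); congr pair => /=; rewrite scaler0 add0r.
have E1 : derivable f z e2 = derivable (fun y => f (z.1, y)) z.2 1.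
  exact: (congr1 (fun q : R -> R => cvg (q @ 0^')) E).
have E2 : 'D_e2 f z = 'D_1 (fun y => f (z.1, y)) z.2.
  exact: (congr1 (fun q : R -> R => lim (q @ 0^')) E).
by split => -[d1 d2]; split; [rewrite -E1|rewrite -E2|rewrite E1|rewrite E2].
Qed.

(** The partial derivatives are parameters, so a gradient can be prescribed by a formula, as for the
    Bernoulli pressure, and product and chain rules compute it explicitly. *)
Record C1 U f (fx fy : R * R -> R) : Prop := MkC1 {
  C1x : forall z, U z -> is_derive z ((1, 0) : R * R) f (fx z);
  C1y : forall z, U z -> is_derive z ((0, 1) : R * R) f (fy z);
  C1c : cts U f;
  C1cx : cts U fx;
  C1cy : cts U fy }.

Lemma eq_C1 U f fx fy fx' fy' : C1 U f fx fy -> fx =1 fx' -> fy =1 fy' ->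
  C1 U f fx' fy'.
Proof. by move=> + /funext <- /funext <-. Qed.

Lemma C1_cst U (c : R) : C1 U (fun=> c) (fun=> 0) (fun=> 0).
Proof.
by split; try exact: cts_cst; move=> z _; exact: is_derive_cst.
Qed.

Lemma C1_fst U : C1 U fst (fun=> 1) (fun=> 0).
Proof.
split; try exact: cts_cst; last exact: cts_fst.
- by move=> z _; apply/is_derive_slicex; exact: is_derive_id.
- by move=> z _; apply/is_derive_slicey; exact: is_derive_cst.
Qed.

Lemma C1_snd U : C1 U snd (fun=> 0) (fun=> 1).
Proof.
split; try exact: cts_cst; last exact: cts_snd.
- by move=> z _; apply/is_derive_slicex; exact: is_derive_cst.
- by move=> z _; apply/is_derive_slicey; exact: is_derive_id.
Qed.

Lemma C1D U f fx fy g gx gy : C1 U f fx fy -> C1 U g gx gy ->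
  C1 U (fun z => f z + g z) (fun z => fx z + gx z) (fun z => fy z + gy z).
Proof.
move=> [dfx dfy cf cfx cfy] [dgx dgy cg cgx cgy]; split; try exact: ctsD.
- by move=> z Uz; apply: is_deriveD; [exact: dfx|exact: dgx].
- by move=> z Uz; apply: is_deriveD; [exact: dfy|exact: dgy].
Qed.

Lemma C1N U f fx fy : C1 U f fx fy ->
  C1 U (fun z => - f z) (fun z => - fx z) (fun z => - fy z).
Proof.
move=> [dfx dfy cf cfx cfy]; split; try exact: ctsN.
- by move=> z Uz; apply: is_deriveN; exact: dfx.
- by move=> z Uz; apply: is_deriveN; exact: dfy.
Qed.

Lemma C1M U f fx fy g gx gy : C1 U f fx fy -> C1 U g gx gy ->
  C1 U (fun z => f z * g z) (fun z => fx z * g z + f z * gx z)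
    (fun z => fy z * g z + f z * gy z).
Proof.
move=> [dfx dfy cf cfx cfy] [dgx dgy cg cgx cgy].
split; try by [exact: ctsM|apply: ctsD; exact: ctsM].
- move=> z Uz; have := is_deriveM (dfx z Uz) (dgx z Uz).
  by move/is_derive_eq; apply; rewrite addrC /GRing.scale/= mulrC.
- move=> z Uz; have := is_deriveM (dfy z Uz) (dgy z Uz).
  by move/is_derive_eq; apply; rewrite addrC /GRing.scale/= mulrC.
Qed.

Lemma C1_comp U f (fx fy : R * R -> R) (G dG : R -> R) : C1 U f fx fy ->
  (forall s : R, is_derive s (1 : R) G (dG s)) -> continuous dG ->
  C1 U (fun z => G (f z)) (fun z => dG (f z) * fx z) (fun z => dG (f z) * fy z).
Proof.
move=> [dfx dfy cf cfx cfy] DG cdG.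
have cG : continuous G.
  by move=> s; have [ds _] := DG s; exact/differentiable_continuous/derivable1_diffP.
split; try by [exact: (cts_comp cG)|apply: ctsM => //; exact: (cts_comp cdG)].
- move=> z Uz; apply/is_derive_slicex.
  have /is_derive_slicex h := dfx z Uz.
  by apply: (@is_derive1_comp _ G (fun x => f (x, z.2))) => //; rewrite -surjective_pairing.
- move=> z Uz; apply/is_derive_slicey.
  have /is_derive_slicey h := dfy z Uz.
  by apply: (@is_derive1_comp _ G (fun y => f (z.1, y))) => //; rewrite -surjective_pairing.
Qed.

Lemma C1_slicex U f fx fy x y : C1 U f fx fy -> U (x, y) ->
  is_derive x 1 (fun x => f (x, y)) (fx (x, y)).
Proof. by move=> [dfx _ _ _ _] /dfx /is_derive_slicex. Qed.

Lemma C1_slicey U f fx fy x y : C1 U f fx fy -> U (x, y) ->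
  is_derive y 1 (fun y => f (x, y)) (fy (x, y)).
Proof. by move=> [_ dfy _ _ _] /dfy /is_derive_slicey. Qed.

Lemma FTCx U f fx fy a b y : a <= b -> C1 U f fx fy ->
  (forall x, a <= x <= b -> U (x, y)) ->
  I1 a b (fun x => fx (x, y)) = f (b, y) - f (a, y).
Proof.
move=> ab C Uy; apply: (@FTC_at _ _ _ (fun x => f (x, y))) => // x /Uy Ux.
- exact: (cts_slicex (C1cx C)).
- exact: (C1_slicex C).
Qed.

Lemma FTCy U f fx fy x a b : a <= b -> C1 U f fx fy ->
  (forall y, a <= y <= b -> U (x, y)) ->
  I1 a b (fun y => fy (x, y)) = f (x, b) - f (x, a).
Proof.
move=> ab C Uy; apply: (@FTC_at _ _ _ (fun y => f (x, y))) => // y /Uy Ux.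
- exact: (cts_slicey (C1cy C)).
- exact: (C1_slicey C).
Qed.

End C1.

Lemma shift_in_itv (R : realType) (a b x h : R) :
  `|h| < x - a -> `|h| < b - x -> a <= h + x <= b.
Proof. by rewrite !ltr_norml => /andP[? ?] /andP[? ?]; apply/andP; split; lra. Qed.

Section Green.
Variable R : realType.
Variable U : set (R * R).
Hypothesis oU : open U.
Variables x1 x2 y1 y2 : R.
Hypothesis KU : rect x1 x2 y1 y2 `<=` U.
Hypothesis y12 : y1 <= y2.
Implicit Types (f g h : R * R -> R).

Let Uxy x y : x1 <= x <= x2 -> y1 <= y <= y2 -> U (x, y).
Proof. by move=> hx hy; apply: KU; apply/rectP. Qed.

Lemma cts1_param h : cts U h ->
  cts1 x1 x2 (fun x => I1 y1 y2 (fun y => h (x, y))).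
Proof.
move=> ch; apply/subspace_continuousP => x /=; rewrite in_itv/= => xx.
apply/cvgrPdist_le => e e0.
(* The added 1 keeps the denominator positive for a segment reduced to a point. *)
have e'0 : 0 < e / (y2 - y1 + 1) by rewrite divr_gt0// ltr_wpDl// subr_ge0.
have [d d0 hd] := compact_cts_unif (@compact_rect _ x1 x2 y1 y2) (ctsS KU ch) e'0.
rewrite near_withinE; near=> x'; rewrite /= in_itv/= => xx'.
rewrite -I1B; [|exact/integrable1/(cts1_slicey KU)..].
have ib : lebesgue_measure.-integrable `[y1, y2] (EFin \o (fun y => h (x, y) - h (x', y))).
  apply/integrable1/cts1_at => y yy; apply: cvgB.
    exact: (cts_slicey ch (Uxy xx yy)).
  exact: (cts_slicey ch (Uxy xx' yy)).
apply: (le_trans (I1_norm ib)).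
apply: (@le_trans _ _ (I1 y1 y2 (fun=> e / (y2 - y1 + 1)))).
  apply: I1_le; first exact: (integrable_norm ib).
    by apply: integrable1; apply: cts1_at => ? _; exact: cst_continuous.
  move=> y yy; rewrite distrC; apply: hd => /=.
  - exact/rectP.
  - by near: x'; apply/nbhs_ballP; exists d => // w; rewrite /ball/= distrC.
  - by rewrite subrr normr0.
rewrite I1_cst// mulrAC ler_pdivrMr; last by rewrite ltr_wpDl// subr_ge0.
by rewrite ler_wpM2l ?ltW// ltrDl.
Unshelve. all: by end_near. Qed.

(** By the mean value theorem a difference quotient is a value of [fx] at an intermediate point, and
    [fx] is uniformly continuous near the rectangle. *)
Lemma slope_unif f fx fy : C1 U f fx fy -> forall e : R, 0 < e ->
  exists2 d : R, 0 < d & forall x x' y, x1 <= x <= x2 -> x1 <= x' <= x2 ->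
    y1 <= y <= y2 -> `|x' - x| < d -> x' != x ->
    `|(x' - x)^-1 * (f (x', y) - f (x, y)) - fx (x, y)| <= e.
Proof.
move=> C e e0.
have [d d0 hd] := compact_cts_unif (@compact_rect _ x1 x2 y1 y2) (ctsS KU (C1cx C)) e0.
exists d => // x x' y xx xx' yy xd xN.
have key a b : x1 <= a <= x2 -> x1 <= b <= x2 -> a <= b ->
    exists2 c, a <= c <= b & f (b, y) - f (a, y) = fx (c, y) * (b - a).
  move=> /andP[a1 a2] /andP[b1 b2] ab.
  have [||c] := @MVT_segment _ (fun x => f (x, y)) (fun x => fx (x, y)) _ _ ab.
  - move=> c; rewrite in_itv/= => /andP[/ltW ac /ltW cb]; apply: (C1_slicex C).
    by apply: Uxy => //; rewrite (le_trans a1)//= (le_trans cb).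
  - apply: cts1_at => c /andP[ac cb]; apply: (cts_slicex (C1c C)).
    by apply: Uxy => //; rewrite (le_trans a1)//= (le_trans cb).
  by rewrite in_itv/=; exists c.
have nz : x' - x != 0 by rewrite subr_eq0.
have [c cc ->] : exists2 c, `|c - x| < d & f (x', y) - f (x, y) = fx (c, y) * (x' - x).
  have [le|/ltW le] := leP x x'.
    have [c /andP[c1 c2] E] := key _ _ xx xx' le; exists c => //.
    by move: xd; rewrite !ger0_norm ?subr_ge0//; lra.
  have [c /andP[c1 c2] E] := key _ _ xx' xx le; exists c => //.
    by move: xd; rewrite !ler0_norm ?subr_le0//; lra.
  by rewrite -opprB E; ring.
rewrite mulrCA mulVf// mulr1; apply: (hd (x, y) (c, y)); [exact/rectP|exact: cc|by rewrite /= subrr normr0].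
Qed.

(* [phi] need not vanish on the bottom side.  Only first derivatives of [P] and
   [phi] are available, so the identity is obtained by differentiating
   [x |-> \int P_y phi dy] with difference quotients. *)
Section Flux.
Variables P Px Py phi phix phiy : R * R -> R.
Hypothesis CP : C1 U P Px Py.
Hypothesis Cphi : C1 U phi phix phiy.
Hypothesis x12 : x1 <= x2.
Hypothesis phi_left : forall y, y1 <= y <= y2 -> phi (x1, y) = 0.
Hypothesis phi_right : forall y, y1 <= y <= y2 -> phi (x2, y) = 0.
Hypothesis phi_top : forall x, x1 <= x <= x2 -> phi (x, y2) = 0.

Let J x := I1 y1 y2 (fun y => Py (x, y) * phi (x, y)).
Let T x := I1 y1 y2 (fun y => Py (x, y) * phix (x, y) - Px (x, y) * phiy (x, y))
  - Px (x, y1) * phi (x, y1).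

Let y1y : y1 <= y1 <= y2. Proof. by rewrite lexx. Qed.
Let y2y : y1 <= y2 <= y2. Proof. by rewrite lexx y12. Qed.

(** The increment of [Py] is integrated by parts in [y], so that only difference quotients of [P]
    and [phi] remain; each is compared with a first derivative. *)
Let J_incr x x' : x1 <= x <= x2 -> x1 <= x' <= x2 -> x' != x ->
  (x' - x)^-1 * (J x' - J x) - T x =
  I1 y1 y2 (fun y => Py (x', y) * ((x' - x)^-1 * (phi (x', y) - phi (x, y)))
     - Py (x, y) * phix (x, y)
     - ((x' - x)^-1 * (P (x', y) - P (x, y)) - Px (x, y)) * phiy (x, y))
  - ((x' - x)^-1 * (P (x', y1) - P (x, y1)) - Px (x, y1)) * phi (x, y1).
Proof.
move=> xx xx' xN; set k := (x' - x)^-1.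
have sl f z : cts U f -> x1 <= z <= x2 -> forall y, y1 <= y <= y2 ->
    {for y, continuous (fun y => f (z, y))}.
  by move=> cf zz y yy; apply: (cts_slicey cf); exact: Uxy.
have int1 (h : R -> R) : (forall y, y1 <= y <= y2 -> {for y, continuous h}) ->
    lebesgue_measure.-integrable `[y1, y2] (EFin \o h).
  by move=> ch; exact/integrable1/cts1_at.
have cP := C1c CP; have cPx := C1cx CP; have cPy := C1cy CP.
have cp := C1c Cphi; have cpx := C1cx Cphi; have cpy := C1cy Cphi.
pose A y := Py (x', y) * phi (x', y) - Py (x, y) * phi (x, y).
(* [B] is the [y]-derivative of [(P (x', y) - P (x, y)) * phi (x, y)]; as [phi] vanishes on top, its
   integral is the bottom value with a minus sign. *)
pose B y := (Py (x', y) - Py (x, y)) * phi (x, y) +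
  (P (x', y) - P (x, y)) * phiy (x, y).
pose C y := Py (x, y) * phix (x, y) - Px (x, y) * phiy (x, y).
have iA : lebesgue_measure.-integrable `[y1, y2] (EFin \o A).
  by apply: int1 => y yy; apply: cvgB; apply: cvgM; exact: sl.
have iB : lebesgue_measure.-integrable `[y1, y2] (EFin \o B).
  by apply: int1 => y yy; apply: cvgD; apply: cvgM; try apply: cvgB; exact: sl.
have iC : lebesgue_measure.-integrable `[y1, y2] (EFin \o C).
  by apply: int1 => y yy; apply: cvgB; apply: cvgM; exact: sl.
have IB : I1 y1 y2 B = - ((P (x', y1) - P (x, y1)) * phi (x, y1)).
  have -> : I1 y1 y2 B = (P (x', y2) - P (x, y2)) * phi (x, y2) -
      (P (x', y1) - P (x, y1)) * phi (x, y1).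
    apply: (@FTC_at _ _ _ (fun y => (P (x', y) - P (x, y)) * phi (x, y))) => // y yy.
      by apply: cvgD; apply: cvgM; try apply: cvgB; exact: sl.
    have h1 := C1_slicey CP (Uxy xx' yy); have h2 := C1_slicey CP (Uxy xx yy).
    have h3 := C1_slicey Cphi (Uxy xx yy).
    have := is_deriveM (is_deriveB h1 h2) h3.
    by move/is_derive_eq; apply; rewrite addrC /GRing.scale/= mulrC.
  by rewrite phi_top// mulr0 sub0r.
have IA : I1 y1 y2 A = J x' - J x.
  by rewrite /A I1B//; apply: int1 => y yy; apply: cvgM; exact: sl.
have ikA : lebesgue_measure.-integrable `[y1, y2] (EFin \o (fun y => k * A y)).
  by apply: int1 => y yy; apply: cvgM; [exact: cvg_cst|apply: cvgB; apply: cvgM; exact: sl].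
have ikB : lebesgue_measure.-integrable `[y1, y2] (EFin \o (fun y => k * B y)).
  apply: int1 => y yy; apply: cvgM; first exact: cvg_cst.
  by apply: cvgD; apply: cvgM; try apply: cvgB; exact: sl.
have ikAB : lebesgue_measure.-integrable `[y1, y2] (EFin \o (fun y => k * A y - k * B y)).
  exact: (integrableB _ ikA ikB).
rewrite (@eq_I1 _ _ _ _ (fun y => (k * A y - k * B y) - C y)); last first.
  by move=> y yy; rewrite /A /B /C; ring.
rewrite I1B// I1B// I1Zl// I1Zl// IA IB /T -/(C _); ring.
Qed.

Let J_derive x : x1 < x < x2 -> is_derive x 1 J (T x).
Proof.
move=> /andP[x1x xx2]; have xx : x1 <= x <= x2 by rewrite !ltW.
have K := @compact_rect _ x1 x2 y1 y2.
have [M1 M10 hM1] := compact_cts_bounded K (ctsS KU (C1cy CP)).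
have [M2 M20 hM2] := compact_cts_bounded K (ctsS KU (C1cx Cphi)).
have [M3 M30 hM3] := compact_cts_bounded K (ctsS KU (C1cy Cphi)).
have [M4 M40 hM4] := compact_cts_bounded K (ctsS KU (C1c Cphi)).
pose M := M1 + M2 + M3 + M4.
have M0 : 0 < M by rewrite !addr_gt0.
have bM1 z : rect x1 x2 y1 y2 z -> `|Py z| <= M by move/hM1; rewrite /M; lra.
have bM2 z : rect x1 x2 y1 y2 z -> `|phix z| <= M by move/hM2; rewrite /M; lra.
have bM3 z : rect x1 x2 y1 y2 z -> `|phiy z| <= M by move/hM3; rewrite /M; lra.
have bM4 z : rect x1 x2 y1 y2 z -> `|phi z| <= M by move/hM4; rewrite /M; lra.
have lim : (fun h : R => h^-1 *: (J (h *: (1 : R) + x) - J x)) @ 0^' --> T x.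
  suff key (e : R) : 0 < e -> \forall h \near 0^',
      `|T x - h^-1 *: (J (h *: (1 : R) + x) - J x)| <= e by exact/cvgrPdist_le.
  (* Three errors in the integrand and one on the bottom side, each at most [M * e'], add up to
     [e]. *)
  move=> e0; pose e' : R := e / (M * (3 * (y2 - y1) + 1)).
  have L0 : 0 < 3 * (y2 - y1) + 1 by move: y12; lra.
  have e'0 : 0 < e' by rewrite divr_gt0// mulr_gt0.
  have [d1 d10 hd1] := slope_unif CP e'0.
  have [d2 d20 hd2] := slope_unif Cphi e'0.
  have [d3 d30 hd3] := compact_cts_unif K (ctsS KU (C1cy CP)) e'0.
  near=> h.
  have h0 : h != 0 by near: h; exact: nbhs_dnbhs_neq.
  have hd : `|h| < Num.min (Num.min d1 d2) (Num.min d3 (Num.min (x - x1) (x2 - x))).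
    near: h; apply: dnbhs0_lt; rewrite !lt_min d10 d20 d30/=.
    by rewrite !subr_gt0 x1x xx2.
  move: hd; rewrite !lt_min => /andP[/andP[hd1' hd2'] /andP[hd3' /andP[hx1 hx2]]].
  rewrite [_ *: (1 : R)]mulr1.
  have xx' : x1 <= h + x <= x2.
    exact: shift_in_itv.
  have xN : h + x != x by rewrite -subr_eq0 addrK.
  have -> : T x - h^-1 *: (J (h + x) - J x) =
      - ((h + x - x)^-1 * (J (h + x) - J x) - T x).
    by rewrite addrK /GRing.scale/=; ring.
  rewrite normrN J_incr//.
  have dh : `|h + x - x| = `|h| by rewrite addrK.
  have bnd y : y1 <= y <= y2 ->
    `|Py (h + x, y) * ((h + x - x)^-1 * (phi (h + x, y) - phi (x, y)))
     - Py (x, y) * phix (x, y)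
     - ((h + x - x)^-1 * (P (h + x, y) - P (x, y)) - Px (x, y)) * phiy (x, y)| <= 3 * (M * e').
    move=> yy.
    have r1 : rect x1 x2 y1 y2 (x, y) by apply/rectP.
    have r2 : rect x1 x2 y1 y2 (h + x, y) by apply/rectP.
    have s1 := hd1 x (h + x) y xx xx' yy; rewrite dh in s1; have {}s1 := s1 hd1' xN.
    have s2 := hd2 x (h + x) y xx xx' yy; rewrite dh in s2; have {}s2 := s2 hd2' xN.
    have s3 : `|Py (h + x, y) - Py (x, y)| <= e'.
      by apply: (hd3 (x, y) (h + x, y)); [exact: r1|rewrite /= dh|rewrite /= subrr normr0].
    have := bM1 _ r2; have := bM2 _ r1; have := bM3 _ r1.
    set a := Py (h + x, y); set q := _^-1 * (phi _ - _); set b := Py (x, y).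
    set p := _^-1 * (P _ - _); rewrite -/q -/p in s1 s2; rewrite -/a -/b in s3.
    move=> k3 k2 k1.
    have -> : a * q - b * phix (x, y) - (p - Px (x, y)) * phiy (x, y) =
      a * (q - phix (x, y)) + (a - b) * phix (x, y) - (p - Px (x, y)) * phiy (x, y) by ring.
    apply: (le_trans (ler_normB _ _)).
    apply: (le_trans (lerD (ler_normD _ _) (lexx _))); rewrite !normrM.
    have t1 : `|a| * `|q - phix (x, y)| <= M * e' by rewrite ler_pM.
    have t2 : `|a - b| * `|phix (x, y)| <= e' * M by rewrite ler_pM.
    have t3 : `|p - Px (x, y)| * `|phiy (x, y)| <= e' * M by rewrite ler_pM.
    have := lerD (lerD t1 t2) t3; rewrite (mulrC e').
    by rewrite (_ : M * e' + M * e' + M * e' = 3 * (M * e'))//; ring.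
  have sl f z : cts U f -> x1 <= z <= x2 -> forall y, y1 <= y <= y2 ->
      {for y, continuous (fun y => f (z, y))}.
    by move=> cf zz y yy; apply: (cts_slicey cf); exact: Uxy.
  have cP := C1c CP; have cPx := C1cx CP; have cPy := C1cy CP.
  have cp := C1c Cphi; have cpx := C1cx Cphi; have cpy := C1cy Cphi.
  apply: (le_trans (ler_normB _ _)).
  have -> : e = 3 * (M * e') * (y2 - y1) + e' * M.
    by rewrite /e'; field; rewrite !gt_eqF//= mulr_gt0.
  apply: lerD.
    rewrite -I1_cst//; set D := (X in I1 _ _ X).
    have iD : lebesgue_measure.-integrable `[y1, y2] (EFin \o D).
      apply/integrable1/cts1_at => y yy; rewrite /D.
      apply: cvgB; first (apply: cvgB; apply: cvgM; try exact: sl).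
        by apply: cvgM; [exact: cvg_cst|apply: cvgB; exact: sl].
      apply: cvgM; last exact: sl.
      apply: cvgB; last exact: sl.
      by apply: cvgM; [exact: cvg_cst|apply: cvgB; exact: sl].
    apply: (le_trans (I1_norm iD)); apply: I1_le.
    - exact: (integrable_norm iD).
    - by apply: integrable1; apply: cts1_at => ? _; exact: cst_continuous.
    - exact: bnd.
  have r1 : rect x1 x2 y1 y2 (x, y1) by apply/rectP.
  rewrite normrM ler_pM//; last exact: bM4.
  by apply: hd1 => //; rewrite dh.
split; first exact: (cvgP _ lim).
exact: (cvg_lim _ lim).
Unshelve. all: by end_near. Qed.

(** For smooth [P] the integrand is the [y]-derivative of [Px * phi] minus the [x]-derivative of
    [Py * phi], and only the bottom side contributes. *)
Lemma green : I2 x1 x2 y1 y2 (fun z => Px z * phiy z - Py z * phix z) =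
  - I1 x1 x2 (fun x => Px (x, y1) * phi (x, y1)).
Proof.
have cP := C1c CP; have cPx := C1cx CP; have cPy := C1cy CP.
have cp := C1c Cphi; have cpx := C1cx Cphi; have cpy := C1cy Cphi.
have cD : cts U (fun z => Py z * phix z - Px z * phiy z).
  by apply: ctsB; exact: ctsM.
have cB : cts1 x1 x2 (fun x => Px (x, y1) * phi (x, y1)).
  exact: (cts1_slicex (U := U) KU (ctsM cPx cp)).
have cT : cts1 x1 x2 T.
  have c1 := cts1_param cD.
  by move=> x; apply: cvgB; [exact: c1|exact: cB].
have : I1 x1 x2 T = J x2 - J x1.
  exact: (FTC x12 cT J_derive (cts1_param (ctsM cPy cp))).
have J0 x : x = x1 \/ x = x2 -> J x = 0.
  move=> xE; rewrite /J (@eq_I1 _ _ _ _ (fun=> 0)); first by rewrite I1_cst// mul0r.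
  by move=> y yy; case: xE => ->; rewrite ?phi_left ?phi_right ?mulr0.
rewrite !J0; [|by left|by right]; rewrite subrr /T I1B; last 2 first.
- exact: (integrable_slicey oU KU cD).
- exact: integrable1.
rewrite -(I2_xy oU KU cD) => E.
rewrite (@eq_I2 _ _ _ _ _ _ (fun z => -1 * (Py z * phix z - Px z * phiy z))); last first.
  by move=> z _; ring.
rewrite (I2Zl oU KU _ cD); lra.
Qed.

End Flux.

(** The minimum of the line integrals is at most their mean. Continuity in [x] makes the minimum
    attained, so there is a genuine good line and no exceptional null set to avoid. *)
Lemma goodx h : cts U h -> x1 <= x2 ->
  exists2 x, x1 <= x <= x2 &
    I1 y1 y2 (fun y => h (x, y)) * (x2 - x1) <= I2 x1 x2 y1 y2 h.
Proof.
move=> ch x12; have [x] := EVT_min x12 (cts1_param ch).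
rewrite in_itv/= => xx xmin; exists x => //.
rewrite (I2_xy oU KU ch) -I1_cst//; apply: I1_le.
- by apply: integrable1; apply: cts1_at => ? _; exact: cst_continuous.
- exact: (integrable_slicey oU KU ch).
- by move=> t tt; apply: xmin; rewrite in_itv.
Qed.

End Green.

Section Swap.
Variable R : realType.
Variable U : set (R * R).
Hypothesis oU : open U.
Variables x1 x2 y1 y2 : R.
Hypothesis KU : rect x1 x2 y1 y2 `<=` U.
Hypothesis x12 : x1 <= x2.
Implicit Types (f g h : R * R -> R).

Lemma cts1_param_y h : cts U h ->
  cts1 y1 y2 (fun y => I1 x1 x2 (fun x => h (x, y))).
Proof.
move=> ch.
apply: (@cts1_param _ [set z | U (z.2, z.1)] y1 y2 x1 x2 _ x12 (fun z => h (z.2, z.1))).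
- by move=> z /rectP[? ?]; apply: KU; apply/rectP.
- move=> z Uz; apply: (@continuous_comp _ _ _ (fun z => (z.2, z.1)) h); last exact: ch.
  by apply: (@cvg_pair _ _ _ (nbhs z) (nbhs z.2) (nbhs z.1)); [exact: cvg_snd|exact: cvg_fst].
Qed.

Lemma goody h : cts U h -> y1 <= y2 ->
  exists2 y, y1 <= y <= y2 &
    I1 x1 x2 (fun x => h (x, y)) * (y2 - y1) <= I2 x1 x2 y1 y2 h.
Proof.
move=> ch y12; have [y] := EVT_min y12 (cts1_param_y ch).
rewrite in_itv/= => yy ymin; exists y => //.
rewrite (I2_yx oU KU ch) -I1_cst//; apply: I1_le.
- by apply: integrable1; apply: cts1_at => ? _; exact: cst_continuous.
- exact: (integrable_slicex oU KU ch).
- by move=> t tt; apply: ymin; rewrite in_itv.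
Qed.

End Swap.

(** * Cauchy-Schwarz estimates along lines, monotonicity in the rectangle, continuity from partial
    derivatives *)

Section Tools.
Variable R : realType.
Implicit Types (U : set (R * R)) (f g h : R * R -> R).

Lemma I1_sqr (a b : R) (h : R -> R) : a <= b ->
  (forall x, a <= x <= b -> {for x, continuous h}) ->
  I1 a b h ^+ 2 <= (b - a) * I1 a b (fun x => h x ^+ 2).
Proof.
move=> ab ch; have [->|] := eqVneq a b.
  by rewrite subrr mul0r /I1 set_itv1 Rintegral_set1 expr0n.
move=> /negPf anb; have ba : 0 < b - a.
  by rewrite subr_gt0 lt_neqAle anb ab.
(* [m] is the mean of [h]; expanding the nonnegative integral of [(h - m)^2] gives the
   Cauchy-Schwarz inequality. *)
set m := I1 a b h / (b - a).
have int (k : R -> R) : (forall x, a <= x <= b -> {for x, continuous k}) ->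
    lebesgue_measure.-integrable `[a, b] (EFin \o k).
  by move=> ck; exact/integrable1/cts1_at.
have ih := int _ ch.
have ih2 : lebesgue_measure.-integrable `[a, b] (EFin \o (fun x => h x ^+ 2)).
  by apply: int => x xx; apply: cvgM; exact: ch.
have ikh : lebesgue_measure.-integrable `[a, b] (EFin \o (fun x => 2 * m * h x)).
  by apply: int => x xx; apply: cvgM; [exact: cvg_cst|exact: ch].
have ic : lebesgue_measure.-integrable `[a, b] (EFin \o (fun x : R => m ^+ 2)).
  by apply: int => x xx; exact: cvg_cst.
have ihc : lebesgue_measure.-integrable `[a, b] (EFin \o (fun x => h x ^+ 2 - 2 * m * h x)).
  exact: (integrableB _ ih2 ikh).
have := @I1_ge0 _ a b (fun x => (h x - m) ^+ 2) (fun x _ => sqr_ge0 _).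
rewrite (@eq_I1 _ _ _ _ (fun x => (h x ^+ 2 - 2 * m * h x) + m ^+ 2)); last first.
  by move=> x _; ring.
rewrite I1D// I1B// I1Zl// I1_cst//.
have -> : I1 a b h = m * (b - a) by rewrite /m divfK// gt_eqF.
move: (I1 _ _ _) => S hS.
have : 0 <= (b - a) * (S - m ^+ 2 * (b - a)).
  apply: mulr_ge0; first exact: ltW.
  by move: hS; rewrite (_ : _ + _ = S - m ^+ 2 * (b - a))//; ring.
by move=> H; rewrite -subr_ge0 (_ : _ - (m * (b - a)) ^+ 2 = (b - a) * (S - m ^+ 2 * (b - a)))//; ring.
Qed.

Lemma sqr_incrx U f fx fy a b y : a <= b -> C1 U f fx fy ->
  (forall x, a <= x <= b -> U (x, y)) ->
  (f (b, y) - f (a, y)) ^+ 2 <= (b - a) * I1 a b (fun x => fx (x, y) ^+ 2).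
Proof.
move=> ab C Uy; rewrite -(FTCx ab C Uy); apply: I1_sqr => // x /Uy Ux.
exact: (cts_slicex (C1cx C)).
Qed.

Lemma sqr_incry U f fx fy x a b : a <= b -> C1 U f fx fy ->
  (forall y, a <= y <= b -> U (x, y)) ->
  (f (x, b) - f (x, a)) ^+ 2 <= (b - a) * I1 a b (fun y => fy (x, y) ^+ 2).
Proof.
move=> ab C Uy; rewrite -(FTCy ab C Uy); apply: I1_sqr => // y /Uy Ux.
exact: (cts_slicey (C1cy C)).
Qed.

Lemma I1_subset (a b c d : R) (h : R -> R) : a <= c -> d <= b ->
  (forall x, a <= x <= b -> {for x, continuous h}) ->
  (forall x, a <= x <= b -> 0 <= h x) ->
  I1 c d h <= I1 a b h.
Proof.
move=> ac db ch h0.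
have ih : lebesgue_measure.-integrable `[a, b] (EFin \o h) by exact/integrable1/cts1_at.
have sub : `[c, d] `<=` `[a, b].
  by apply: subset_itv; rewrite bnd_simp.
apply: fine_le; [|exact: integrable_fin_num ih|].
  by apply: integrable_fin_num => //; exact: integrableS ih.
apply: ge0_subset_integral => //; first exact: measurable_int ih.
Qed.

Lemma sqr_incrx_sub U f fx fy a b y s t : C1 U f fx fy ->
  (forall x, a <= x <= b -> U (x, y)) -> a <= s <= b -> a <= t <= b ->
  (f (s, y) - f (t, y)) ^+ 2 <= (b - a) * I1 a b (fun x => fx (x, y) ^+ 2).
Proof.
move=> C Uy; wlog ts : s t / t <= s => [H|].
  have [/H//|/ltW st ss tt] := leP t s.
  by rewrite -sqrrN opprB; exact: H.
move=> /andP[as_ sb] /andP[at_ tb].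
have sq x : a <= x <= b -> {for x, continuous (fun x => fx (x, y) ^+ 2)}.
  by move=> /Uy Ux; exact: (cts_slicex (ctsX (n := 2) (C1cx C))).
apply: (@le_trans _ _ ((s - t) * I1 t s (fun x => fx (x, y) ^+ 2))).
  apply: (sqr_incrx ts C) => x /andP[tx xs]; apply: Uy.
  by rewrite (le_trans at_)//= (le_trans xs).
apply: ler_pM; first by rewrite subr_ge0.
- by apply: I1_ge0 => x _; exact: sqr_ge0.
- by rewrite lerB.
- by apply: I1_subset => // x _; exact: sqr_ge0.
Qed.

Lemma sqr_incry_sub U f fx fy a b x s t : C1 U f fx fy ->
  (forall y, a <= y <= b -> U (x, y)) -> a <= s <= b -> a <= t <= b ->
  (f (x, s) - f (x, t)) ^+ 2 <= (b - a) * I1 a b (fun y => fy (x, y) ^+ 2).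
Proof.
move=> C Uy; wlog ts : s t / t <= s => [H|].
  have [/H//|/ltW st ss tt] := leP t s.
  by rewrite -sqrrN opprB; exact: H.
move=> /andP[as_ sb] /andP[at_ tb].
have sq y : a <= y <= b -> {for y, continuous (fun y => fy (x, y) ^+ 2)}.
  by move=> /Uy Ux; exact: (cts_slicey (ctsX (n := 2) (C1cy C))).
apply: (@le_trans _ _ ((s - t) * I1 t s (fun y => fy (x, y) ^+ 2))).
  apply: (sqr_incry ts C) => y /andP[tx xs]; apply: Uy.
  by rewrite (le_trans at_)//= (le_trans xs).
apply: ler_pM; first by rewrite subr_ge0.
- by apply: I1_ge0 => y _; exact: sqr_ge0.
- by rewrite lerB.
- by apply: I1_subset => // y _; exact: sqr_ge0.
Qed.

Lemma I2_subset U a b c d a' b' c' d' g : open U -> rect a b c d `<=` U ->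
  a <= a' -> b' <= b -> c <= c' -> d' <= d -> cts U g ->
  (forall z, rect a b c d z -> 0 <= g z) ->
  I2 a' b' c' d' g <= I2 a b c d g.
Proof.
move=> oU KU aa bb cc dd cg g0.
have sub : rect a' b' c' d' `<=` rect a b c d.
  move=> z /rectP[/andP[h1 h2] /andP[h3 h4]]; apply/rectP; split.
    by rewrite (le_trans aa)//= (le_trans h2).
  by rewrite (le_trans cc)//= (le_trans h4).
have ig := integrable2 oU KU cg.
rewrite -lee_fin.
have -> : (I2 a b c d g)%:E = (\int[(lebesgue_measure \x lebesgue_measure)%E]_(z in rect a b c d) (g z)%:E)%E.
  by rewrite /I2 /Rintegral fineK//; apply: integrable_fin_num => //; exact: measurable_rect.
apply: (I2_le_integral oU (subset_trans sub KU)) => //.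
exact: measurable_rect.
Qed.

(** Increments along the two sides of an L-shaped path are bounded by the mean value theorem. This
    serves the pressure, which is only known to have partial derivatives. *)
Lemma continuous_of_partials U f (fx fy : R * R -> R) : open U ->
  (forall z, U z -> is_derive z ((1, 0) : R * R) f (fx z)) ->
  (forall z, U z -> is_derive z ((0, 1) : R * R) f (fy z)) ->
  cts U fx -> cts U fy -> cts U f.
Proof.
move=> oU dfx dfy cfx cfy [x y] Uz.
have : nbhs (x, y) U by exact: open_nbhs_nbhs.
move=> -[[A B] /= [/nbhs_ballP[d1 /= d10 A1] /nbhs_ballP[d2 /= d20 B2]] AB].
pose d := Num.min d1 d2 / 2.
have m0 : 0 < Num.min d1 d2 by rewrite lt_min d10.
have d0 : 0 < d by rewrite divr_gt0.
have self c : c - d <= c <= c + d by apply/andP; split; lra.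
have KU : rect (x - d) (x + d) (y - d) (y + d) `<=` U.
  have dlt : d < Num.min d1 d2 by rewrite /d; move: m0; lra.
  move: dlt; rewrite lt_min => /andP[dd1 dd2].
  move=> [s t] /rectP[/= /andP[s1 s2] /andP[t1 t2]]; apply: AB; split => /=.
    by apply: A1; rewrite /ball/= ltr_norml; apply/andP; split; lra.
  by apply: B2; rewrite /ball/= ltr_norml; apply/andP; split; lra.
have [M1 M10 hM1] := compact_cts_bounded (@compact_rect _ _ _ _ _) (ctsS KU cfx).
have [M2 M20 hM2] := compact_cts_bounded (@compact_rect _ _ _ _ _) (ctsS KU cfy).
have incx s t y' : x - d <= s <= x + d -> x - d <= t <= x + d ->
    y - d <= y' <= y + d -> `|f (s, y') - f (t, y')| <= M1 * `|s - t|.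
  wlog ts : s t / t <= s => [H|].
    have [/H//|/ltW st ss tt yy] := leP t s.
    by rewrite distrC (distrC s); exact: H.
  move=> /andP[s1 s2] /andP[t1 t2] yy.
  have UU c : t <= c <= s -> rect (x - d) (x + d) (y - d) (y + d) (c, y').
    by move=> /andP[c1 c2]; apply/rectP; rewrite /= yy (le_trans t1)//= (le_trans c2).
  have D c : t <= c <= s -> is_derive c 1 (fun x => f (x, y')) (fx (c, y')).
    by move=> cc; have /is_derive_slicex := dfx _ (KU _ (UU _ cc)).
  have [||c] := @MVT_segment _ (fun x => f (x, y')) (fun x => fx (x, y')) _ _ ts.
  - by move=> c; rewrite in_itv/= => /andP[/ltW ? /ltW ?]; apply: D; apply/andP.
  - apply: cts1_at => c cc; have [dx _] := D c cc.
    exact/differentiable_continuous/derivable1_diffP.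
  by rewrite in_itv/= => cc ->; rewrite normrM ler_wpM2r// hM1//; exact: UU.
have incy s t : y - d <= s <= y + d -> y - d <= t <= y + d ->
    `|f (x, s) - f (x, t)| <= M2 * `|s - t|.
  wlog ts : s t / t <= s => [H|].
    have [/H//|/ltW st ss tt] := leP t s.
    by rewrite distrC (distrC s); exact: H.
  move=> /andP[s1 s2] /andP[t1 t2].
  have UU c : t <= c <= s -> rect (x - d) (x + d) (y - d) (y + d) (x, c).
    move=> /andP[c1 c2]; apply/rectP; split; first exact: self.
    by rewrite /= (le_trans t1)//= (le_trans c2).
  have D c : t <= c <= s -> is_derive c 1 (fun y => f (x, y)) (fy (x, c)).
    by move=> cc; have /is_derive_slicey := dfy _ (KU _ (UU _ cc)).
  have [||c] := @MVT_segment _ (fun y => f (x, y)) (fun y => fy (x, y)) _ _ ts.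
  - by move=> c; rewrite in_itv/= => /andP[/ltW ? /ltW ?]; apply: D; apply/andP.
  - apply: cts1_at => c cc; have [dx _] := D c cc.
    exact/differentiable_continuous/derivable1_diffP.
  by rewrite in_itv/= => cc ->; rewrite normrM ler_wpM2r// hM2//; exact: UU.
suff key (e : R) : 0 < e -> \forall w \near (x, y), `|f (x, y) - f w| <= e.
  exact/cvgrPdist_le.
move=> e0.
pose r := Num.min d (Num.min (e / 2 / M1) (e / 2 / M2)).
have r0 : 0 < r by rewrite !lt_min d0 !divr_gt0.
apply/nbhs_ballP; exists r => //= -[s t] [/= bs bt].
rewrite /ball/= !lt_min in bs bt.
move: bs bt => /andP[bs1 /andP[bs2 _]] /andP[bt1 /andP[_ bt2]].
have xx := self x.
have yy := self y.
have ss : x - d <= s <= x + d.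
  by move: bs1; rewrite ltr_norml => /andP[? ?]; apply/andP; split; lra.
have tt : y - d <= t <= y + d.
  by move: bt1; rewrite ltr_norml => /andP[? ?]; apply/andP; split; lra.
have h1 := incx x s t xx ss tt; have h2 := incy y t yy tt.
have k1 : M1 * `|x - s| <= e / 2 by rewrite mulrC -ler_pdivlMr// ltW.
have k2 : M2 * `|y - t| <= e / 2 by rewrite mulrC -ler_pdivlMr// ltW.
have := ler_distD (f (x, t)) (f (x, y)) (f (s, t)); lra.
Qed.

End Tools.

Ltac cts_leaf f :=
  match goal with
  | H : cts _ f |- _ => exact H
  | H : C1 _ f _ _ |- _ => exact (C1c H)
  | H : C1 _ _ f _ |- _ => exact (C1cx H)
  | H : C1 _ _ _ f |- _ => exact (C1cy H)
  end.

Ltac cts_tac :=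
  lazymatch goal with
  | |- cts _ (fun z => @?f z + @?g z) => apply (@ctsD _ _ f g); cts_tac
  | |- cts _ (fun z => - @?f z) => apply (@ctsN _ _ f); cts_tac
  | |- cts _ (fun z => @?f z * @?g z) => apply (@ctsM _ _ f g); cts_tac
  | |- cts _ (fun z => @?f z ^+ ?n) => apply (@ctsX _ _ f n); cts_tac
  | |- cts _ (fun z => `| @?f z |) => apply (@cts_norm _ _ f); cts_tac
  | |- cts _ (fun z => ?f z) => cts_leaf f
  | |- cts _ (fun _ => ?c) => exact (@cts_cst _ _ c)
  | |- cts _ ?f => cts_leaf f
  end.

Section RectIdentities.
Variable R : realType.
Variable U : set (R * R).
Hypothesis oU : open U.
Variables x1 x2 y1 y2 : R.
Hypothesis KU : rect x1 x2 y1 y2 `<=` U.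
Hypothesis x12 : x1 <= x2.
Hypothesis y12 : y1 <= y2.
Implicit Types (f g h : R * R -> R).

Lemma I2_dx f (fx fy : R * R -> R) : C1 U f fx fy ->
  I2 x1 x2 y1 y2 fx = I1 y1 y2 (fun y => f (x2, y) - f (x1, y)).
Proof.
move=> C; rewrite (I2_yx oU KU (C1cx C)); apply: eq_I1 => y yy.
by apply: (FTCx x12 C) => x xx; apply: KU; apply/rectP.
Qed.

Lemma I2_dy f (fx fy : R * R -> R) : C1 U f fx fy ->
  I2 x1 x2 y1 y2 fy = I1 x1 x2 (fun x => f (x, y2) - f (x, y1)).
Proof.
move=> C; rewrite (I2_xy oU KU (C1cy C)); apply: eq_I1 => x xx.
by apply: (FTCy y12 C) => y yy; apply: KU; apply/rectP.
Qed.

Lemma divergence_theorem (A Ax Ay B Bx By : R * R -> R) :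
  C1 U A Ax Ay -> C1 U B Bx By ->
  (forall y, y1 <= y <= y2 -> A (x1, y) = 0) ->
  (forall y, y1 <= y <= y2 -> A (x2, y) = 0) ->
  (forall x, x1 <= x <= x2 -> B (x, y2) = 0) ->
  I2 x1 x2 y1 y2 (fun z => Ax z + By z) = - I1 x1 x2 (fun x => B (x, y1)).
Proof.
move=> CA CB A1 A2 B2; rewrite (I2D oU KU (C1cx CA) (C1cy CB)).
rewrite (I2_dx CA) (I2_dy CB).
rewrite (@eq_I1 _ y1 y2 _ (fun=> 0)) ?I1_cst ?mul0r ?add0r//; last first.
  by move=> y yy; rewrite A1// A2// subrr.
rewrite -mulN1r -I1Zl; last first.
  by apply: integrable1; apply: (cts1_slicex KU (C1c CB)); rewrite lexx.
by apply: eq_I1 => x xx; rewrite B2// sub0r mulN1r.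
Qed.

Lemma I2_eq0 h : cts U h -> x1 < x2 -> y1 < y2 ->
  (forall z, rect x1 x2 y1 y2 z -> 0 <= h z) ->
  I2 x1 x2 y1 y2 h <= 0 -> forall z, rect x1 x2 y1 y2 z -> h z = 0.
Proof.
move=> ch x12' y12' h0 Ih z Kz; apply/eqP; rewrite eq_le h0// andbT leNgt.
apply/negP => hz; move: Ih; apply/negP; rewrite -ltNge.
have hz2 : 0 < h z / 2 by rewrite divr_gt0.
have [d d0 hd] := compact_cts_unif (@compact_rect _ _ _ _ _) (ctsS KU ch) hz2.
have /rectP[/andP[zx1 zx2] /andP[zy1 zy2]] := Kz.
(* A box around [z] clipped to the rectangle: it keeps positive area even when [z] lies on a
   side. *)
pose a := Num.max x1 (z.1 - d / 2); pose b := Num.min x2 (z.1 + d / 2).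
pose c := Num.max y1 (z.2 - d / 2); pose e := Num.min y2 (z.2 + d / 2).
have d20 : 0 < d / 2 by rewrite divr_gt0.
have ab : a < b.
  by rewrite /a /b gt_max !lt_min x12'/=; apply/andP; split; [|apply/andP; split]; lra.
have ce : c < e.
  by rewrite /c /e gt_max !lt_min y12'/=; apply/andP; split; [|apply/andP; split]; lra.
apply: (@lt_le_trans _ _ (I2 a b c e h)); last first.
  apply: (I2_subset oU KU) => //.
  - by rewrite /a le_max lexx.
  - by rewrite /b ge_min lexx.
  - by rewrite /c le_max lexx.
  - by rewrite /e ge_min lexx.
have sub : rect a b c e `<=` rect x1 x2 y1 y2.
  move=> w /rectP[/andP[+ +] /andP[+ +]].
  rewrite /a /b /c /e !ge_max !le_min => /andP[? ?] /andP[? ?] /andP[? ?] /andP[? ?].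
  by apply/rectP; split; apply/andP.
apply: (@lt_le_trans _ _ (I2 a b c e (fun=> h z / 2))).
  by rewrite I2_cst ?ltW// mulr_gt0// mulr_gt0// subr_gt0.
apply: (I2_le oU (subset_trans sub KU) (@cts_cst _ _ _) ch) => w Kw.
have /rectP[/andP[+ +] /andP[+ +]] := Kw.
rewrite /a /b /c /e !ge_max !le_min => /andP[_ w1] /andP[_ w2] /andP[_ w3] /andP[_ w4].
have : `|h w - h z| <= h z / 2.
  by apply: hd => //; rewrite ltr_norml; apply/andP; split; lra.
by rewrite ler_norml => /andP[+ _]; lra.
Qed.

(** Both mixed derivatives integrate to the same alternating sum of [f] over the four corners. *)
Lemma clairaut_rect f (fx fy fxx fxy fyx fyy : R * R -> R) :
  C1 U f fx fy -> C1 U fx fxx fxy -> C1 U fy fyx fyy ->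
  I2 x1 x2 y1 y2 (fun z => fxy z - fyx z) = 0.
Proof.
move=> C Cx Cy; rewrite (I2B oU KU (C1cy Cx) (C1cx Cy)).
rewrite (I2_dy Cx) (I2_dx Cy).
have y1y : y1 <= y1 <= y2 by rewrite lexx.
have y2y : y1 <= y2 <= y2 by rewrite lexx andbT.
have x1x : x1 <= x1 <= x2 by rewrite lexx.
have x2x : x1 <= x2 <= x2 by rewrite lexx andbT.
rewrite I1B; [|exact/integrable1/(cts1_slicex KU (C1cx C))..].
rewrite I1B; [|exact/integrable1/(cts1_slicey KU (C1cy C))..].
rewrite !(FTCx x12 C) ?(FTCy y12 C); first ring.
all: by move=> t tt; apply: KU; apply/rectP.
Qed.

End RectIdentities.

Lemma clairaut (R : realType) (U : set (R * R)) f (fx fy fxx fxy fyx fyy : R * R -> R) :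
  open U -> C1 U f fx fy -> C1 U fx fxx fxy -> C1 U fy fyx fyy ->
  forall z, U z -> fxy z = fyx z.
Proof.
move=> oU C Cx Cy.
(* One inequality suffices, used in both orders: were [g > k] at a point, a small rectangle with
   that corner would carry a positive integral. *)
suff key (g k : R * R -> R) : cts U g -> cts U k ->
    (forall x1 x2 y1 y2, x1 <= x2 -> y1 <= y2 -> rect x1 x2 y1 y2 `<=` U ->
      I2 x1 x2 y1 y2 (fun z => g z - k z) = 0) -> forall z, U z -> g z <= k z.
  move=> z Uz; apply/eqP; rewrite eq_le; apply/andP; split.
    apply: key Uz => [||x1 x2 y1 y2 x12 y12 KU]; [exact: C1cy Cx|exact: C1cx Cy|].
    exact: (clairaut_rect oU KU x12 y12 C Cx Cy).
  apply: key Uz => [||x1 x2 y1 y2 x12 y12 KU]; [exact: C1cx Cy|exact: C1cy Cx|].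
  rewrite (@eq_I2 _ _ _ _ _ _ (fun z => -1 * (fxy z - fyx z))); last by move=> w _; ring.
  rewrite (I2Zl oU KU _ (ctsB (C1cy Cx) (C1cx Cy))).
  by rewrite (clairaut_rect oU KU x12 y12 C Cx Cy) mulr0.
move=> cg ck H [x y] Uz; rewrite leNgt; apply/negP => kg.
have gk0 : 0 < g (x, y) - k (x, y) by rewrite subr_gt0.
have cgk := ctsB cg ck.
have pos : \forall w \near (x, y), 0 < g w - k w.
  by have /cvgr_gt := cgk _ Uz; apply.
have : nbhs (x, y) (U `&` [set w | 0 < g w - k w]).
  by apply: filterI => //; exact: open_nbhs_nbhs.
move=> -[[A B] /= [/nbhs_ballP[d1 /= d10 A1] /nbhs_ballP[d2 /= d20 B2]] AB].
have h1 : 0 < d1 / 2 by rewrite divr_gt0.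
have h2 : 0 < d2 / 2 by rewrite divr_gt0.
have sub : rect x (x + d1 / 2) y (y + d2 / 2) `<=` U `&` [set w | 0 < g w - k w].
  move=> [s t] /rectP[/= /andP[s1 s2] /andP[t1 t2]]; apply: AB; split => /=.
    by apply: A1; rewrite /ball/= ltr_norml; apply/andP; split; lra.
  by apply: B2; rewrite /ball/= ltr_norml; apply/andP; split; lra.
have KU : rect x (x + d1 / 2) y (y + d2 / 2) `<=` U by move=> w /sub[].
have x12 : x < x + d1 / 2 by rewrite ltrDl.
have y12 : y < y + d2 / 2 by rewrite ltrDl.
have Kz : rect x (x + d1 / 2) y (y + d2 / 2) (x, y).
  by apply/rectP; rewrite /= !lexx !ltW.
have E : I2 x (x + d1 / 2) y (y + d2 / 2) (fun z => g z - k z) <= 0.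
  by rewrite H// ltW.
have := I2_eq0 oU KU cgk x12 y12 (fun w Kw => ltW (sub w Kw).2) E Kz.
by move/eqP; rewrite gt_eqF.
Qed.

(** * The square of the positive part *)

Section Pos.
Variable R : realType.

Definition pos (s : R) : R := Num.max s 0.

Lemma pos_ge0 s : 0 <= pos s. Proof. by rewrite /pos le_max lexx orbT. Qed.

Lemma posM s : pos s * s = pos s ^+ 2.
Proof. by rewrite /pos expr2; case: (leP s 0) => [s0|//]; rewrite !mul0r. Qed.

Lemma pos_eq0 s : s <= 0 -> pos s = 0. Proof. by move=> s0; rewrite /pos max_r. Qed.

Lemma pos_continuous : continuous pos.
Proof. by move=> s; apply: continuous_max; [exact: cvg_id|exact: cvg_cst]. Qed.

(** Squaring removes the kink of the positive part, so that [(w - k)_+ ^ 2] is a C1 test function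
    although [w] is only C1. *)
Lemma is_derive_pos2 (s : R) : is_derive s (1 : R) (fun t => pos t ^+ 2) (2 * pos s).
Proof.
have [s0|s0|->] := ltgtP s 0.
- rewrite pos_eq0 ?ltW// mulr0.
  apply: (near_eq_is_derive _ (is_derive_cst (0 : R) s (1 : R))).
  by near=> t; rewrite pos_eq0 ?expr0n//= ltW//; near: t; exact: lt_nbhsl.
- have posE t : 0 < t -> pos t = t by move=> t0; rewrite /pos max_l// ltW.
  rewrite posE//; have h : is_derive s (1 : R) (fun t : R => t * t) (2 * s).
    have := is_deriveM (is_derive_id s (1 : R)) (is_derive_id s (1 : R)).
    by move/is_derive_eq; apply; rewrite /GRing.scale/=; ring.
  apply: (near_eq_is_derive _ h).
  by near=> t; rewrite posE ?expr2//; near: t; exact: lt_nbhsr.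
(* At the origin the difference quotient of the square is [pos] itself, which is continuous and
   vanishes there. *)
- rewrite pos_eq0// mulr0; apply/is_derive1_caratheodory; exists pos; split.
  + by move=> t; rewrite (pos_eq0 (lexx 0)) expr0n/= !subr0 posM.
  + exact: pos_continuous.
  + exact: pos_eq0.
Unshelve. all: by end_near. Qed.

End Pos.

(** * Maximum principle and energy estimates for the vorticity *)

Section Flow.
Variable R : realType.
Variable U : set (R * R).
Hypothesis oU : open U.
Variables (u ux uy V Vx Vy w wx wy P : R * R -> R).
Hypothesis Cu : C1 U u ux uy.
Hypothesis CV : C1 U V Vx Vy.
Hypothesis Cw : C1 U w wx wy.
Hypothesis CP : C1 U P (fun z => wy z - V z * w z) (fun z => - wx z + u z * w z).
Hypothesis div0 : forall z, U z -> ux z + Vy z = 0.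

Let cu := C1c Cu. Let cux := C1cx Cu. Let cuy := C1cy Cu.
Let cV := C1c CV. Let cVx := C1cx CV. Let cVy := C1cy CV.
Let cw := C1c Cw. Let cwx := C1cx Cw. Let cwy := C1cy Cw.

Variables x1 x2 y1 y2 : R.
Hypothesis KU : rect x1 x2 y1 y2 `<=` U.

(* Green's identity with [phi = (w - k)_+ ^ 2]; the transport term is the
   divergence of [pos (w - k) ^ 2 * (k + 2/3 * pos (w - k))] times the flow. *)
Lemma max_principle (k : R) : x1 < x2 -> y1 < y2 ->
  (forall y, y1 <= y <= y2 -> w (x1, y) <= k) ->
  (forall y, y1 <= y <= y2 -> w (x2, y) <= k) ->
  (forall x, x1 <= x <= x2 -> w (x, y1) <= k) ->
  (forall x, x1 <= x <= x2 -> w (x, y2) <= k) ->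
  forall z, rect x1 x2 y1 y2 z -> w z <= k.
Proof.
move=> x12 y12 wl wr wb wt.
have x12' := ltW x12; have y12' := ltW y12.
have cpos (c : R) : continuous (fun s : R => c * pos (s - k)).
  move=> s; apply: cvgM; first exact: cvg_cst.
  apply: (@continuous_comp _ _ _ (fun s => s - k) (@pos R)).
    by apply: cvgB; [exact: cvg_id|exact: cvg_cst].
  exact: pos_continuous.
pose G (s : R) : R := pos (s - k) ^+ 2.
pose dG (s : R) : R := 2 * pos (s - k).
have DG s : is_derive s (1 : R) G (dG s).
  have h : is_derive s (1 : R) (fun t : R => t - k) 1.
    have := is_deriveB (is_derive_id s (1 : R)) (is_derive_cst k s (1 : R)).
    by move/is_derive_eq; apply; rewrite subr0.
  have := @is_derive1_comp _ (fun t => pos t ^+ 2) (fun t => t - k) s _ _ (is_derive_pos2 (s - k)) h.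
  by move/is_derive_eq; apply; rewrite mulr1.
pose H (s : R) : R := G s * (k + 2 / 3 * (s - k)).
pose dH (s : R) : R := dG s * s.
have DH s : is_derive s (1 : R) H (dH s).
  have h : is_derive s (1 : R) (fun t : R => k + 2 / 3 * (t - k)) (2 / 3).
    have h0 := is_deriveB (is_derive_id s (1 : R)) (is_derive_cst k s (1 : R)).
    have := is_deriveD (is_derive_cst k s (1 : R)) (is_deriveZ (2 / 3) h0).
    by move/is_derive_eq; apply; rewrite subr0 add0r [_ *: _]mulr1.
  have := is_deriveM (DG s) h.
  move/is_derive_eq; apply; rewrite /GRing.scale/= /dH /dG /G.
  have := posM (s - k); set q := pos (s - k) => E.
  by rewrite -E; field.
have cdH : continuous dH by move=> s; apply: cvgM; [exact: cpos|exact: cvg_id].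
have Cphi := C1_comp Cw DG (cpos 2).
have CH := C1_comp Cw DH cdH.
have G0 s : s <= k -> G s = 0 by move=> sk; rewrite /G pos_eq0 ?expr0n// subr_le0.
have H0 s : s <= k -> H s = 0 by move=> sk; rewrite /H G0// mul0r.
have E1 := green oU KU y12' CP Cphi x12' _ _ _.
have E1' := E1 (fun y yy => G0 _ (wl y yy)) (fun y yy => G0 _ (wr y yy)) (fun x xx => G0 _ (wt x xx)).
have E2 := divergence_theorem oU KU x12' y12' (C1M Cu CH) (C1M CV CH) _ _ _.
have {E2} E2 : I2 x1 x2 y1 y2 (fun z => ux z * H (w z) + u z * (dH (w z) * wx z) +
   (Vy z * H (w z) + V z * (dH (w z) * wy z))) = 0.
  rewrite E2.
  - rewrite (@eq_I1 _ _ _ _ (fun=> 0)) ?I1_cst ?mul0r ?oppr0// => x xx.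
    by rewrite H0 ?mulr0//; exact: wb.
  - by move=> y yy; rewrite H0 ?mulr0//; exact: wl.
  - by move=> y yy; rewrite H0 ?mulr0//; exact: wr.
  - by move=> x xx; rewrite H0 ?mulr0//; exact: wt.
move: E1'; rewrite (@eq_I1 _ _ _ _ (fun=> 0)) ?I1_cst ?mul0r ?oppr0//; last first.
  by move=> x xx; rewrite G0 ?mulr0//; exact: wb.
move=> {}E1.
have cdG := C1cx Cphi. have cdG2 := C1cy Cphi.
have cdHx := C1cx CH. have cdHy := C1cy CH. have cH := C1c CH.
have cdGw : cts U (fun z => dG (w z)) by exact: (cts_comp (cpos 2) (C1c Cw)).
have cE : cts U (fun z => dG (w z) * (wx z ^+ 2 + wy z ^+ 2)).
  by apply: ctsM => //; apply: ctsD; exact: ctsX.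
have E : I2 x1 x2 y1 y2 (fun z => dG (w z) * (wx z ^+ 2 + wy z ^+ 2)) = 0.
  rewrite -(addr0 0) -{1}E1 -E2 -(I2D oU KU); last 2 first.
  - by cts_tac.
  - by apply: ctsD; apply: ctsD; exact: ctsM.
  apply: eq_I2 => z Kz; have d0 := div0 (KU Kz).
  have -> : Vy z = - ux z by lra.
  by rewrite /dH; ring.
have Z := I2_eq0 oU KU cE x12 y12 _ _.
have {}Z z : rect x1 x2 y1 y2 z -> dG (w z) * (wx z ^+ 2 + wy z ^+ 2) = 0.
  apply: Z; last by rewrite E.
  move=> z' _; apply: mulr_ge0; first by rewrite mulr_ge0// pos_ge0.
  by rewrite addr_ge0// sqr_ge0.
move=> [x y] /rectP[/= xx yy]; have /andP[x1x xx2] := xx.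
(* The [x]-derivative of [G (w)] is [dG (w) * wx], a product in which one factor vanishes at each
   point; hence [G (w)] keeps along the row its value on the left side, which is zero. *)
have := FTCx x1x Cphi _; move=> /(_ y).
rewrite (@eq_I1 _ _ _ _ (fun=> 0)) ?I1_cst ?mul0r//; last first.
  move=> t /andP[t1 t2]; have Kt : rect x1 x2 y1 y2 (t, y).
    by apply/rectP; rewrite /= t1 (le_trans t2).
  have /eqP := Z _ Kt; rewrite mulf_eq0 => /orP[/eqP ->|]; first by rewrite mul0r.
  by rewrite paddr_eq0 ?sqr_ge0// sqrf_eq0 => /andP[/eqP -> _]; rewrite mulr0.
rewrite (G0 (w (x1, y))); last exact: wl.
move=> Gxy; have {Gxy}/eqP : 0 = G (w (x, y)).
  rewrite -[RHS]subr0; apply: Gxy => t /andP[t1 t2]; apply: KU; apply/rectP.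
  by rewrite /= t1 (le_trans t2).
rewrite eq_sym sqrf_eq0 /pos => /eqP h.
have : w (x, y) - k <= 0 by rewrite -h le_max lexx.
by rewrite subr_le0.
Qed.

Variables (zeta zx zy : R * R -> R).
Hypothesis Cz : C1 U zeta zx zy.
Hypothesis x12 : x1 <= x2.
Hypothesis y12 : y1 <= y2.
Hypothesis zl : forall y, y1 <= y <= y2 -> zeta (x1, y) = 0.
Hypothesis zr : forall y, y1 <= y <= y2 -> zeta (x2, y) = 0.
Hypothesis zt : forall x, x1 <= x <= x2 -> zeta (x, y2) = 0.

Let cz := C1c Cz. Let czx := C1cx Cz. Let czy := C1cy Cz.

Let Cz2 : C1 U (fun z => zeta z ^+ 2) (fun z => 2 * zeta z * zx z) (fun z => 2 * zeta z * zy z).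
Proof.
by apply: (eq_C1 (C1M Cz Cz)) => z; ring.
Qed.

Let bottom_le (b : R * R -> R) (e : R) : cts U b ->
  (forall x, x1 <= x <= x2 -> `|b (x, y1)| <= e) ->
  `|I1 x1 x2 (fun x => b (x, y1))| <= e * (x2 - x1).
Proof.
move=> cb be.
have ib : lebesgue_measure.-integrable `[x1, x2] (EFin \o (fun x => b (x, y1))).
  by apply/integrable1/(cts1_slicex KU cb); rewrite lexx.
apply: (le_trans (I1_norm ib)); rewrite -I1_cst//; apply: I1_le => //.
- exact: (integrable_norm ib).
- by apply: integrable1; apply: cts1_at => ? _; exact: cst_continuous.
Qed.

(** The test function is [zeta^2 w], and half the divergence of [zeta^2 w^2 (u, V)] is added to
    remove derivatives of [w] from the transport term. As [zeta] may be nonzero on the bottom side,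
    two bottom integrals survive; up to sign they combine into the integral of the quantity bounded
    by [e]. *)
Lemma caccioppoli (e : R) :
  (forall x, x1 <= x <= x2 ->
    `|zeta (x, y1) ^+ 2 * (w (x, y1) * (wy (x, y1) - V (x, y1) * w (x, y1) / 2))| <= e) ->
  I2 x1 x2 y1 y2 (fun z => zeta z ^+ 2 * (wx z ^+ 2 + wy z ^+ 2)) <=
  4 * I2 x1 x2 y1 y2 (fun z => w z ^+ 2 * (zx z ^+ 2 + zy z ^+ 2)) +
  2 * I2 x1 x2 y1 y2 (fun z => `|zeta z| * w z ^+ 2 * `|u z * zx z + V z * zy z|) +
  2 * (e * (x2 - x1)).
Proof.
move=> be.
have z2l y : y1 <= y <= y2 -> zeta (x1, y) ^+ 2 = 0 by move=> yy; rewrite zl// expr0n.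
have z2r y : y1 <= y <= y2 -> zeta (x2, y) ^+ 2 = 0 by move=> yy; rewrite zr// expr0n.
have z2t x : x1 <= x <= x2 -> zeta (x, y2) ^+ 2 = 0 by move=> yy; rewrite zt// expr0n.
have Cphi := C1M Cz2 Cw.
have E1 : I2 x1 x2 y1 y2 (fun z => (wy z - V z * w z) * (2 * zeta z * zy z * w z + zeta z ^+ 2 * wy z)
   - (- wx z + u z * w z) * (2 * zeta z * zx z * w z + zeta z ^+ 2 * wx z)) =
   - I1 x1 x2 (fun x => (wy (x, y1) - V (x, y1) * w (x, y1)) * (zeta (x, y1) ^+ 2 * w (x, y1))).
  apply: (green oU KU y12 CP Cphi x12).
  - by move=> y yy; rewrite z2l// mul0r.
  - by move=> y yy; rewrite z2r// mul0r.
  - by move=> y yy; rewrite z2t// mul0r.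
have Cw2 := C1M Cw Cw.
have CA := C1M Cz2 (C1M Cu Cw2). have CB := C1M Cz2 (C1M CV Cw2).
have E2 := divergence_theorem oU KU x12 y12 CA CB _ _ _.
have {}E2 := E2 (fun y yy => etrans (congr1 (fun t => t * _) (z2l y yy)) (mul0r _))
  (fun y yy => etrans (congr1 (fun t => t * _) (z2r y yy)) (mul0r _))
  (fun y yy => etrans (congr1 (fun t => t * _) (z2t y yy)) (mul0r _)).
have cb1 : cts U (fun z => (wy z - V z * w z) * (zeta z ^+ 2 * w z)) by cts_tac.
have cb2 : cts U (fun z => zeta z ^+ 2 * (V z * (w z * w z))) by cts_tac.
have ci := cts1_slicex KU _ _.
have y1y : y1 <= y1 <= y2 by rewrite lexx.
have i1 := integrable1 (ci _ y1 cb1 y1y); have i2 := integrable1 (ci _ y1 cb2 y1y).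
pose b z := zeta z ^+ 2 * (w z * (wy z - V z * w z / 2)).
have cb : cts U b by rewrite /b; cts_tac.
have B : - I1 x1 x2 (fun x => (wy (x, y1) - V (x, y1) * w (x, y1)) * (zeta (x, y1) ^+ 2 * w (x, y1)))
   + 2^-1 * - I1 x1 x2 (fun x => zeta (x, y1) ^+ 2 * (V (x, y1) * (w (x, y1) * w (x, y1))))
   <= e * (x2 - x1).
  have := bottom_le cb be; rewrite ler_norml => /andP[+ _].
  rewrite (@eq_I1 _ _ _ _ (fun x => (wy (x, y1) - V (x, y1) * w (x, y1)) * (zeta (x, y1) ^+ 2 * w (x, y1))
    + 2^-1 * (zeta (x, y1) ^+ 2 * (V (x, y1) * (w (x, y1) * w (x, y1)))))); last first.
    by move=> x _; rewrite /b; field.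
  rewrite I1D//; last by exact: (integrable1 (ci _ y1 (ctsM (@cts_cst _ _ 2^-1) cb2) y1y)).
  by rewrite I1Zl//; lra.
rewrite -E1 -E2 in B.
set g1 := (fun z => _ - _) in B; set g2 := (X in 2^-1 * I2 _ _ _ _ X) in B.
have cg1 : cts U g1 by rewrite /g1; cts_tac.
have cg2 : cts U g2 by rewrite /g2; cts_tac.
have cab : cts U (fun z => `|zeta z| * w z ^+ 2 * `|u z * zx z + V z * zy z|) by cts_tac.
have cgr : cts U (fun z => w z ^+ 2 * (zx z ^+ 2 + zy z ^+ 2)) by cts_tac.
have clhs : cts U (fun z => zeta z ^+ 2 * (wx z ^+ 2 + wy z ^+ 2)) by cts_tac.
have chalf : cts U (fun z => 2^-1 * g2 z) by cts_tac.
have c2gr : cts U (fun z => 2 * (w z ^+ 2 * (zx z ^+ 2 + zy z ^+ 2))) by cts_tac.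
have c2lhs : cts U (fun z => 2^-1 * (zeta z ^+ 2 * (wx z ^+ 2 + wy z ^+ 2))) by cts_tac.
have : I2 x1 x2 y1 y2 (fun z => 2^-1 * (zeta z ^+ 2 * (wx z ^+ 2 + wy z ^+ 2))) <=
  I2 x1 x2 y1 y2 (fun z => (g1 z + 2^-1 * g2 z) +
    (`|zeta z| * w z ^+ 2 * `|u z * zx z + V z * zy z| +
     2 * (w z ^+ 2 * (zx z ^+ 2 + zy z ^+ 2)))).
  apply: (I2_le oU KU c2lhs); first by cts_tac.
  move=> z Kz; have d0 : Vy z = - ux z by have := div0 (KU Kz); lra.
  rewrite -subr_ge0.
  have abs : 0 <= `|zeta z| * w z ^+ 2 * `|u z * zx z + V z * zy z| - zeta z * w z ^+ 2 * (u z * zx z + V z * zy z).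
    rewrite subr_ge0; apply: (le_trans (ler_norm _)).
    by rewrite 2!normrM (ger0_norm (sqr_ge0 _)).
  (* Young's inequality as completed squares: the cross terms cost half of the energy and
     [2 w^2 |grad zeta|^2]. Doubling gives the constants 4 and 2. *)
  rewrite (_ : _ - _ = 2^-1 * (zeta z * wx z + 2 * w z * zx z) ^+ 2 +
    2^-1 * (zeta z * wy z + 2 * w z * zy z) ^+ 2 +
    (`|zeta z| * w z ^+ 2 * `|u z * zx z + V z * zy z| - zeta z * w z ^+ 2 * (u z * zx z + V z * zy z))).
    by rewrite addr_ge0// addr_ge0// mulr_ge0 ?sqr_ge0 ?invr_ge0.
  rewrite /g1 /g2 d0; move: `|_| `|_| => p q; by field.
rewrite (I2Zl oU KU _ clhs) (I2D oU KU (ctsD cg1 chalf) (ctsD cab c2gr)).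
rewrite (I2D oU KU cg1 chalf) (I2D oU KU cab c2gr) (I2Zl oU KU _ cg2) (I2Zl oU KU _ cgr).
by move=> H; lra.
Qed.

(** Green's identity with [P = ux] and [phi = zeta^2 uy] produces the determinant [uxx uyy - uxy^2]
    without third derivatives. Substituting [uyy = wy - uxx] turns it into
    [- uxx^2 - uxy^2 + uxx wy], so the derivative [wy] alone controls [uxx] and [uxy], up to cutoff
    and bottom terms. *)
Lemma hessian_estimate (uxx uxy uyx uyy : R * R -> R) (e : R) :
  C1 U ux uxx uxy -> C1 U uy uyx uyy ->
  (forall z, U z -> uxx z + uyy z = wy z) ->
  (forall x, x1 <= x <= x2 ->
    `|zeta (x, y1) ^+ 2 * (uxx (x, y1) * uy (x, y1))| <= e) ->
  I2 x1 x2 y1 y2 (fun z => zeta z ^+ 2 * (uxx z ^+ 2 + uxy z ^+ 2)) <=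
  2 * I2 x1 x2 y1 y2 (fun z => zeta z ^+ 2 * wy z ^+ 2) +
  8 * I2 x1 x2 y1 y2 (fun z => uy z ^+ 2 * (zx z ^+ 2 + zy z ^+ 2)) +
  2 * (e * (x2 - x1)).
Proof.
move=> Cux Cuy lap be.
have sch := clairaut oU Cu Cux Cuy.
have cuxx := C1cx Cux; have cuxy := C1cy Cux; have cuyx := C1cx Cuy; have cuyy := C1cy Cuy.
have Cphi := C1M Cz2 Cuy.
have E1 : I2 x1 x2 y1 y2 (fun z => uxx z * (2 * zeta z * zy z * uy z + zeta z ^+ 2 * uyy z)
   - uxy z * (2 * zeta z * zx z * uy z + zeta z ^+ 2 * uyx z)) =
   - I1 x1 x2 (fun x => uxx (x, y1) * (zeta (x, y1) ^+ 2 * uy (x, y1))).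
  apply: (green oU KU y12 Cux Cphi x12).
  - by move=> y yy; rewrite zl// expr0n mul0r.
  - by move=> y yy; rewrite zr// expr0n mul0r.
  - by move=> x xx; rewrite zt// expr0n mul0r.
pose b z := zeta z ^+ 2 * (uxx z * uy z).
have cb : cts U b by rewrite /b; cts_tac.
have := bottom_le cb be; rewrite ler_norml => /andP[_].
rewrite (@eq_I1 _ _ _ _ (fun x => uxx (x, y1) * (zeta (x, y1) ^+ 2 * uy (x, y1)))); last first.
  by move=> x _; rewrite /b; ring.
move=> B; have {E1}E1 := congr1 -%R E1; rewrite opprK in E1; rewrite -E1 in B.
set g1 := (X in - I2 _ _ _ _ X) in B.
have cg1 : cts U g1 by rewrite /g1; cts_tac.
have ca : cts U (fun z => zeta z ^+ 2 * wy z ^+ 2) by cts_tac.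
have cgr : cts U (fun z => uy z ^+ 2 * (zx z ^+ 2 + zy z ^+ 2)) by cts_tac.
have clhs : cts U (fun z => zeta z ^+ 2 * (uxx z ^+ 2 + uxy z ^+ 2)) by cts_tac.
have c1 : cts U (fun z => -1 * g1 z) by cts_tac.
have c4gr : cts U (fun z => 4 * (uy z ^+ 2 * (zx z ^+ 2 + zy z ^+ 2))) by cts_tac.
have c2lhs : cts U (fun z => 2^-1 * (zeta z ^+ 2 * (uxx z ^+ 2 + uxy z ^+ 2))) by cts_tac.
have : I2 x1 x2 y1 y2 (fun z => 2^-1 * (zeta z ^+ 2 * (uxx z ^+ 2 + uxy z ^+ 2))) <=
  I2 x1 x2 y1 y2 (fun z => -1 * g1 z +
    (zeta z ^+ 2 * wy z ^+ 2 + 4 * (uy z ^+ 2 * (zx z ^+ 2 + zy z ^+ 2)))).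
  apply: (I2_le oU KU c2lhs); first by cts_tac.
  move=> z Kz; have Uz := KU Kz.
  have l : uyy z = wy z - uxx z by have := lap _ Uz; lra.
  rewrite -subr_ge0 /g1 -(sch _ Uz) l.
  rewrite (_ : _ - _ =
    (2^-1 * zeta z * uxx z - zeta z * wy z) ^+ 2 +
    (2^-1 * zeta z * uxx z - 2 * uy z * zy z) ^+ 2 +
    (2^-1 * zeta z * uxy z + 2 * uy z * zx z) ^+ 2 +
    4^-1 * (zeta z * uxy z) ^+ 2); last by field.
  by rewrite !addr_ge0 ?sqr_ge0// mulr_ge0 ?sqr_ge0 ?invr_ge0.
rewrite (I2Zl oU KU _ clhs) (I2D oU KU c1 (ctsD ca c4gr)).
rewrite (I2D oU KU ca c4gr) (I2Zl oU KU _ cg1) (I2Zl oU KU _ cgr).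
by move=> H; lra.
Qed.

End Flow.

(** * Growth of functions with finite Dirichlet integral *)

Section Mass.
Variable R : realType.
Notation mu2 := (@lebesgue_measure R \x @lebesgue_measure R)%E.
Variable U : set (R * R).
Hypothesis oU : open U.
Variable g : R * R -> R.
Hypothesis cg : cts U g.
Hypothesis g0 : forall z, U z -> 0 <= g z.
Hypothesis gfin : (\int[mu2]_(z in U) (g z)%:E < +oo)%E.

Definition mass (A : set (R * R)) : R := \int[mu2]_(z in A) g z.

Let mU : measurable U. Proof. exact: open_measurable2. Qed.

Let mg A : A `<=` U -> measurable_fun A (EFin \o g).
Proof.
move=> AU; apply/measurable_EFinP; apply: (measurable_funS mU AU).
exact: cts_measurable.
Qed.

Let finA A : measurable A -> A `<=` U -> (\int[mu2]_(z in A) (g z)%:E)%E \is a fin_num.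
Proof.
move=> mA AU; rewrite ge0_fin_numE; last first.
  by apply: integral_ge0 => z /AU Uz; rewrite lee_fin g0.
apply: le_lt_trans gfin; apply: ge0_subset_integral => //; exact: mg.
Qed.

Lemma massE A : measurable A -> A `<=` U ->
  (mass A)%:E = (\int[mu2]_(z in A) (g z)%:E)%E.
Proof. by move=> mA AU; rewrite /mass /Rintegral fineK//; exact: finA. Qed.

Lemma mass_ge0 A : A `<=` U -> 0 <= mass A.
Proof. by move=> AU; apply: Rintegral_ge0 => z /AU; exact: g0. Qed.

Lemma mass_le A B : measurable A -> measurable B -> A `<=` B -> B `<=` U ->
  mass A <= mass B.
Proof.
move=> mA mB AB BU; have AU := subset_trans AB BU.
rewrite -lee_fin !massE//.
by apply: ge0_subset_integral => //; [exact: mg|move=> z /BU Uz; rewrite lee_fin g0].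
Qed.

Lemma mass_setU A B C : measurable A -> measurable B -> measurable C ->
  A `<=` C -> B `<=` C -> C `<=` U -> A `&` B = set0 -> mass A + mass B <= mass C.
Proof.
move=> mA mB mC AC BC CU AB0.
have AU := subset_trans AC CU; have BU := subset_trans BC CU.
have ABU : A `|` B `<=` U by move=> z [/AU|/BU].
have mAB := measurableU _ _ mA mB.
rewrite -lee_fin EFinD !massE// -ge0_integral_setU//.
- by rewrite -!massE// lee_fin; apply: mass_le => // z [/AC|/BC].
- exact: mg.
- by move=> z /ABU Uz; rewrite lee_fin g0.
- by apply/disj_set2P.
Qed.

Lemma I2_mass x1 x2 y1 y2 : I2 x1 x2 y1 y2 g = mass (rect x1 x2 y1 y2).
Proof. by []. Qed.

Lemma I2_le_mass x1 x2 y1 y2 : rect x1 x2 y1 y2 `<=` U ->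
  I2 x1 x2 y1 y2 g <= mass U.
Proof. by move=> KU; rewrite I2_mass; apply: mass_le => //; exact: measurable_rect. Qed.

Lemma open_half (c : R) : open [set z : R * R | z.2 < c].
Proof.
apply: (@open_comp _ _ (fun z : R * R => z.2) [set y : R | y < c]).
  by move=> z _; exact: cvg_snd.
exact: open_lt.
Qed.

Lemma measurable_below (c : R) : measurable (U `&` [set z : R * R | z.2 < c]).
Proof. by apply: open_measurable2; apply: openI => //; exact: open_half. Qed.

(** Box [k] lies between the height sublevels [A k] and [A k.+3], so the boxes cover any point at
    most three times and their masses sum uniformly in [N]. *)
Lemma mass_telescope (c : R) (a b : nat -> R) (N : nat) :
  (forall k, rect (a k) (b k) (c + 2 ^+ k) (c + 2 ^+ k.+2) `<=` U) ->
  \sum_(k < N) I2 (a k) (b k) (c + 2 ^+ k) (c + 2 ^+ k.+2) g <= 3 * mass U.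
Proof.
move=> KU; pose A k := U `&` [set z : R * R | z.2 < c + 2 ^+ k].
have mA k : measurable (A k) by exact: measurable_below.
have AU k : A k `<=` U by move=> z [].
have pow_lt (i j : nat) : (i < j)%N -> (2 : R) ^+ i < 2 ^+ j.
  by move=> ij; rewrite ltr_eXn2l// ltr1n.
have pow_le (i j : nat) : (i <= j)%N -> (2 : R) ^+ i <= 2 ^+ j.
  by move=> ij; rewrite ler_eXn2l// ltr1n.
(* The index is [k.+3] and not [k.+2] because the box contains its top side while the sublevels are
   strict. *)
have step k : I2 (a k) (b k) (c + 2 ^+ k) (c + 2 ^+ k.+2) g + mass (A k) <= mass (A k.+3).
  rewrite I2_mass; apply: mass_setU => //; first exact: measurable_rect.
  - move=> z Kz; split; first exact: KU Kz.
    move: Kz => /rectP[_ /andP[_ zk]] /=; apply: (le_lt_trans zk).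
    by rewrite ltrD2l; exact: pow_lt.
  - move=> z [Uz /= zk]; split => //=; apply: (lt_le_trans zk).
    by rewrite lerD2l; apply: pow_le; rewrite !leqW.
  - apply/seteqP; split => // z [/rectP[_ /andP[zk _]] [_ /= zk']].
    by move: zk'; rewrite ltNge zk.
have up k : mass (A k) <= mass U by apply: mass_le.
have lo k : 0 <= mass (A k) by exact: mass_ge0.
suff : \sum_(k < N) I2 (a k) (b k) (c + 2 ^+ k) (c + 2 ^+ k.+2) g <=
   mass (A N) + mass (A N.+1) + mass (A N.+2).
  by have := up N; have := up N.+1; have := up N.+2; lra.
elim: N => [|N IH]; first by rewrite big_ord0 !addr_ge0.
by rewrite big_ord_recr/=; have := step N; lra.
Qed.

(** Monotone convergence along the squares of half-side [n] leaves an arbitrarily small mass outside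
    a large square. This is the source of the little-o in the final rate. *)
Lemma mass_tail (e : R) : 0 < e -> exists2 r : R, 0 < r &
  forall x1 x2 y1 y2, rect x1 x2 y1 y2 `<=` U ->
    (forall z, rect x1 x2 y1 y2 z -> r < `|z.1| \/ r < `|z.2|) ->
    I2 x1 x2 y1 y2 g <= e.
Proof.
move=> e0; pose A (n : nat) := U `&` rect (- n%:R) n%:R (- n%:R) (n%:R : R).
have mA k : measurable (A k) by apply: measurableI => //; exact: measurable_rect.
have AU k : A k `<=` U by move=> z [].
have UA : \bigcup_n A n = U.
  apply/seteqP; split => [z [n _ []]//|z Uz].
  pose n := (Num.bound (`|z.1| + `|z.2|)).
  have : `|z.1| + `|z.2| < n%:R.
    by rewrite /n; apply: le_lt_trans (archi_boundP _); rewrite ?addr_ge0.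
  move=> zn; exists n => //; split => //; apply/rectP; rewrite -!ler_norml.
  by have := normr_ge0 z.1; have := normr_ge0 z.2; split; lra.
have h : (\int[mu2]_(x in A i) (g x)%:E @[i --> \oo] --> \int[mu2]_(x in U) (g x)%:E)%E.
  rewrite -[in X in _ --> X]UA; apply: ge0_nondecreasing_set_cvg_integral => //.
  - move=> n m nm; apply/subsetPset => z [Uz /rectP[/andP[h1 h2] /andP[h3 h4]]].
    have nm' : (n%:R : R) <= m%:R by rewrite ler_nat.
    by split => //; apply/rectP; split; apply/andP; split; lra.
  - by move=> n; exact: mg.
  - by move=> n z /AU Uz; rewrite lee_fin g0.
have hm : mass (A n) @[n --> \oo] --> mass U.
  have -> : (fun n => mass (A n)) = fine \o (fun n => \int[mu2]_(x in A n) (g x)%:E)%E by [].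
  by apply: fine_cvg; rewrite massE.
have /cvgrPdist_lt/(_ _ e0)[n _ /(_ n (leqnn n))/=] := hm.
have AnU : mass (A n) <= mass U by exact: mass_le.
rewrite ger0_norm ?subr_ge0// => hn.
exists (n%:R + 1) => // x1 x2 y1 y2 KU Kfar.
suff : I2 x1 x2 y1 y2 g + mass (A n) <= mass U by lra.
rewrite I2_mass; apply: mass_setU => //; first exact: measurable_rect.
apply/seteqP; split => // z [/Kfar zfar [_ /rectP]]; rewrite -!ler_norml => -[z1 z2].
by case: zfar; lra.
Qed.

End Mass.

(** * Geometry of the exterior half-plane *)

Section Domain.
Variable R : realType.
Variable r0 : R.
Hypothesis r0_gt0 : 0 < r0.
Local Notation Omega := (Omega0 r0).

Lemma radius_continuous : continuous (@Defs.radius R).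
Proof.
move=> z; apply: (@continuous_comp _ _ _ (fun z : R * R => z.1 ^+ 2 + z.2 ^+ 2) Num.sqrt).
  by apply: cvgD; apply: cvgM; (exact: cvg_fst || exact: cvg_snd).
exact: sqrt_continuous.
Qed.

Lemma open_Omega : open Omega.
Proof.
rewrite (_ : Omega = [set z : R * R | 0 < z.2] `&` [set z | r0 < Defs.radius z]) //.
apply: openI.
  apply: (@open_comp _ _ (fun z : R * R => z.2) [set y : R | 0 < y]).
    by move=> z _; exact: cvg_snd.
  exact: open_gt.
apply: (@open_comp _ _ (@Defs.radius R) [set y : R | r0 < y]).
  by move=> z _; exact: radius_continuous.
exact: open_gt.
Qed.

Lemma norm1_le_radius (z : R * R) : `|z.1| <= Defs.radius z.
Proof. by rewrite -sqrtr_sqr /Defs.radius ler_wsqrtr// lerDl sqr_ge0. Qed.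

Lemma norm2_le_radius (z : R * R) : `|z.2| <= Defs.radius z.
Proof. by rewrite -sqrtr_sqr /Defs.radius ler_wsqrtr// lerDr sqr_ge0. Qed.

Lemma rect_Omega (x1 x2 y1 y2 : R) : 0 < y1 ->
  [\/ r0 < x1, x2 < - r0 | r0 < y1] -> rect x1 x2 y1 y2 `<=` Omega.
Proof.
move=> y10 far z /rectP[/andP[z1 z2] /andP[z3 z4]]; split; first lra.
have h1 := norm1_le_radius z; have h2 := norm2_le_radius z.
have := ler_norm z.1; have := ler_norm (- z.1); have := ler_norm z.2.
by rewrite normrN; case: far => ?; lra.
Qed.

Lemma box_Omega (x0 y0 l m : R) : 0 < m -> y0 - l <= m ->
  r0 + l < `|x0| \/ r0 + l < y0 ->
  rect (x0 - l) (x0 + l) m (y0 + l) `<=` Omega.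
Proof.
move=> m0 ym far; apply: rect_Omega => //.
case: far => [|?]; last by apply: Or33; lra.
by have [x0p|x0n] := leP 0 x0; [rewrite ger0_norm// => ?; apply: Or31|rewrite ltr0_norm// => ?; apply: Or32]; lra.
Qed.

End Domain.

Lemma sqr_sum_le (R : realType) (a : nat -> R) (N : nat) :
  (\sum_(k < N) a k) ^+ 2 <= N%:R * \sum_(k < N) a k ^+ 2.
Proof.
elim: N => [|N IH]; first by rewrite !big_ord0 expr0n mul0r.
rewrite !big_ord_recr/=; case: N IH => [|N].
  by rewrite !big_ord0 !add0r mul1r.
set S := \sum_(_ < _) _; set Q := \sum_(_ < _) _ => IH.
have N0 : 0 < N.+1%:R :> R by rewrite ltr0n.
rewrite -natr1; set n := N.+1%:R in N0 IH *.
(* After multiplication by [n] this follows from [(S - n a)^2 >= 0] and the induction hypothesis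
   [S^2 <= n Q]. *)
suff : 2 * S * a N.+1 <= Q + n * a N.+1 ^+ 2 by move: IH; rewrite sqrrD; lra.
rewrite -(ler_pM2l N0).
have := sqr_ge0 (S - n * a N.+1); rewrite sqrrB !exprMn; move: IH; rewrite (expr2 n); lra.
Qed.

Lemma sqr_sum3 (R : realType) (a b c : R) :
  (a + b + c) ^+ 2 <= 3 * (a ^+ 2 + b ^+ 2 + c ^+ 2).
Proof.
have := sqr_ge0 (a - b); have := sqr_ge0 (a - c); have := sqr_ge0 (b - c).
by rewrite !sqrrB !sqrrD; lra.
Qed.

Lemma sqr_sum2 (R : realType) (a b : R) :
  (a + b) ^+ 2 <= 2 * (a ^+ 2 + b ^+ 2).
Proof. by have := sqr_ge0 (a - b); rewrite !sqrrB !sqrrD; lra. Qed.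

Lemma itv_widen (R : realType) (a b c d x : R) :
  a <= c -> d <= b -> c <= x <= d -> a <= x <= b.
Proof. by move=> ac db /andP[cx xd]; rewrite (le_trans ac cx) (le_trans xd db). Qed.

Lemma itv_shift (R : realType) (c P z : R) :
  0 <= c <= P -> 2 * P <= z <= 4 * P -> c + P <= z <= c + 2 * (2 * P).
Proof. by move=> /andP[? ?] /andP[? ?]; apply/andP; split; lra. Qed.

Lemma itv_double (R : realType) (x P : R) : - P <= x <= P ->
  - P <= x /\ x + P <= 2 * P.
Proof. by move=> /andP[? ?]; split; lra. Qed.

Section LogGrowth.
Variable R : realType.
Variable r0 : R.
Hypothesis r0_gt0 : 0 < r0.
Local Notation Omega := (Omega0 r0).
Variables f fx fy g : R * R -> R.
Hypothesis Cf : C1 Omega f fx fy.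
Hypothesis cg : cts Omega g.
Hypothesis g0 : forall z, Omega z -> 0 <= g z.
Hypothesis gfin : (\int[(@lebesgue_measure R \x @lebesgue_measure R)%E]_(z in Omega) (g z)%:E < +oo)%E.
Hypothesis fg : forall z, Omega z -> fx z ^+ 2 + fy z ^+ 2 <= g z.

Let oO : open Omega := @open_Omega R r0.
Let D := mass g Omega.
Let cfx := C1cx Cf.

Let D0 : 0 <= D. Proof. by apply: (mass_ge0 g0). Qed.

Let I2gD x1 x2 y1 y2 : rect x1 x2 y1 y2 `<=` Omega -> I2 x1 x2 y1 y2 g <= D.
Proof. exact: I2_le_mass. Qed.

Let goodline_x x1 x2 y1 y2 : rect x1 x2 y1 y2 `<=` Omega -> x1 <= x2 -> y1 <= y2 ->
  exists2 x, x1 <= x <= x2 &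
    I1 y1 y2 (fun y => fy (x, y) ^+ 2) * (x2 - x1) <= I2 x1 x2 y1 y2 g.
Proof.
move=> KO x12 y12; have cfy2 : cts Omega (fun z => fy z ^+ 2) by cts_tac.
have [x xx hx] := goodx oO KO y12 cfy2 x12; exists x => //.
apply: (le_trans hx); apply: (I2_le oO KO cfy2 cg) => z Kz.
by have := fg (KO z Kz); have := sqr_ge0 (fx z); lra.
Qed.

Let goodline_y x1 x2 y1 y2 : rect x1 x2 y1 y2 `<=` Omega -> x1 <= x2 -> y1 <= y2 ->
  exists2 y, y1 <= y <= y2 &
    I1 x1 x2 (fun x => fx (x, y) ^+ 2) * (y2 - y1) <= I2 x1 x2 y1 y2 g.
Proof.
move=> KO x12 y12; have cfx2 : cts Omega (fun z => fx z ^+ 2) by cts_tac.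
have [y yy hy] := goody oO KO x12 cfx2 y12; exists y => //.
apply: (le_trans hy); apply: (I2_le oO KO cfx2 cg) => z Kz.
by have := fg (KO z Kz); have := sqr_ge0 (fy z); lra.
Qed.

Let pow1 k : 1 <= (2 : R) ^+ k. Proof. by rewrite exprn_ege1// ler1n. Qed.
Let powS k : (2 : R) ^+ k.+1 = 2 * 2 ^+ k. Proof. by rewrite exprS. Qed.

Section Chain.
Variables x0 y0 : R.
Hypothesis y0_ge0 : 0 <= y0.
Hypothesis far : 4 * r0 <= `|x0| \/ 4 * r0 <= y0.

(** Boxes of size of order [2 ^+ k] climbing from the base point. Even the first is at height at
    least 1, so the flat boundary never interferes, however small [y0] is. *)
Let Q k := rect x0 (x0 + 2 ^+ k.+1) (y0 + 2 ^+ k) (y0 + 2 ^+ k.+2).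

Let QO k : Q k `<=` Omega.
Proof.
have p := pow1 k; apply: rect_Omega; first by move: y0_ge0; lra.
rewrite powS; move: far y0_ge0 r0_gt0 => [+|]; last by move=> *; apply: Or33; lra.
have [x0p|x0n] := leP 0 x0; first by rewrite ger0_norm// => *; apply: Or31; lra.
rewrite ltr0_norm// => h1 h2 h3.
(* When [x0] is negative, growing to the right might meet the disc; but small boxes stay on its left
   and larger ones pass above it. *)
have [h|h] := leP (2 ^+ k) r0; last by apply: Or33; lra.
by apply: Or32; lra.
Qed.

Let d k := I2 x0 (x0 + 2 ^+ k.+1) (y0 + 2 ^+ k) (y0 + 2 ^+ k.+2) g.

(** [p] is the crossing of a good vertical and a good horizontal line. The vertical one spans the
    full height of box [k], hence reaches the row chosen in box [k.+1]; the horizontal one spans the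
    full width, hence meets the vertical line coming from the previous box. *)
Let link k (p : R * R) :=
  [/\ x0 <= p.1 <= x0 + 2 ^+ k, y0 + 2 ^+ k <= p.2 <= y0 + 2 ^+ k.+1,
    I1 (y0 + 2 ^+ k) (y0 + 2 ^+ k.+2) (fun y => fy (p.1, y) ^+ 2) * 2 ^+ k <= d k &
    I1 x0 (x0 + 2 ^+ k.+1) (fun x => fx (x, p.2) ^+ 2) * 2 ^+ k <= d k].

Let link_ex k : exists p, link k p.
Proof.
have p0 := pow1 k; have QOk := @QO k.
have S1 : rect x0 (x0 + 2 ^+ k) (y0 + 2 ^+ k) (y0 + 2 ^+ k.+2) `<=` Q k.
  move=> z /rectP[/andP[z1 z2] /andP[z3 z4]]; apply/rectP; rewrite z1 z3 z4; split => //.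
  by rewrite powS; lra.
have S2 : rect x0 (x0 + 2 ^+ k.+1) (y0 + 2 ^+ k) (y0 + 2 ^+ k.+1) `<=` Q k.
  move=> z /rectP[/andP[z1 z2] /andP[z3 z4]]; apply/rectP; rewrite z1 z2 z3; split => //.
  by rewrite powS; move: z4; lra.
have [||x xx hx] := goodline_x (subset_trans S1 QOk).
- by lra.
- by rewrite !powS; lra.
have [||y yy hy] := goodline_y (subset_trans S2 QOk).
- by rewrite !powS; lra.
- by rewrite !powS; lra.
exists (x, y); split => //=.
- apply: (le_trans _ (le_trans hx _)); first by rewrite (addrC x0) addrK.
  apply: (I2_subset oO QOk) => //; first by rewrite powS; lra.
  by move=> z /QOk; exact: g0.
- apply: (le_trans _ (le_trans hy _)).
    by rewrite powS (_ : y0 + _ - _ = 2 ^+ k)//; ring.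
  apply: (I2_subset oO QOk) => //; first by rewrite !powS; lra.
  by move=> z /QOk; exact: g0.
Qed.

(** From [p], follow its vertical line to the row of [q], then that row to [q]. A squared increment
    is at most length times line energy; the length is of order [2 ^+ k] and the line energy at most
    [2 ^- k] times a box energy, so the scale cancels. *)
Let link_next k p q : link k p -> link k.+1 q ->
  (f q - f p) ^+ 2 <= 6 * (d k + d k.+1).
Proof.
case: p q => [px py] [qx qy] [/= px_ py_ pV pH] [/= qx_ qy_ qV qH].
have p0 := pow1 k.
rewrite !powS in px_ py_ pV pH qx_ qy_ qV qH.
move: px_ py_ qx_ qy_ => /andP[px1 px2] /andP[py1 py2] /andP[qx1 qx2] /andP[qy1 qy2].
have hv : (f (px, qy) - f (px, py)) ^+ 2 <= 3 * d k.
  apply: (le_trans (@sqr_incry_sub _ Omega f fx fy (y0 + 2 ^+ k) (y0 + 2 * (2 * 2 ^+ k)) px qy py Cf _ _ _)).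
  - move=> y yy; apply: (@QO k); apply/rectP; rewrite !powS/=; split => //.
    by apply/andP; split; lra.
  - by apply/andP; split; lra.
  - by apply/andP; split; lra.
  - by move: pV; rewrite (_ : _ - _ = 3 * 2 ^+ k); [lra|ring].
have hh : (f (qx, qy) - f (px, qy)) ^+ 2 <= 2 * d k.+1.
  apply: (le_trans (@sqr_incrx_sub _ Omega f fx fy x0 (x0 + 2 * (2 * 2 ^+ k)) qy qx px Cf _ _ _)).
  - move=> x xx; apply: (@QO k.+1); apply/rectP; rewrite !powS/=; split => //.
    by apply/andP; split; lra.
  - by apply/andP; split; lra.
  - by apply/andP; split; lra.
  - by move: qH; rewrite (_ : _ - _ = 2 * (2 * 2 ^+ k)); [lra|ring].
have dk : 0 <= d k by apply: I2_ge0 => z /QO; exact: g0.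
have dk1 : 0 <= d k.+1 by apply: I2_ge0 => z /QO; exact: g0.
have := sqr_sum2 (f (qx, qy) - f (px, qy)) (f (px, qy) - f (px, py)).
by rewrite addrA subrK; lra.
Qed.

(** The logarithm originates here: Cauchy-Schwarz over [N] increments costs a factor [N], while the
    two families of box energies sum to at most [3 * D] each, whence [36 = 6 * (3 + 3)]. *)
Lemma chain N : exists p q : R * R,
  [/\ [/\ x0 <= p.1 <= x0 + 1, y0 + 1 <= p.2 <= y0 + 2 &
       I1 x0 (x0 + 2) (fun x => fx (x, p.2) ^+ 2) <= D],
      [/\ x0 <= q.1 <= x0 + 2 ^+ N, y0 + 2 ^+ N <= q.2 <= y0 + 2 ^+ N.+1 &
       forall y, y0 + 2 ^+ N <= y <= y0 + 2 ^+ N.+2 -> (f (q.1, y) - f q) ^+ 2 <= 3 * D] &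
      (f q - f p) ^+ 2 <= 36 * N%:R * D].
Proof.
have [c hc] := choice link_ex.
have dD k : d k <= D by exact/I2gD/QO.
exists (c 0%N), (c N); split.
- have [h1 h2 _ h3] := hc 0%N.
  rewrite expr0 expr1 mulr1 in h1 h2 h3; split => //.
  exact: le_trans h3 (dD _).
- have [h1 h2 h3 _] := hc N; split => // y yy.
  have {}h3 := le_trans h3 (dD _).
  rewrite (surjective_pairing (c N)).
  apply: (le_trans (@sqr_incry_sub _ Omega f fx fy (y0 + 2 ^+ N) (y0 + 2 ^+ N.+2) (c N).1 y (c N).2 Cf _ _ _)) => //.
  - move=> t tt; apply: (@QO N); apply/rectP; split => //=.
    by rewrite powS; have := pow1 N; move: h1 => /andP[? ?] ?; apply/andP; split; lra.
  - by rewrite !powS; have := pow1 N; move: h2; rewrite powS => /andP[? ?] ?; apply/andP; split; lra.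
  - rewrite (_ : y0 + 2 ^+ N.+2 - _ = 3 * 2 ^+ N); last by rewrite !powS; ring.
    by move: h3; lra.
have tel : f (c N) - f (c 0%N) = \sum_(k < N) (f (c k.+1) - f (c k)).
  by elim: N => [|N IH]; rewrite ?big_ord0 ?subrr// big_ord_recr/= -IH; ring.
rewrite tel; apply: (le_trans (sqr_sum_le (fun k => f (c k.+1) - f (c k)) N)).
have S1 := mass_telescope oO cg g0 gfin N (c := y0) (fun k => @QO k).
have S2 : \sum_(k < N) d k.+1 <= 3 * D.
  have := mass_telescope oO cg g0 gfin N.+1 (c := y0) (fun k => @QO k).
  rewrite big_ord_recl/=; apply: le_trans; rewrite lerDr.
  by apply: I2_ge0 => z /(@QO 0); exact: g0.
have : \sum_(k < N) (f (c k.+1) - f (c k)) ^+ 2 <= \sum_(k < N) 6 * (d k + d k.+1).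
  by apply: ler_sum => k _; apply: link_next.
rewrite -mulr_sumr big_split/= => h.
have {}h : \sum_(k < N) (f (c k.+1) - f (c k)) ^+ 2 <= 36 * D.
  by apply: (le_trans h); move: S1 S2; rewrite -/D /d; lra.
rewrite (_ : 36 * _ * D = N%:R * (36 * D)); last by ring.
by rewrite ler_wpM2l// ler0n.
Qed.

End Chain.

(** A chain from [(x0, y0)] and one from the fixed point [(0, Y)] climb to the same scale and are
    joined there; near the fixed point [f] is bounded by compactness. *)
Lemma point_growth : exists2 C : R, 0 <= C & forall N (x0 y0 : R),
  `|x0| <= 2 ^+ N -> 0 <= y0 <= 2 ^+ N ->
  4 * r0 + 1 <= `|x0| \/ 4 * r0 + 1 <= y0 ->
  exists p : R * R, [/\ x0 <= p.1 <= x0 + 1, y0 + 1 <= p.2 <= y0 + 2,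
    I1 x0 (x0 + 2) (fun x => fx (x, p.2) ^+ 2) <= D & f p ^+ 2 <= C * N.+1%:R].
Proof.
pose Y := 4 * r0 + 1.
have KO : rect 0 1 (Y + 1) (Y + 2) `<=` Omega.
  by apply: rect_Omega; rewrite /Y; [|apply: Or33]; move: r0_gt0; lra.
have [M M0 hM] := compact_cts_bounded (@compact_rect _ _ _ _ _) (ctsS KO (C1c Cf)).
have M2 := sqr_ge0 M.
exists (6 * (80 * D + M ^+ 2)); first by move: D0; lra.
move=> N x0 y0 x0N /andP[y00 y0N] far.
have YN : Y <= 2 ^+ N by case: far; rewrite -/Y; lra.
have far1 : 4 * r0 <= `|x0| \/ 4 * r0 <= y0 by case: far => ?; [left|right]; lra.
have far2 : 4 * r0 <= `|0 : R| \/ 4 * r0 <= Y by right; rewrite /Y; lra.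
have Y0 : 0 <= Y by rewrite /Y; move: r0_gt0; lra.
have [p [q [[p1 p2 p3] [q1 q2 q3] pq]]] := chain y00 far1 N.
have [p' [q' [[p1' p2' p3'] [q1' q2' q3'] pq']]] := chain Y0 far2 N.
exists p; split => //.
have P1 := pow1 N.
have BO : rect (- 2 ^+ N) (2 * 2 ^+ N) (2 * 2 ^+ N) (4 * 2 ^+ N) `<=` Omega.
  by apply: rect_Omega; [|apply: Or33]; move: r0_gt0 YN; rewrite /Y; lra.
have P12 : - 2 ^+ N < 2 * 2 ^+ N :> R by rewrite (@lt_trans _ _ 0) ?oppr_lt0 ?mulr_gt0 ?exprn_gt0.
have P24 : 2 * 2 ^+ N < 4 * 2 ^+ N :> R by rewrite ltr_pM2r ?exprn_gt0// ltr_nat.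
(* The joining row [Z]: its height lies in the range of both last vertical lines because both base
   heights are between 0 and [2 ^+ N]. *)
have [||Z ZZ hZ] := goodline_y BO; [by rewrite ?ltW..|].
have {}hZ := le_trans hZ (I2gD BO).
rewrite !powS in q2 q3 q2' q3'.
have [xa xb] := itv_double (etrans (esym (ler_norml _ _)) x0N).
have YY : 0 <= Y <= 2 ^+ N by rewrite Y0.
have hq : (f (q.1, Z) - f q) ^+ 2 <= 3 * D by apply: q3; apply: itv_shift ZZ; rewrite y00.
have hq' : (f (q'.1, Z) - f q') ^+ 2 <= 3 * D by apply: q3'; exact: itv_shift YY ZZ.
have hl : (f (q.1, Z) - f (q'.1, Z)) ^+ 2 <= 2 * D.
  apply: (le_trans (@sqr_incrx_sub _ Omega f fx fy (- 2 ^+ N) (2 * 2 ^+ N) Z q.1 q'.1 Cf _ _ _)).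
  - by move=> x xx; apply: BO; apply/rectP.
  - exact: itv_widen q1.
  - apply: itv_widen q1'; rewrite ?add0r ?oppr_le0 ?exprn_ge0//.
    by rewrite ler_peMl ?exprn_ge0// ler1n.
  - move: hZ D0; rewrite (_ : 4 * _ - _ = 2 * 2 ^+ N); last by ring.
    by rewrite (_ : _ - - _ = 3 * 2 ^+ N); [lra|ring].
have hp' : f p' ^+ 2 <= M ^+ 2.
  rewrite -[f p' ^+ 2]real_normK ?num_real// lerXn2r ?nnegrE ?(ltW M0)//.
  by apply: hM; apply/rectP; rewrite add0r in p1'.
rewrite -[N.+1%:R]natr1; have N0 : 0 <= N%:R :> R by [].
have ND : 0 <= N%:R * D by exact: mulr_ge0.
have NM : 0 <= N%:R * M ^+ 2 by exact: mulr_ge0.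
clear -pq pq' hq hq' hl hp' N0 ND NM D0 M2.
move: pq pq' hq hq' hl hp' N0 ND NM D0 M2; rewrite -/D.
move: (f p) (f q) (f p') (f q') (f (q.1, Z)) (f (q'.1, Z)) (N%:R) D (M ^+ 2).
move=> A B A' B' C C' n d m pq pq' hq hq' hl hp' N0 ND NM D0' M2'.
have h1 := sqr_sum3 (A - B) (B - C) (C - C').
have h2 := sqr_sum3 (C' - B') (B' - A') A'.
have h3 := sqr_sum2 (A - B + (B - C) + (C - C')) (C' - B' + (B' - A') + A').
rewrite (_ : _ + _ + (_ + _ + _) = A) in h3; last by ring.
rewrite -sqrrN opprB in pq; rewrite -sqrrN opprB in hq.
by lra.
Qed.

(** A good vertical line carries the bound at one point to all heights of the box, and rows carry it
    across. The constant is independent of [m], so the box may come arbitrarily close to the flat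
    boundary. *)
Lemma log_growth : exists2 C : R, 0 <= C & forall N (x0 y0 m : R),
  `|x0| <= 2 ^+ N -> 0 < m -> m < y0 -> y0 <= 2 ^+ N -> y0 - 2 <= m ->
  4 * r0 + 2 <= `|x0| \/ 4 * r0 + 2 <= y0 ->
  I2 (x0 - 2) (x0 + 2) m (y0 + 2) (fun z => f z ^+ 2) <= C * N.+1%:R.
Proof.
have [K K0 hK] := point_growth.
have D0' : 0 <= D := D0.
exists (700 * (D + K)); first lra.
move=> N x0 y0 m x0N m0 my0 y0N ym far.
have x02 : x0 - 2 <= x0 by lra.
have x12' : x0 + 1 <= x0 + 2 by lra.
have x02' : x0 <= x0 + 2 by lra.
have far1 : 4 * r0 + 1 <= `|x0| \/ 4 * r0 + 1 <= y0 by case: far => ?; [left|right]; lra.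
have yy0 : 0 <= y0 <= 2 ^+ N by apply/andP; split; lra.
have [p [/andP[p1 p1'] /andP[p2 p2'] p3 p4]] := hK N x0 y0 x0N yy0 far1.
have BO : rect (x0 - 2) (x0 + 2) m (y0 + 2) `<=` Omega.
  by apply: box_Omega => //; move: r0_gt0; case: far => ? ?; [left|right]; lra.
have BO' : rect x0 (x0 + 1) m (y0 + 2) `<=` Omega.
  by move=> z /rectP[z1 z2]; apply: BO; apply/rectP; split => //; exact: itv_widen z1.
have [||x' xx' hx'] := goodline_x BO'; [by lra..|].
have {}hx' := le_trans hx' (I2gD BO').
rewrite (addrC x0) addrK mulr1 in hx'.
have /andP[x1' x2'] := xx'.
have hv y : m <= y <= y0 + 2 -> f (x', y) ^+ 2 <= 18 * D + 3 * (K * N.+1%:R).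
  move=> yy.
  have h1 : (f (x', y) - f (x', p.2)) ^+ 2 <= 4 * D.
    apply: (le_trans (@sqr_incry_sub _ Omega f fx fy m (y0 + 2) x' y p.2 Cf _ yy _)).
    - by move=> t tt; apply: BO'; apply/rectP.
    - by rewrite p2'  andbT (le_trans _ p2)// (le_trans (ltW my0))// lerDl.
    - have I0 : 0 <= I1 m (y0 + 2) (fun y => fy (x', y) ^+ 2) by apply: I1_ge0 => t _; exact: sqr_ge0.
      by apply: ler_pM => //; lra.
  have h2 : (f (x', p.2) - f p) ^+ 2 <= 2 * D.
    rewrite [in f p](surjective_pairing p).
    apply: (le_trans (@sqr_incrx_sub _ Omega f fx fy x0 (x0 + 2) p.2 x' p.1 Cf _ _ _)).
    - move=> t tt; apply: BO; apply/rectP; split; first exact: itv_widen tt.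
      by rewrite /= p2' andbT (le_trans _ p2)// (le_trans (ltW my0))// lerDl.
    - exact: itv_widen xx'.
    - by rewrite p1 (le_trans p1').
    - by rewrite (_ : x0 + 2 - x0 = 2) ?ler_pM2l//; ring.
  have := sqr_sum3 (f (x', y) - f (x', p.2)) (f (x', p.2) - f p) (f p).
  by rewrite (_ : _ + _ + _ = f (x', y)); [lra|ring].
set Z := 18 * D + 3 * (K * N.+1%:R) in hv.
have cf2 : cts Omega (fun z => f z ^+ 2) by apply: ctsX; exact: C1c Cf.
have cfx2 : cts Omega (fun z => 32 * fx z ^+ 2) by cts_tac.
have crhs : cts Omega (fun z => 32 * fx z ^+ 2 + 2 * Z) by cts_tac.
have x12 : x0 - 2 <= x0 + 2 by lra.
have y12 : m <= y0 + 2 by lra.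
apply: (@le_trans _ _ (I2 (x0 - 2) (x0 + 2) m (y0 + 2) (fun z => 32 * fx z ^+ 2 + 2 * Z))).
  rewrite (I2_yx oO BO cf2) (I2_yx oO BO crhs).
  apply: I1_le.
  - exact: (integrable_slicex oO BO cf2).
  - exact: (integrable_slicex oO BO crhs).
  move=> y yy.
  have ifx2 : lebesgue_measure.-integrable `[x0 - 2, x0 + 2] (EFin \o (fun x => fx (x, y) ^+ 2)).
    by apply: integrable1; apply: (cts1_slicex BO (ctsX (n := 2) cfx)).
  have i32 : lebesgue_measure.-integrable `[x0 - 2, x0 + 2] (EFin \o (fun x => 32 * fx (x, y) ^+ 2)).
    by apply: integrable1; apply: (cts1_slicex BO cfx2).
  have icst (c : R) : lebesgue_measure.-integrable `[x0 - 2, x0 + 2] (EFin \o (fun x : R => c)).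
    by apply: integrable1; apply: cts1_at => ? _; exact: cst_continuous.
  (* The energy of a single row is not bounded by [D]; it is kept as it is and controlled only after
     integration in [y]. *)
  have hI : forall x, x0 - 2 <= x <= x0 + 2 ->
      f (x, y) ^+ 2 <= 8 * I1 (x0 - 2) (x0 + 2) (fun x => fx (x, y) ^+ 2) + 2 * Z.
    move=> x xx.
    have h1 : (f (x, y) - f (x', y)) ^+ 2 <= 4 * I1 (x0 - 2) (x0 + 2) (fun x => fx (x, y) ^+ 2).
      apply: (le_trans (@sqr_incrx_sub _ Omega f fx fy (x0 - 2) (x0 + 2) y x x' Cf _ xx _)).
      - by move=> t tt; apply: BO; apply/rectP.
      - exact: itv_widen xx'.
      - by rewrite (_ : x0 + 2 - _ = 4)//; ring.
    have := sqr_sum2 (f (x, y) - f (x', y)) (f (x', y)); rewrite subrK.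
    by have := hv y yy; lra.
  apply: (@le_trans _ _ (I1 (x0 - 2) (x0 + 2) (fun=> 8 * I1 (x0 - 2) (x0 + 2) (fun x => fx (x, y) ^+ 2) + 2 * Z))).
    by apply: I1_le => //; apply: integrable1; exact: (cts1_slicex BO cf2).
  rewrite I1_cst// I1D// I1Zl// I1_cst//.
  by rewrite (_ : x0 + 2 - _ = 4); [lra|ring].
rewrite (I2D oO BO cfx2 (@cts_cst _ _ _)) (I2Zl oO BO _ (ctsX (n := 2) cfx)) I2_cst//.
have hfx : I2 (x0 - 2) (x0 + 2) m (y0 + 2) (fun z => fx z ^+ 2) <= D.
  apply: (le_trans _ (I2gD BO)); apply: (I2_le oO BO (ctsX (n := 2) cfx) cg) => z Kz.
  by have := fg (BO z Kz); have := sqr_ge0 (fy z); lra.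
have KN : 0 <= K * N.+1%:R by rewrite mulr_ge0.
have Z0 : 0 <= Z by rewrite /Z; lra.
have hZ : 2 * Z * ((x0 + 2 - (x0 - 2)) * (y0 + 2 - m)) <= 2 * Z * 16.
  by apply: ler_wpM2l; [lra|rewrite (_ : _ - (x0 - 2) = 4); [lra|ring]].
have N1 : 1 <= N.+1%:R :> R by rewrite ler1n.
have DN : D <= D * N.+1%:R by rewrite ler_peMr.
rewrite (_ : 700 * (D + K) * N.+1%:R = 700 * (D * N.+1%:R) + 700 * (K * N.+1%:R)); last by ring.
by move: hZ;  move: hfx DN KN D0'; rewrite /Z; lra.
Qed.

End LogGrowth.

(** * Good lines and cutoff functions *)

(** The minimum of [F^2] is at most its mean, and the oscillation of [F^2] is at most the integral
    of [|2 F F'|], split by AM-GM with weight [lam]. *)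
Lemma line_sup (R : realType) (a b lam : R) (F dF : R -> R) : a < b -> 0 < lam ->
  (forall t, a <= t <= b -> {for t, continuous dF}) ->
  (forall t, a <= t <= b -> is_derive t (1 : R) F (dF t)) ->
  forall y, a <= y <= b ->
    F y ^+ 2 <= ((lam * (b - a))^-1 + 1) * I1 a b (fun t => lam * F t ^+ 2 + lam^-1 * dF t ^+ 2).
Proof.
move=> ab lam0 cdF DF y yab; have /andP[ay yb] := yab.
have cF t : a <= t <= b -> {for t, continuous F}.
  by move=> /DF[dt _]; exact/differentiable_continuous/derivable1_diffP.
have cF2 t : a <= t <= b -> {for t, continuous (fun s => F s ^+ 2)}.
  by move=> tt; apply: cvgM; exact: cF.
pose h t := lam * F t ^+ 2 + lam^-1 * dF t ^+ 2.
have ch t : a <= t <= b -> {for t, continuous h}.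
  move=> tt; apply: cvgD; apply: cvgM; try exact: cvg_cst; first exact: cF2.
  by apply: cvgM; exact: cdF.
have h0 t : a <= t <= b -> 0 <= h t.
  by move=> _; rewrite addr_ge0// mulr_ge0 ?sqr_ge0 ?invr_ge0 ?ltW.
have int (k : R -> R) c d : a <= c -> d <= b -> (forall x, a <= x <= b -> {for x, continuous k}) ->
    lebesgue_measure.-integrable `[c, d] (EFin \o k).
  move=> ac db ck; apply/integrable1/cts1_at => x /andP[? ?]; apply: ck.
  by apply/andP; split; [exact: le_trans ac _|exact: le_trans db].
have [y' ] := EVT_min (ltW ab) (cts1_at cF2).
rewrite in_itv/= => yy' ymin; have /andP[ay' yb'] := yy'.
have ba : 0 < b - a by rewrite subr_gt0.
have hmin : F y' ^+ 2 <= (lam * (b - a))^-1 * I1 a b h.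
  rewrite mulrC ler_pdivlMr ?mulr_gt0// mulrCA (mulrC (F _ ^+ 2)) mulrA mulrAC -mulrA mulrA.
  rewrite -(I1_cst (lam * F y' ^+ 2) (ltW ab)); apply: I1_le; try exact: int.
    by apply: (int _ a b) => // t _; exact: cst_continuous.
  move=> t tt; rewrite /h; have := ymin t; rewrite in_itv/= => /(_ tt) H.
  rewrite -[leLHS]addr0 lerD ?ler_pM2l// mulr_ge0 ?sqr_ge0// invr_ge0 ltW//.
have D2 t : a <= t <= b -> is_derive t (1 : R) (fun s => F s ^+ 2) (2 * (F t * dF t)).
  move=> tt; have := is_deriveM (DF t tt) (DF t tt).
  by move/is_derive_eq; apply; rewrite /GRing.scale/=; ring.
have c2 t : a <= t <= b -> {for t, continuous (fun s => 2 * (F s * dF s))}.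
  by move=> tt; apply: cvgM; [exact: cvg_cst|apply: cvgM; [exact: cF|exact: cdF]].
have amgm (p q : R) : `|2 * (p * q)| <= lam * p ^+ 2 + lam^-1 * q ^+ 2.
  rewrite normrM normrM (ger0_norm (_ : 0 <= 2 :> R))//.
  rewrite -(real_normK (num_real p)) -(real_normK (num_real q)).
  move: `|p| `|q| => {}p {}q; rewrite -subr_ge0.
  rewrite (_ : _ - _ = lam * (p - lam^-1 * q) ^+ 2); last by field; rewrite gt_eqF.
  by rewrite mulr_ge0 ?sqr_ge0// ltW.
have key c d : a <= c -> c <= d -> d <= b -> `|F d ^+ 2 - F c ^+ 2| <= I1 a b h.
  move=> ac cd db.
  have sub t : c <= t <= d -> a <= t <= b.
    by move=> /andP[? ?]; rewrite (le_trans ac)//= (le_trans _ db).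
  have <- := @FTC_at _ c d (fun s => F s ^+ 2) (fun s => 2 * (F s * dF s)) cd
    (fun t tt => c2 t (sub t tt)) (fun t tt => D2 t (sub t tt)).
  have i2 := int _ c d ac db c2.
  apply: (le_trans (I1_norm i2)); apply: (@le_trans _ _ (I1 c d h)).
    by apply: I1_le => [||t _]; [exact: (integrable_norm i2)|exact: int|exact: amgm].
  exact: I1_subset.
have hd : F y ^+ 2 - F y' ^+ 2 <= I1 a b h.
  have [yy|/ltW yy] := leP y' y; first by apply: le_trans (ler_norm _) _; exact: key.
  by apply: le_trans (ler_norm _) _; rewrite distrC; exact: key.
by rewrite mulrDl mul1r; lra.
Qed.

Section Sobolev.
Variable R : realType.
Variable U : set (R * R).
Hypothesis oU : open U.

Lemma line_sup_y f (fx fy : R * R -> R) (a b lam x : R) : C1 U f fx fy ->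
  a < b -> 0 < lam -> (forall y, a <= y <= b -> U (x, y)) ->
  forall y, a <= y <= b -> f (x, y) ^+ 2 <=
   ((lam * (b - a))^-1 + 1) * I1 a b (fun y => lam * f (x, y) ^+ 2 + lam^-1 * fy (x, y) ^+ 2).
Proof.
move=> C ab l0 Uy; apply: (@line_sup _ a b lam (fun y => f (x, y)) (fun y => fy (x, y))) => // t /Uy Ut.
- exact: (cts_slicey (C1cy C)).
- exact: (C1_slicey C).
Qed.

Lemma line_sup_x f (fx fy : R * R -> R) (a b lam y : R) : C1 U f fx fy ->
  a < b -> 0 < lam -> (forall x, a <= x <= b -> U (x, y)) ->
  forall x, a <= x <= b -> f (x, y) ^+ 2 <=
   ((lam * (b - a))^-1 + 1) * I1 a b (fun x => lam * f (x, y) ^+ 2 + lam^-1 * fx (x, y) ^+ 2).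
Proof.
move=> C ab l0 Uy; apply: (@line_sup _ a b lam (fun x => f (x, y)) (fun x => fx (x, y))) => // t /Uy Ut.
- exact: (cts_slicex (C1cx C)).
- exact: (C1_slicex C).
Qed.

(** The line estimate is applied first along [y], then along [x] to both [f] and [fy]. Among second
    derivatives only the mixed one enters the bound, which is why a partial Hessian estimate is
    enough later. *)
Lemma corner_le f (fx fy fyx fyy : R * R -> R) (x y : R) :
  C1 U f fx fy -> C1 U fy fyx fyy -> rect x (x + 1) y (y + 1) `<=` U ->
  f (x, y) ^+ 2 <= 4 * I2 x (x + 1) y (y + 1)
    (fun z => f z ^+ 2 + fx z ^+ 2 + fy z ^+ 2 + fyx z ^+ 2).
Proof.
move=> C Cy KU.
have x1 : x < x + 1 by rewrite ltrDl.
have y1 : y < y + 1 by rewrite ltrDl.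
have xx : x <= x <= x + 1 by rewrite lexx ltW.
have yy : y <= y <= y + 1 by rewrite lexx ltW.
have Ux t : y <= t <= y + 1 -> forall s, x <= s <= x + 1 -> U (s, t).
  by move=> tt s ss; apply: KU; apply/rectP.
have l1 := line_sup_y C y1 ltr01 (fun t tt => Ux t tt x xx) yy.
have l2 t : y <= t <= y + 1 -> f (x, t) ^+ 2 <= 2 * I1 x (x + 1) (fun s => f (s, t) ^+ 2 + fx (s, t) ^+ 2).
  move=> tt; have := line_sup_x C x1 ltr01 (Ux t tt) xx.
  rewrite (_ : x + 1 - x = 1); last by ring.
  rewrite mulr1 invr1 (_ : 1 + 1 = 2); last by ring.
  by under eq_I1 => s ss do rewrite !mul1r.
have l3 t : y <= t <= y + 1 -> fy (x, t) ^+ 2 <= 2 * I1 x (x + 1) (fun s => fy (s, t) ^+ 2 + fyx (s, t) ^+ 2).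
  move=> tt; have := line_sup_x Cy x1 ltr01 (Ux t tt) xx.
  rewrite (_ : x + 1 - x = 1); last by ring.
  rewrite mulr1 invr1 (_ : 1 + 1 = 2); last by ring.
  by under eq_I1 => s ss do rewrite !mul1r.
have ch : cts U (fun z => 2 * (f z ^+ 2 + fx z ^+ 2 + fy z ^+ 2 + fyx z ^+ 2)) by cts_tac.
have ch1 : cts U (fun z => f z ^+ 2 + fx z ^+ 2) by cts_tac.
have ch2 : cts U (fun z => fy z ^+ 2 + fyx z ^+ 2) by cts_tac.
have ch3 : cts U (fun z => f z ^+ 2 + fx z ^+ 2 + fy z ^+ 2 + fyx z ^+ 2) by cts_tac.
have ch4 : cts U (fun z => 1 * f z ^+ 2 + 1 * fy z ^+ 2) by cts_tac.
rewrite (_ : 4 * I2 _ _ _ _ _ = 2 * I2 x (x + 1) y (y + 1) (fun z => 2 * (f z ^+ 2 + fx z ^+ 2 + fy z ^+ 2 + fyx z ^+ 2))); last first.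
  by rewrite (I2Zl oU KU _ ch3); ring.
move: l1; rewrite (_ : y + 1 - y = 1); last by ring.
rewrite mulr1 invr1 (_ : 1 + 1 = 2); last by ring.
move=> /le_trans; apply; rewrite ler_pM2l// (I2_yx oU KU ch).
apply: I1_le.
- by apply/integrable1/(cts1_slicey KU ch4).
- exact: (integrable_slicex oU KU ch).
move=> t tt; rewrite I1Zl; last by apply/integrable1/(cts1_slicex KU ch3).
rewrite (@eq_I1 _ x (x + 1) _ (fun s => (f (s, t) ^+ 2 + fx (s, t) ^+ 2) + (fy (s, t) ^+ 2 + fyx (s, t) ^+ 2))); last first.
  by move=> s _; ring.
rewrite I1D; last 2 first.
- by apply/integrable1/(cts1_slicex KU ch1).
- by apply/integrable1/(cts1_slicex KU ch2).
by have := l2 t tt; have := l3 t tt; rewrite !mul1r; lra.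
Qed.

Section Lines.
Variables x1 x2 y1 y2 lam : R.
Hypothesis KU : rect x1 x2 y1 y2 `<=` U.
Hypothesis lam0 : 0 < lam.
Variables f fx fy : R * R -> R.
Hypothesis C : C1 U f fx fy.

Let h z := lam * f z ^+ 2 + lam^-1 * (fx z ^+ 2 + fy z ^+ 2).

Let ch : cts U h. Proof. by rewrite /h; cts_tac. Qed.

(** On a line long compared with [1 / lam], the factor in the line estimate is at most 2. *)
Lemma good_line_x : x1 < x2 -> y1 < y2 -> 1 <= lam * (y2 - y1) ->
  exists2 x, x1 <= x <= x2 & forall y, y1 <= y <= y2 ->
    f (x, y) ^+ 2 * (x2 - x1) <= 2 * I2 x1 x2 y1 y2 h.
Proof.
move=> x12 y12 l1; have [x xx hx] := goodx oU KU (ltW y12) ch (ltW x12).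
exists x => // y yy; have x210 : 0 < x2 - x1 by rewrite subr_gt0.
have c1 : cts U (fun z => lam * f z ^+ 2 + lam^-1 * fy z ^+ 2) by cts_tac.
have h1 : I1 y1 y2 (fun y => lam * f (x, y) ^+ 2 + lam^-1 * fy (x, y) ^+ 2) <= I1 y1 y2 (fun y => h (x, y)).
  apply: I1_le.
  - exact/integrable1/(cts1_slicey KU c1).
  - exact/integrable1/(cts1_slicey KU ch).
  by move=> t _; rewrite /h lerD2l ler_pM2l ?invr_gt0// lerDr sqr_ge0.
have h0 : 0 <= I1 y1 y2 (fun y => lam * f (x, y) ^+ 2 + lam^-1 * fy (x, y) ^+ 2).
  by apply: I1_ge0 => t _; rewrite addr_ge0// mulr_ge0 ?sqr_ge0 ?invr_ge0 ?(ltW lam0).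
have := line_sup_y C y12 lam0 (fun t tt => KU (iffRL (rectP x1 x2 y1 y2 (x, t)) (conj xx tt))) yy.
have l2 : (lam * (y2 - y1))^-1 + 1 <= 2.
  have : (lam * (y2 - y1))^-1 <= 1 by rewrite invf_le1//; exact: lt_le_trans l1.
  by lra.
move=> h2; have h3 := le_trans h2 (ler_pM _ h0 l2 h1).
have {}h3 : f (x, y) ^+ 2 <= 2 * I1 y1 y2 (fun y => h (x, y)).
  by apply: h3; rewrite addr_ge0// invr_ge0 mulr_ge0 ?(ltW lam0)// subr_ge0 ltW.
by apply: le_trans (ler_wpM2r (ltW x210) h3) _; rewrite -mulrA ler_pM2l.
Qed.

Lemma good_line_y : x1 < x2 -> y1 < y2 -> 1 <= lam * (x2 - x1) ->
  exists2 y, y1 <= y <= y2 & forall x, x1 <= x <= x2 ->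
    f (x, y) ^+ 2 * (y2 - y1) <= 2 * I2 x1 x2 y1 y2 h.
Proof.
move=> x12 y12 l1; have [y yy hy] := goody oU KU (ltW x12) ch (ltW y12).
exists y => // x xx; have y210 : 0 < y2 - y1 by rewrite subr_gt0.
have c1 : cts U (fun z => lam * f z ^+ 2 + lam^-1 * fx z ^+ 2) by cts_tac.
have h1 : I1 x1 x2 (fun x => lam * f (x, y) ^+ 2 + lam^-1 * fx (x, y) ^+ 2) <= I1 x1 x2 (fun x => h (x, y)).
  apply: I1_le.
  - exact/integrable1/(cts1_slicex KU c1).
  - exact/integrable1/(cts1_slicex KU ch).
  by move=> t _; rewrite /h lerD2l ler_pM2l ?invr_gt0// lerDl sqr_ge0.
have h0 : 0 <= I1 x1 x2 (fun x => lam * f (x, y) ^+ 2 + lam^-1 * fx (x, y) ^+ 2).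
  by apply: I1_ge0 => t _; rewrite addr_ge0// mulr_ge0 ?sqr_ge0 ?invr_ge0 ?(ltW lam0).
have := line_sup_x C x12 lam0 (fun t tt => KU (iffRL (rectP x1 x2 y1 y2 (t, y)) (conj tt yy))) xx.
have l2 : (lam * (x2 - x1))^-1 + 1 <= 2.
  have : (lam * (x2 - x1))^-1 <= 1 by rewrite invf_le1//; exact: lt_le_trans l1.
  by lra.
move=> h2; have h3 := le_trans h2 (ler_pM _ h0 l2 h1).
have {}h3 : f (x, y) ^+ 2 <= 2 * I1 x1 x2 (fun x => h (x, y)).
  by apply: h3; rewrite addr_ge0// invr_ge0 mulr_ge0 ?(ltW lam0)// subr_ge0 ltW.
by apply: le_trans (ler_wpM2r (ltW y210) h3) _; rewrite -mulrA ler_pM2l.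
Qed.

(** An anisotropic product inequality: [q^2] is bounded uniformly in [x] through [qx], starting from
    its zeros on the left side, and [f^2] uniformly in [y] through [fy]; the two bounds are
    integrated in complementary variables. *)
Lemma I2_mul_le (q qx qy : R * R -> R) : C1 U q qx qy -> x1 <= x2 -> 1 <= y2 - y1 ->
  (forall y, y1 <= y <= y2 -> q (x1, y) = 0) ->
  I2 x1 x2 y1 y2 (fun z => q z ^+ 2 * f z ^+ 2) <=
  2 * (x2 - x1) * I2 x1 x2 y1 y2 (fun z => qx z ^+ 2) *
    I2 x1 x2 y1 y2 (fun z => f z ^+ 2 + fy z ^+ 2).
Proof.
move=> Cq x12 yl q0; have y12 : y1 < y2 by rewrite -subr_gt0 (lt_le_trans ltr01).
have cqf : cts U (fun z => q z ^+ 2 * f z ^+ 2) by cts_tac.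
have cf : cts U (fun z => f z ^+ 2 + fy z ^+ 2) by cts_tac.
have cq2 : cts U (fun z => q z ^+ 2) by cts_tac.
have cqx2 : cts U (fun z => qx z ^+ 2) by cts_tac.
have Uxy x y : x1 <= x <= x2 -> y1 <= y <= y2 -> U (x, y) by move=> xx yy; apply: KU; apply/rectP.
have q_le x y : x1 <= x <= x2 -> y1 <= y <= y2 ->
    q (x, y) ^+ 2 <= (x2 - x1) * I1 x1 x2 (fun x => qx (x, y) ^+ 2).
  move=> xx yy; have /andP[x1x _] := xx.
  have := @sqr_incrx_sub _ U q qx qy x1 x2 y x x1 Cq (fun t tt => Uxy t y tt yy) xx.
  by rewrite q0// subr0; apply; rewrite lexx.
have b_le x : x1 <= x <= x2 ->
    I1 y1 y2 (fun y => q (x, y) ^+ 2) <= (x2 - x1) * I2 x1 x2 y1 y2 (fun z => qx z ^+ 2).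
  move=> xx; rewrite (I2_yx oU KU cqx2) -I1Zl; last exact: (integrable_slicex oU KU cqx2).
  apply: I1_le.
  - exact/integrable1/(cts1_slicey KU cq2).
  - by have := integrable_slicex oU KU cqx2; exact: integrableZl.
  by move=> y yy; exact: q_le.
have a_le x y : x1 <= x <= x2 -> y1 <= y <= y2 ->
    f (x, y) ^+ 2 <= 2 * I1 y1 y2 (fun y => f (x, y) ^+ 2 + fy (x, y) ^+ 2).
  move=> xx yy; have := line_sup_y C y12 ltr01 (fun t tt => Uxy x t xx tt) yy.
  rewrite mul1r invr1; under eq_I1 => t tt do rewrite !mul1r.
  move=> /le_trans; apply; apply: ler_wpM2r.
    by apply: I1_ge0 => t _; rewrite addr_ge0// sqr_ge0.
  have : (y2 - y1)^-1 <= 1 by rewrite invf_le1//; exact: lt_le_trans ltr01 yl.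
  by lra.
rewrite (I2_xy oU KU cqf) (I2_xy oU KU cf) -I1Zl; last exact: (integrable_slicey oU KU cf).
apply: I1_le.
- exact: (integrable_slicey oU KU cqf).
- by have := integrable_slicey oU KU cf; exact: integrableZl.
move=> x xx; set a := I1 y1 y2 (fun y => f (x, y) ^+ 2 + fy (x, y) ^+ 2).
have a0 : 0 <= a by apply: I1_ge0 => t _; rewrite addr_ge0// sqr_ge0.
have iq : lebesgue_measure.-integrable `[y1, y2] (EFin \o (fun y => q (x, y) ^+ 2)).
  exact/integrable1/(cts1_slicey KU cq2).
have c3 : cts U (fun z => 2 * a * q z ^+ 2) by cts_tac.
apply: (@le_trans _ _ (I1 y1 y2 (fun y => 2 * a * q (x, y) ^+ 2))).
  apply: I1_le.
  - exact/integrable1/(cts1_slicey KU cqf).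
  - exact/integrable1/(cts1_slicey KU c3).
  by move=> y yy; rewrite mulrC ler_wpM2r ?sqr_ge0//; exact: a_le.
rewrite I1Zl//; have := b_le x xx; set S := I2 _ _ _ _ _ => hb.
rewrite (_ : 2 * (x2 - x1) * S * a = 2 * a * ((x2 - x1) * S)); last by ring.
by apply: ler_wpM2l => //; rewrite mulr_ge0.
Qed.

End Lines.

End Sobolev.

(** * A polynomial cutoff on a box *)

Section Cutoff.
Variable R : realType.
Variables x0 y0 l : R.
Hypothesis l0 : 0 < l.

Definition bump (c t : R) : R := 1 - ((t - c) / l) ^+ 2.

Definition zeta (z : R * R) : R := bump x0 z.1 * bump y0 z.2.
Definition zetax (z : R * R) : R := (- 2 * (z.1 - x0) / l ^+ 2) * bump y0 z.2.
Definition zetay (z : R * R) : R := bump x0 z.1 * (- 2 * (z.2 - y0) / l ^+ 2).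

Lemma C1_zeta U : C1 U zeta zetax zetay.
Proof.
have B1 := C1M (C1D (C1_fst U) (C1_cst U (- x0))) (C1D (C1_fst U) (C1_cst U (- x0))).
have B2 := C1M (C1D (C1_snd U) (C1_cst U (- y0))) (C1D (C1_snd U) (C1_cst U (- y0))).
have E1 := C1D (C1_cst U 1) (C1M (C1_cst U (- l^-1 ^+ 2)) B1).
have E2 := C1D (C1_cst U 1) (C1M (C1_cst U (- l^-1 ^+ 2)) B2).
have := C1M E1 E2.
rewrite (_ : (fun z => (_ + _) * _) = zeta).
  by move/eq_C1; apply => z; rewrite /zetax /zetay /bump; field; rewrite gt_eqF.
by apply/funext => z; rewrite /zeta /bump; field; rewrite gt_eqF.
Qed.

Lemma bump_range c t : c - l <= t <= c + l -> 0 <= bump c t <= 1.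
Proof.
move=> /andP[h1 h2]; rewrite /bump.
have : ((t - c) / l) ^+ 2 <= 1.
  rewrite exprMn exprVn ler_pdivrMr ?exprn_gt0// mul1r -subr_ge0.
  by rewrite (_ : _ - _ = (c + l - t) * (t - (c - l))); [rewrite mulr_ge0//; lra|ring].
by have := sqr_ge0 ((t - c) / l); move=> *; apply/andP; split; lra.
Qed.

Lemma bump_half c t : c - l / 2 <= t <= c + l / 2 -> 3 / 4 <= bump c t.
Proof.
move=> /andP[h1 h2]; rewrite /bump.
suff : ((t - c) / l) ^+ 2 <= 4^-1 by lra.
rewrite exprMn exprVn ler_pdivrMr ?exprn_gt0// -subr_ge0.
by rewrite (_ : _ - _ = (c + l / 2 - t) * (t - (c - l / 2))); [rewrite mulr_ge0//; lra|field].
Qed.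

Lemma bump_edge c t : t = c - l \/ t = c + l -> bump c t = 0.
Proof. by move=> [->|->]; rewrite /bump; field; rewrite gt_eqF. Qed.

Lemma slope_range c t : c - l <= t <= c + l -> `|- 2 * (t - c) / l ^+ 2| <= 2 / l.
Proof.
move=> /andP[h1 h2]; rewrite ler_norml; apply/andP; split.
  rewrite -subr_ge0 (_ : _ - _ = 2 * (c + l - t) / l ^+ 2); last by field; rewrite gt_eqF.
  by rewrite divr_ge0 ?exprn_ge0 ?(ltW l0)// mulr_ge0//; lra.
rewrite -subr_ge0 (_ : _ - _ = 2 * (t - (c - l)) / l ^+ 2); last by field; rewrite gt_eqF.
by rewrite divr_ge0 ?exprn_ge0 ?(ltW l0)// mulr_ge0//; lra.
Qed.

Variables y1 y2 : R.
Hypothesis y1l : y0 - l <= y1.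
Hypothesis y2l : y2 <= y0 + l.
Let K := rect (x0 - l) (x0 + l) y1 y2.

Lemma zeta_range z : K z -> 0 <= zeta z <= 1.
Proof.
move=> /rectP[zx /andP[h1 h2]].
have /andP[a0 a1] := bump_range zx.
have /andP[b0 b1] : 0 <= bump y0 z.2 <= 1 by apply: bump_range; rewrite (le_trans y1l)//= (le_trans h2).
by rewrite /zeta mulr_ge0//= mulr_ile1.
Qed.

Lemma zetax_range z : K z -> `|zetax z| <= 2 / l.
Proof.
move=> /rectP[zx /andP[h1 h2]].
have /andP[b0 b1] : 0 <= bump y0 z.2 <= 1 by apply: bump_range; rewrite (le_trans y1l)//= (le_trans h2).
rewrite /zetax normrM (ger0_norm b0) -[leRHS]mulr1.
by apply: ler_pM => //; exact: slope_range.
Qed.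

Lemma zetay_range z : K z -> `|zetay z| <= 2 / l.
Proof.
move=> /rectP[zx /andP[h1 h2]].
have /andP[b0 b1] := bump_range zx.
rewrite /zetay normrM (ger0_norm b0) -[leRHS]mul1r.
by apply: ler_pM => //; apply: slope_range; rewrite (le_trans y1l)//= (le_trans h2).
Qed.

(** Each factor is at least [3 / 4], and [(9 / 16)^2] exceeds [1 / 4]. *)
Lemma zeta_half z : x0 - l / 2 <= z.1 <= x0 + l / 2 ->
  y0 - l / 2 <= z.2 <= y0 + l / 2 -> 4^-1 <= zeta z ^+ 2.
Proof.
move=> /bump_half hx /bump_half hy.
have h : 9 / 16 <= zeta z by rewrite /zeta (_ : 9 / 16 = 3 / 4 * (3 / 4)); [apply: ler_pM|field].
have h0 : 0 <= zeta z - 9 / 16 by lra.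
have := mulr_ge0 h0 h0; rewrite expr2; lra.
Qed.

Lemma zeta_grad z : K z -> zetax z ^+ 2 + zetay z ^+ 2 <= 8 / l ^+ 2.
Proof.
move=> Kz; have hx := zetax_range Kz; have hy := zetay_range Kz.
have l2 : 0 <= 2 / l by rewrite divr_ge0// ltW.
have sq (t : R) : `|t| <= 2 / l -> t ^+ 2 <= 4 / l ^+ 2.
  move=> ht; rewrite -(real_normK (num_real t)) (_ : 4 / _ = (2 / l) ^+ 2).
    by rewrite lerXn2r ?nnegrE.
  by field; rewrite gt_eqF.
by have := sq _ hx; have := sq _ hy; lra.
Qed.

End Cutoff.

(** * Growth of the velocity and decay of the vorticity *)

Lemma C1_unique (R : realType) (U : set (R * R)) f g (fx fy gx gy : R * R -> R) :
  open U -> C1 U f fx fy -> C1 U g gx gy -> (forall z, U z -> f z = g z) ->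
  (forall z, U z -> fx z = gx z) /\ (forall z, U z -> fy z = gy z).
Proof.
move=> oU Cf Cg fg; split => z Uz.
  have [_ <-] := C1x Cf Uz; have [_ <-] := C1x Cg Uz.
  apply: near_eq_derive; have : nbhs z U by exact: open_nbhs_nbhs.
  by apply: filterS => t; exact: fg.
have [_ <-] := C1y Cf Uz; have [_ <-] := C1y Cg Uz.
apply: near_eq_derive; have : nbhs z U by exact: open_nbhs_nbhs.
by apply: filterS => t; exact: fg.
Qed.

(** Zero boundary values on the flat boundary without evaluating there: uniform smallness on low
    horizontal segments whose projection stays off the disc. *)
Definition vanish (R : realType) (r0 : R) (h : R * R -> R) := forall x1 x2 : R,
  r0 < x1 \/ x2 < - r0 -> forall e : R, 0 < e -> exists2 d : R, 0 < d &
  forall x m : R, x1 <= x <= x2 -> 0 < m < d -> `|h (x, m)| <= e.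

Lemma rectS (R : realType) (a b c d x1 x2 y1 y2 : R) :
  a <= x1 -> x2 <= b -> c <= y1 -> y2 <= d -> rect x1 x2 y1 y2 `<=` rect a b c d.
Proof.
move=> h1 h2 h3 h4 z /rectP[/andP[z1 z2] /andP[z3 z4]]; apply/rectP.
by rewrite (le_trans h1 z1) (le_trans z2 h2) (le_trans h3 z3) (le_trans z4 h4).
Qed.

Lemma quarter_points (R : realType) (c l : R) : 0 < l ->
  [/\ c - l < c - l / 2, c - l / 2 < c - l / 4, c - l / 4 < c, c < c + l / 4 &
      c + l / 4 < c + l / 2 /\ c + l / 2 < c + l].
Proof. by move=> l0; split; [lra..|split; lra]. Qed.

Section Vorticity.
Variable R : realType.
Variable r0 : R.
Hypothesis r0_gt0 : 0 < r0.
Local Notation Omega := (Omega0 r0).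
Variables (u ux uy uxx uxy uyx uyy V Vx Vy Vxx Vxy Vyx Vyy P g : R * R -> R).
Hypothesis Cu : C1 Omega u ux uy.
Hypothesis Cux : C1 Omega ux uxx uxy.
Hypothesis Cuy : C1 Omega uy uyx uyy.
Hypothesis CV : C1 Omega V Vx Vy.
Hypothesis CVx : C1 Omega Vx Vxx Vxy.
Hypothesis CVy : C1 Omega Vy Vyx Vyy.
Hypothesis div0 : forall z, Omega z -> ux z + Vy z = 0.

Definition w z : R := uy z - Vx z.
Definition wx z : R := uyx z - Vxx z.
Definition wy z : R := uyy z - Vxy z.

(* [P] is the Bernoulli pressure [p + (u^2 + v^2)/2 + b v], with [V = v + b]. *)
Hypothesis CP : C1 Omega P (fun z => wy z - V z * w z) (fun z => - wx z + u z * w z).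
Hypothesis gE : forall z, g z = ux z ^+ 2 + uy z ^+ 2 + Vx z ^+ 2 + Vy z ^+ 2.
Hypothesis gfin : (\int[(@lebesgue_measure R \x @lebesgue_measure R)%E]_(z in Omega) (g z)%:E < +oo)%E.
Hypothesis van_w : vanish r0 w.
Hypothesis van_b1 : vanish r0 (fun z => w z * (wy z - V z * w z / 2)).
Hypothesis van_b2 : vanish r0 (fun z => uxx z * uy z).

Let oO : open Omega := @open_Omega R r0.

Lemma C1_w : C1 Omega w wx wy.
Proof. exact: (C1D Cuy (C1N CVx)). Qed.

Let Cw := C1_w.

Lemma Vyx_uxx z : Omega z -> Vyx z = - uxx z.
Proof.
have E t : Omega t -> Vy t = - ux t by move=> Ot; have := div0 Ot; lra.
by have [h _] := C1_unique oO CVy (C1N Cux) E; exact: h.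
Qed.

(** In [wy = uyy - Vxy], symmetry of mixed derivatives and incompressibility turn [- Vxy] into
    [uxx]. *)
Lemma laplacian_u z : Omega z -> uxx z + uyy z = wy z.
Proof.
move=> Oz; rewrite /wy (clairaut oO CV CVx CVy Oz) (Vyx_uxx Oz); lra.
Qed.

Lemma cts_g : cts Omega g.
Proof.
have -> : g = (fun z => ux z ^+ 2 + uy z ^+ 2 + Vx z ^+ 2 + Vy z ^+ 2) by apply/funext.
cts_tac.
Qed.

Let cg := cts_g.

Lemma g_ge0 z : 0 <= g z.
Proof. by rewrite gE !addr_ge0// sqr_ge0. Qed.

Let D := mass g Omega.

Lemma D_ge0 : 0 <= D. Proof. by apply: (@mass_ge0 _ Omega) => // z _; exact: g_ge0. Qed.

Lemma w_le_g z : w z ^+ 2 <= 2 * g z.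
Proof.
rewrite gE /w; have := sqr_ge0 (uy z + Vx z); have := sqr_ge0 (ux z); have := sqr_ge0 (Vy z).
rewrite sqrrD sqrrB; lra.
Qed.

(* Either the box of half-side [l] fits in the half-plane, or its bottom side
   is moved up to a height at which the boundary terms are below [e]. *)
Lemma bottom (x0 y0 l mu e : R) : 0 < y0 -> 0 < l -> 0 < mu -> 0 < e ->
  r0 + l < `|x0| \/ r0 + l < y0 ->
  exists m : R, [/\ 0 < m, m < y0, y0 - l <= m &
    m = y0 - l \/ [/\ m < mu, y0 <= l &
      forall x, x0 - l <= x <= x0 + l -> [/\ `|w (x, m)| <= e,
        `|w (x, m) * (wy (x, m) - V (x, m) * w (x, m) / 2)| <= e &
        `|uxx (x, m) * uy (x, m)| <= e]]].
Proof.
move=> y00 l0 mu0 e0 far; have [ly|yl] := ltP l y0.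
  by exists (y0 - l); split; [lra|lra|exact: lexx|left].
have side : r0 < x0 - l \/ x0 + l < - r0.
  case: far => [|]; last by move: r0_gt0; lra.
  have [x00|x00] := leP 0 x0; first by rewrite ger0_norm// => ?; left; lra.
  by rewrite ltr0_norm// => ?; right; lra.
have [d1 d10 h1] := van_w side e0.
have [d2 d20 h2] := van_b1 side e0.
have [d3 d30 h3] := van_b2 side e0.
pose m := Num.min (Num.min d1 d2) (Num.min d3 (Num.min mu y0)) / 2.
have M0 : 0 < Num.min (Num.min d1 d2) (Num.min d3 (Num.min mu y0)).
  by rewrite !lt_min d10 d20 d30 mu0.
have m0 : 0 < m by rewrite divr_gt0.
have mM : m < Num.min (Num.min d1 d2) (Num.min d3 (Num.min mu y0)).
  by rewrite /m ltr_pdivrMr// ltr_pMr// ltr1n.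
move: mM; rewrite !lt_min => /andP[/andP[m1 m2] /andP[m3 /andP[m4 m5]]].
exists m; split => //; first by lra.
right; split => // x xx; split; [apply: h1|apply: h2|apply: h3] => //; exact/andP.
Qed.

Section Box.
Variables x0 y0 l m e : R.
Hypothesis l0 : 0 < l.
Hypothesis m0 : 0 < m.
Hypothesis my : m < y0.
Hypothesis ym : y0 - l <= m.
Hypothesis far : r0 + l < `|x0| \/ r0 + l < y0.
Hypothesis e0 : 0 <= e.
Hypothesis bot : m = y0 - l \/
  forall x, x0 - l <= x <= x0 + l ->
        `|w (x, m) * (wy (x, m) - V (x, m) * w (x, m) / 2)| <= e /\
        `|uxx (x, m) * uy (x, m)| <= e.

Local Notation K := (rect (x0 - l) (x0 + l) m (y0 + l)).
Local Notation IK := (I2 (x0 - l) (x0 + l) m (y0 + l)).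
Local Notation zt := (zeta x0 y0 l).
Local Notation ztx := (zetax x0 y0 l).
Local Notation zty := (zetay x0 y0 l).

Lemma box_sub : K `<=` Omega. Proof. exact: box_Omega. Qed.

Let KO := box_sub.
Let Cz : C1 Omega zt ztx zty := C1_zeta x0 y0 l0 Omega.

Let x12 : x0 - l <= x0 + l. Proof. by move: l0; lra. Qed.
Let y12 : m <= y0 + l. Proof. by move: l0 my; lra. Qed.

Let zl y : m <= y <= y0 + l -> zt (x0 - l, y) = 0.
Proof. by move=> _; rewrite /zeta/= bump_edge ?mul0r//; left. Qed.
Let zr y : m <= y <= y0 + l -> zt (x0 + l, y) = 0.
Proof. by move=> _; rewrite /zeta/= bump_edge ?mul0r//; right. Qed.
Let ztop x : x0 - l <= x <= x0 + l -> zt (x, y0 + l) = 0.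
Proof. by move=> _; rewrite /zeta/= (bump_edge l0 (c := y0)) ?mulr0//; right. Qed.

Let zK z : K z -> 0 <= zt z <= 1. Proof. exact: zeta_range. Qed.
Let zxK z : K z -> `|ztx z| <= 2 / l. Proof. exact: zetax_range. Qed.
Let zyK z : K z -> `|zty z| <= 2 / l. Proof. exact: zetay_range. Qed.

Let bottom_zeta (b : R) x : x0 - l <= x <= x0 + l -> m = y0 - l \/ `|b| <= e ->
  `|zt (x, m) ^+ 2 * b| <= e.
Proof.
move=> xx [mE|be].
  by rewrite /zeta/= mE (bump_edge l0 (c := y0)) ?mulr0 ?expr0n ?mul0r ?normr0//; left.
have Kx : K (x, m) by apply/rectP; rewrite /= xx lexx y12.
have /andP[h0 h1] := zK Kx.
rewrite normrM normrX (ger0_norm h0) -[leRHS]mul1r; apply: ler_pM => //.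
  by rewrite exprn_ge0.
by rewrite exprn_ile1.
Qed.

Lemma box_caccioppoli :
  IK (fun z => zt z ^+ 2 * (wx z ^+ 2 + wy z ^+ 2)) <=
  32 / l ^+ 2 * IK (fun z => w z ^+ 2) +
  2 * IK (fun z => `|zt z| * w z ^+ 2 * `|u z * ztx z + V z * zty z|) + 4 * (e * l).
Proof.
have be x : x0 - l <= x <= x0 + l ->
    `|zt (x, m) ^+ 2 * (w (x, m) * (wy (x, m) - V (x, m) * w (x, m) / 2))| <= e.
  by move=> xx; apply: bottom_zeta => //; case: bot => [?|/(_ _ xx)[? _]]; [left|right].
have := caccioppoli oO Cu CV Cw CP div0 KO Cz x12 y12 zl zr ztop be.
have cw2 : cts Omega (fun z => w z ^+ 2) by cts_tac.
have cgr : cts Omega (fun z => w z ^+ 2 * (ztx z ^+ 2 + zty z ^+ 2)) by cts_tac.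
have c8 : cts Omega (fun z => 8 / l ^+ 2 * w z ^+ 2) by cts_tac.
have h : IK (fun z => w z ^+ 2 * (ztx z ^+ 2 + zty z ^+ 2)) <= 8 / l ^+ 2 * IK (fun z => w z ^+ 2).
  rewrite -(I2Zl oO KO _ cw2); apply: (I2_le oO KO cgr c8) => z Kz.
  by rewrite mulrC; apply: ler_wpM2r; [exact: sqr_ge0|exact: (zeta_grad l0 ym (lexx _) Kz)].
move=> H; apply: (le_trans H); rewrite (_ : x0 + l - _ = 2 * l); last by ring.
move: h; rewrite (_ : 32 / l ^+ 2 = 4 * (8 / l ^+ 2)); last by ring.
by rewrite -mulrA; lra.
Qed.

(** Both components of the cutoff gradient are at most [2 / l], so a velocity bound [A] makes the
    transport term at most [4 * A / l] times the integral of [w^2]. *)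
Lemma box_energy (A : R) : 0 <= A ->
  (forall z, K z -> u z ^+ 2 + V z ^+ 2 <= A ^+ 2) ->
  IK (fun z => zt z ^+ 2 * (wx z ^+ 2 + wy z ^+ 2)) <=
  (32 / l ^+ 2 + 8 * A / l) * IK (fun z => w z ^+ 2) + 4 * (e * l).
Proof.
move=> A0 uA; apply: (le_trans box_caccioppoli).
have cw2 : cts Omega (fun z => w z ^+ 2) by cts_tac.
have c1 : cts Omega (fun z => `|zt z| * w z ^+ 2 * `|u z * ztx z + V z * zty z|) by cts_tac.
have c2 : cts Omega (fun z => 4 * A / l * w z ^+ 2) by cts_tac.
have h : IK (fun z => `|zt z| * w z ^+ 2 * `|u z * ztx z + V z * zty z|) <=
    4 * A / l * IK (fun z => w z ^+ 2).
  rewrite -(I2Zl oO KO _ cw2); apply: (I2_le oO KO c1 c2) => z Kz.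
  have leA (q : R) : q ^+ 2 <= A ^+ 2 -> `|q| <= A.
    by move=> qA; rewrite -(ger0_norm A0) -ler_sqr ?nnegrE// !real_normK ?num_real.
  have hu : `|u z| <= A by apply: leA; have := uA _ Kz; have := sqr_ge0 (V z); lra.
  have hV : `|V z| <= A by apply: leA; have := uA _ Kz; have := sqr_ge0 (u z); lra.
  have hz : `|u z * ztx z + V z * zty z| <= 4 * A / l.
    apply: (le_trans (ler_normD _ _)); rewrite (normrM (u z)) (normrM (V z)).
    rewrite (_ : 4 * A / l = A * (2 / l) + A * (2 / l)); last by ring.
    by apply: lerD; apply: ler_pM => //; [exact: zxK|exact: zyK].
  have /andP[z0 z1] := zK Kz.
  rewrite (ger0_norm z0) (mulrC (4 * A / l)).
  apply: ler_pM => //; first by rewrite mulr_ge0// sqr_ge0.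
  by rewrite ler_piMl// sqr_ge0.
by move: h; rewrite mulrDl (_ : 8 * A / l = 2 * (4 * A / l)); [rewrite -mulrA; lra|ring].
Qed.

Lemma box_hessian :
  IK (fun z => zt z ^+ 2 * (uxx z ^+ 2 + uxy z ^+ 2)) <=
  2 * IK (fun z => zt z ^+ 2 * (wx z ^+ 2 + wy z ^+ 2)) +
  64 / l ^+ 2 * IK (fun z => uy z ^+ 2) + 4 * (e * l).
Proof.
have be x : x0 - l <= x <= x0 + l -> `|zt (x, m) ^+ 2 * (uxx (x, m) * uy (x, m))| <= e.
  by move=> xx; apply: bottom_zeta => //; case: bot => [?|/(_ _ xx)[_ ?]]; [left|right].
have := hessian_estimate oO Cu Cw KO Cz x12 y12 zl zr ztop Cux Cuy laplacian_u be.
have cuy2 : cts Omega (fun z => uy z ^+ 2) by cts_tac.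
have cgr : cts Omega (fun z => uy z ^+ 2 * (ztx z ^+ 2 + zty z ^+ 2)) by cts_tac.
have c8 : cts Omega (fun z => 8 / l ^+ 2 * uy z ^+ 2) by cts_tac.
have cw1 : cts Omega (fun z => zt z ^+ 2 * wy z ^+ 2) by cts_tac.
have cw2 : cts Omega (fun z => zt z ^+ 2 * (wx z ^+ 2 + wy z ^+ 2)) by cts_tac.
have h : IK (fun z => uy z ^+ 2 * (ztx z ^+ 2 + zty z ^+ 2)) <= 8 / l ^+ 2 * IK (fun z => uy z ^+ 2).
  rewrite -(I2Zl oO KO _ cuy2); apply: (I2_le oO KO cgr c8) => z Kz.
  by rewrite mulrC; apply: ler_wpM2r; [exact: sqr_ge0|exact: (zeta_grad l0 ym (lexx _) Kz)].
have h2 : IK (fun z => zt z ^+ 2 * wy z ^+ 2) <= IK (fun z => zt z ^+ 2 * (wx z ^+ 2 + wy z ^+ 2)).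
  apply: (I2_le oO KO cw1 cw2) => z _.
  by apply: ler_wpM2l; [exact: sqr_ge0|rewrite lerDr sqr_ge0].
move=> H; apply: (le_trans H); rewrite (_ : x0 + l - _ = 2 * l); last by ring.
move: h h2; rewrite (_ : 64 / l ^+ 2 = 8 * (8 / l ^+ 2)); last by ring.
by rewrite -mulrA; lra.
Qed.

End Box.

(** * Velocity bound from boxes of fixed size *)

Section UnitBox.
Variables x0 y0 m e T : R.
Hypothesis m0 : 0 < m.
Hypothesis my : m < y0.
Hypothesis ym : y0 - 2 <= m.
Hypothesis far : r0 + 2 < `|x0| \/ r0 + 2 < y0.
Hypothesis e0 : 0 <= e.
Hypothesis bot : m = y0 - 2 \/
  forall x, x0 - 2 <= x <= x0 + 2 ->
        `|w (x, m) * (wy (x, m) - V (x, m) * w (x, m) / 2)| <= e /\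
        `|uxx (x, m) * uy (x, m)| <= e.
Local Notation K := (rect (x0 - 2) (x0 + 2) m (y0 + 2)).
Local Notation IK := (I2 (x0 - 2) (x0 + 2) m (y0 + 2)).
Local Notation zt := (zeta x0 y0 2).
Local Notation ztx := (zetax x0 y0 2).
Local Notation zty := (zetay x0 y0 2).
Hypothesis T1 : 1 <= T.
Hypothesis uT : IK (fun z => u z ^+ 2 + uy z ^+ 2) <= T.
Hypothesis VT : IK (fun z => V z ^+ 2 + Vy z ^+ 2) <= T.

Let l0 : 0 < 2 :> R := ltr0Sn R 1.
Let KO : K `<=` Omega := box_sub m0 ym far.
Let Cz : C1 Omega zt ztx zty := C1_zeta x0 y0 l0 Omega.

(* The transport term is split by AM-GM with weights [64 T] and [1 / (256 T)],
   so that half of the energy is absorbed thanks to [I2_mul_le]. *)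
Lemma unit_box_energy :
  IK (fun z => zt z ^+ 2 * (wx z ^+ 2 + wy z ^+ 2)) <=
  273 * T * IK (fun z => w z ^+ 2) + 16 * e.
Proof.
have := box_caccioppoli l0 m0 my ym far e0 bot.
set E := IK (fun z => zt z ^+ 2 * _); set W := IK (fun z => w z ^+ 2); set Tr := IK (fun z => `|zt z| * _ * _).
have W0 : 0 <= W by apply: I2_ge0 => z _; exact: sqr_ge0.
have cw2 : cts Omega (fun z => w z ^+ 2) by cts_tac.
have cE : cts Omega (fun z => zt z ^+ 2 * (wx z ^+ 2 + wy z ^+ 2)) by cts_tac.
(* [q = zeta * w] vanishes on the left side, as the product inequality requires, and its
   [x]-derivative is controlled by [W] and by the energy [E] itself. *)
have Cq := C1M Cz Cw.
have ztx1 z : K z -> `|ztx z| <= 1 by move=> Kz; apply: le_trans (zetax_range l0 ym (lexx _) Kz) _; lra.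
have zty1 z : K z -> `|zty z| <= 1 by move=> Kz; apply: le_trans (zetay_range l0 ym (lexx _) Kz) _; lra.
have sq1 (t : R) : `|t| <= 1 -> t ^+ 2 <= 1.
  by move=> ht; rewrite -(real_normK (num_real t)) exprn_ile1.
set q := (fun z => zt z * w z) in Cq; set qx := (fun z => ztx z * w z + zt z * wx z) in Cq.
have cqx2 : cts Omega (fun z => qx z ^+ 2) by rewrite /qx; cts_tac.
have cB : cts Omega (fun z => 2 * w z ^+ 2 + 2 * (zt z ^+ 2 * (wx z ^+ 2 + wy z ^+ 2))) by cts_tac.
have hq : IK (fun z => qx z ^+ 2) <= 2 * (W + E).
  have -> : 2 * (W + E) = IK (fun z => 2 * w z ^+ 2 + 2 * (zt z ^+ 2 * (wx z ^+ 2 + wy z ^+ 2))).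
    have c1 : cts Omega (fun z => 2 * w z ^+ 2) by cts_tac.
    have c2 : cts Omega (fun z => 2 * (zt z ^+ 2 * (wx z ^+ 2 + wy z ^+ 2))) by cts_tac.
    by rewrite (I2D oO KO c1 c2) !(I2Zl oO KO)// mulrDr.
  apply: (I2_le oO KO cqx2 cB) => z Kz; rewrite /qx.
  apply: le_trans (sqr_sum2 _ _) _; rewrite mulrDr (exprMn _ (ztx z)) (exprMn _ (zt z)).
  apply: lerD; rewrite ler_pM2l//.
    by rewrite ler_piMl ?sqr_ge0// sq1// ztx1.
  by rewrite ler_wpM2l ?sqr_ge0// lerDl sqr_ge0.
have q_l y : m <= y <= y0 + 2 -> q (x0 - 2, y) = 0.
  by move=> _; rewrite /q /zeta/= bump_edge ?mul0r//; left.
have x12 : x0 - 2 <= x0 + 2 by lra.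
have yl : 1 <= y0 + 2 - m by move: my; lra.
have WE0 : 0 <= W + E.
  by rewrite addr_ge0//; apply: I2_ge0 => z _; rewrite mulr_ge0 ?addr_ge0 ?sqr_ge0.
have h1 := I2_mul_le oO KO Cu Cq x12 yl q_l.
have h2 := I2_mul_le oO KO CV Cq x12 yl q_l.
have bnd (I J : R) : I <= 2 * (x0 + 2 - (x0 - 2)) * IK (fun z => qx z ^+ 2) * J ->
    0 <= J -> J <= T -> I <= 16 * (W + E) * T.
  move=> hI J0 JT; apply: (le_trans hI); apply: ler_pM => //.
    by rewrite mulr_ge0 ?I2_ge0// => [|z _]; [lra|exact: sqr_ge0].
  by rewrite (_ : 2 * _ = 8); [move: hq; lra|ring].
have {}h1 : IK (fun z => q z ^+ 2 * u z ^+ 2) <= 16 * (W + E) * T.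
  by apply: (bnd _ _ h1) uT; apply: I2_ge0 => z _; rewrite addr_ge0 ?sqr_ge0.
have {}h2 : IK (fun z => q z ^+ 2 * V z ^+ 2) <= 16 * (W + E) * T.
  by apply: (bnd _ _ h2) VT; apply: I2_ge0 => z _; rewrite addr_ge0 ?sqr_ge0.
have T0 : 0 < T by exact: lt_le_trans T1.
have cq1 : cts Omega (fun z => q z ^+ 2 * u z ^+ 2) by rewrite /q; cts_tac.
have cq2 : cts Omega (fun z => q z ^+ 2 * V z ^+ 2) by rewrite /q; cts_tac.
have cTr : cts Omega (fun z => `|zt z| * w z ^+ 2 * `|u z * ztx z + V z * zty z|) by cts_tac.
have cTr2 : cts Omega (fun z => 64 * T * w z ^+ 2 + (128 * T)^-1 * (q z ^+ 2 * u z ^+ 2 + q z ^+ 2 * V z ^+ 2)).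
  by rewrite /q; cts_tac.
have hTr : Tr <= 64 * T * W + (128 * T)^-1 * (32 * (W + E) * T).
  apply: (@le_trans _ _ (IK (fun z => 64 * T * w z ^+ 2 + (128 * T)^-1 * (q z ^+ 2 * u z ^+ 2 + q z ^+ 2 * V z ^+ 2)))).
    apply: (I2_le oO KO cTr cTr2) => z Kz.
    have uv : `|u z * ztx z + V z * zty z| <= `|u z| + `|V z|.
      apply: (le_trans (ler_normD _ _)); rewrite (normrM (u z)) (normrM (V z)).
      by apply: lerD; rewrite ler_piMr//; [exact: ztx1|exact: zty1].
    have amgm (p r : R) : p * r <= 64 * T * p ^+ 2 + (256 * T)^-1 * r ^+ 2.
      rewrite -subr_ge0 (_ : _ - _ = 64 * T * (p - (128 * T)^-1 * r) ^+ 2); last by field; rewrite gt_eqF.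
      by rewrite mulr_ge0 ?sqr_ge0// mulr_ge0// ltW.
    rewrite (_ : `|zt z| * _ * _ = `|w z| * (`|q z| * `|u z * ztx z + V z * zty z|)); last first.
      by rewrite /q (normrM (zt z)) -(real_normK (num_real (w z))); ring.
    apply: (@le_trans _ _ (`|w z| * (`|q z| * (`|u z| + `|V z|)))).
      by rewrite !ler_wpM2l.
    apply: (le_trans (amgm _ _)).
    rewrite real_normK ?num_real// lerD2l.
    rewrite (_ : (128 * T)^-1 = (256 * T)^-1 * 2); last by field; rewrite gt_eqF.
    have T2 : 0 < (256 * T)^-1 by rewrite invr_gt0; apply: mulr_gt0 T0; rewrite ltr0n.
    rewrite -mulrA ler_pM2l//.
    have := sqr_sum2 `|u z| `|V z|; rewrite !real_normK ?num_real// => h.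
    rewrite (exprMn _ `|q z|) real_normK ?num_real// -(mulrDr (q z ^+ 2)) (mulrCA 2).
    by apply: ler_wpM2l => //; exact: sqr_ge0.
  have c1 : cts Omega (fun z => 64 * T * w z ^+ 2) by cts_tac.
  have c3 : cts Omega (fun z => q z ^+ 2 * u z ^+ 2 + q z ^+ 2 * V z ^+ 2) by rewrite /q; cts_tac.
  have c2 : cts Omega (fun z => (128 * T)^-1 * (q z ^+ 2 * u z ^+ 2 + q z ^+ 2 * V z ^+ 2)).
    by rewrite /q; cts_tac.
  rewrite (I2D oO KO c1 c2) (I2Zl oO KO _ cw2) (I2Zl oO KO _ c3).
  rewrite lerD2l ler_pM2l ?invr_gt0 ?mulr_gt0// (I2D oO KO cq1 cq2).
  by move: h1 h2; lra.
move: hTr; rewrite (_ : (128 * T)^-1 * _ = (W + E) / 4); last by field; rewrite gt_eqF.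
rewrite (_ : 32 / 2 ^+ 2 = 8); last by field.
(* Twice the transport bound contains [(W + E) / 2]; absorbing [E / 2] gives
   [E <= (17 + 256 * T) * W + 16 * e], and [1 <= T] merges 17 and 256 into 273. *)
have hTW : W <= T * W by rewrite ler_peMl.
move: hTW; rewrite -!mulrA; move: (T * W) => TW; lra.
Qed.

(** The point is the lower left corner of a unit square: lying above the point, the square stays in
    the domain however small [y0] is, and inside the part of the box where [zeta^2 >= 1 / 4]. *)
Lemma unit_box_velocity : u (x0, y0) ^+ 2 + V (x0, y0) ^+ 2 <=
  4 * (IK (fun z => u z ^+ 2) + IK (fun z => V z ^+ 2) + IK g +
    4 * (2 * (273 * T * IK (fun z => w z ^+ 2) + 16 * e) +
     16 * IK (fun z => uy z ^+ 2) + 8 * e)).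
Proof.
have hE := unit_box_energy.
have := box_hessian l0 m0 my ym far e0 bot.
set H := I2 _ _ _ _ _; set E := I2 _ _ _ _ _ in hE *; set W := I2 _ _ _ _ _ in hE *.
set Y := IK (fun z => uy z ^+ 2) => hH.
pose S := rect x0 (x0 + 1) y0 (y0 + 1).
have SK : S `<=` K.
  by move=> z /rectP[/andP[? ?] /andP[? ?]]; apply/rectP; split; apply/andP; split; move: my; lra.
have SO := subset_trans SK KO.
have hu := corner_le oO Cu Cuy SO.
have hV := corner_le oO CV CVy SO.
pose G z := u z ^+ 2 + V z ^+ 2 + g z + 4 * (zt z ^+ 2 * (uxx z ^+ 2 + uxy z ^+ 2)).
have cH : cts Omega (fun z => zt z ^+ 2 * (uxx z ^+ 2 + uxy z ^+ 2)) by cts_tac.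
have cG : cts Omega G by rewrite /G; cts_tac.
have c1 : cts Omega (fun z => u z ^+ 2 + ux z ^+ 2 + uy z ^+ 2 + uyx z ^+ 2) by cts_tac.
have c2 : cts Omega (fun z => V z ^+ 2 + Vx z ^+ 2 + Vy z ^+ 2 + Vyx z ^+ 2) by cts_tac.
have c12 : cts Omega (fun z => (u z ^+ 2 + ux z ^+ 2 + uy z ^+ 2 + uyx z ^+ 2) + (V z ^+ 2 + Vx z ^+ 2 + Vy z ^+ 2 + Vyx z ^+ 2)) by cts_tac.
have hS : I2 x0 (x0 + 1) y0 (y0 + 1) (fun z => u z ^+ 2 + ux z ^+ 2 + uy z ^+ 2 + uyx z ^+ 2) +
   I2 x0 (x0 + 1) y0 (y0 + 1) (fun z => V z ^+ 2 + Vx z ^+ 2 + Vy z ^+ 2 + Vyx z ^+ 2) <= IK G.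
  rewrite -(I2D oO SO c1 c2); apply: (@le_trans _ _ (I2 x0 (x0 + 1) y0 (y0 + 1) G)).
    apply: (I2_le oO SO c12 cG) => z Sz; have Oz := SO _ Sz; have Kz := SK _ Sz.
    (* The mixed derivatives asked for at the corner are [uxy] for [u] and [- uxx] for [V], exactly
       the two that the Hessian estimate controls. *)
    rewrite (Vyx_uxx Oz) -(clairaut oO Cu Cux Cuy Oz) sqrrN /G gE.
    have z4 : 4^-1 <= zt z ^+ 2.
      by move: Sz => /rectP[/andP[? ?] /andP[? ?]]; apply: zeta_half; lra.
    have : uxx z ^+ 2 + uxy z ^+ 2 <= 4 * zt z ^+ 2 * (uxx z ^+ 2 + uxy z ^+ 2).
      by rewrite ler_peMl ?addr_ge0 ?sqr_ge0//; lra.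
    by rewrite -!mulrA; lra.
  apply: (I2_subset oO KO) => //; try (move: my; lra).
  move=> z _; rewrite /G; have := g_ge0 z; have := sqr_ge0 (u z); have := sqr_ge0 (V z).
  have : 0 <= zt z ^+ 2 * (uxx z ^+ 2 + uxy z ^+ 2) by rewrite mulr_ge0 ?addr_ge0 ?sqr_ge0.
  by lra.
have cu2 : cts Omega (fun z => u z ^+ 2) by cts_tac.
have cV2 : cts Omega (fun z => V z ^+ 2) by cts_tac.
have cuV : cts Omega (fun z => u z ^+ 2 + V z ^+ 2) by cts_tac.
have cuVg : cts Omega (fun z => u z ^+ 2 + V z ^+ 2 + g z) by cts_tac.
have c4H : cts Omega (fun z => 4 * (zt z ^+ 2 * (uxx z ^+ 2 + uxy z ^+ 2))) by cts_tac.
move: hS; rewrite (I2D oO KO cuVg c4H) (I2D oO KO cuV cg) (I2D oO KO cu2 cV2) (I2Zl oO KO _ cH) -/H.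
move: hH; rewrite (_ : 64 / 2 ^+ 2 = 16); last by field.
move: hE hu hV; move: (I2 _ _ _ _ _) (I2 _ _ _ _ _) => a1 a2.
move: (I2 _ _ _ _ _) (I2 _ _ _ _ _) (I2 _ _ _ _ _) (273 * T * W) => a3 a4 a5 a6.
lra.
Qed.

End UnitBox.

(** Mean squares are linear in [N], and the energy bound multiplies them by the integral of [w^2],
    which is at most [2 * D]; so the pointwise bound remains linear in [N]. *)
Lemma velocity_growth : exists2 K : R, 1 <= K & forall N (x0 y0 : R),
  `|x0| <= 2 ^+ N -> 0 < y0 -> y0 <= 2 ^+ N -> 4 * r0 + 4 <= `|x0| \/ 4 * r0 + 4 <= y0 ->
  u (x0, y0) ^+ 2 + V (x0, y0) ^+ 2 <= K * N.+1%:R.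
Proof.
have gx z : Omega z -> ux z ^+ 2 + uy z ^+ 2 <= g z.
  by move=> _; rewrite gE -addrA lerDl addr_ge0 ?sqr_ge0.
have gy z : Omega z -> Vx z ^+ 2 + Vy z ^+ 2 <= g z.
  by move=> _; rewrite gE -addrA lerDr addr_ge0 ?sqr_ge0.
have g0 z : Omega z -> 0 <= g z by move=> _; exact: g_ge0.
have [Ca Ca0 ha] := log_growth r0_gt0 Cu cg g0 gfin gx.
have [Cb Cb0 hb] := log_growth r0_gt0 CV cg g0 gfin gy.
have D0 := D_ge0.
pose C := Ca + Cb + D + 1.
exists (4 * (C + 4 * (2 * (546 * C * D + 16) + 16 * D + 8)) + 1).
  have : 0 <= C * D by rewrite mulr_ge0// /C; lra.
  by rewrite -!mulrA /C; move: (_ * D) => CD; lra.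
move=> N x0 y0 xN y00 yN far.
have far2 : r0 + 2 < `|x0| \/ r0 + 2 < y0 by case: far => ?; [left|right]; move: r0_gt0; lra.
have [m [m0 my ym bot]] := bottom y00 (ltr0Sn R 1) (@ltr01 R) (@ltr01 R) far2.
have {}bot : m = y0 - 2 \/ forall x, x0 - 2 <= x <= x0 + 2 ->
        `|w (x, m) * (wy (x, m) - V (x, m) * w (x, m) / 2)| <= 1 /\
        `|uxx (x, m) * uy (x, m)| <= 1.
  by case: bot => [|[_ _ h]]; [left|right => x /h[]].
have KO : rect (x0 - 2) (x0 + 2) m (y0 + 2) `<=` Omega by exact: box_sub far2.
have far3 : 4 * r0 + 2 <= `|x0| \/ 4 * r0 + 2 <= y0 by case: far => ?; [left|right]; lra.
have {}ha := ha N x0 y0 m xN m0 my yN ym far3.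
have {}hb := hb N x0 y0 m xN m0 my yN ym far3.
have hg := I2_le_mass oO cg g0 gfin KO; rewrite -/D in hg.
have cuy2 : cts Omega (fun z => uy z ^+ 2) by cts_tac.
have cVy2 : cts Omega (fun z => Vy z ^+ 2) by cts_tac.
have cu2 : cts Omega (fun z => u z ^+ 2) by cts_tac.
have cV2 : cts Omega (fun z => V z ^+ 2) by cts_tac.
have cw2 : cts Omega (fun z => w z ^+ 2) by cts_tac.
have c2g : cts Omega (fun z => 2 * g z) by cts_tac.
have huy : I2 (x0 - 2) (x0 + 2) m (y0 + 2) (fun z => uy z ^+ 2) <= D.
  apply: le_trans hg; apply: (I2_le oO KO cuy2 cg) => z _.
  by rewrite gE; have := sqr_ge0 (ux z); have := sqr_ge0 (Vx z); have := sqr_ge0 (Vy z); lra.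
have hVy : I2 (x0 - 2) (x0 + 2) m (y0 + 2) (fun z => Vy z ^+ 2) <= D.
  apply: le_trans hg; apply: (I2_le oO KO cVy2 cg) => z _.
  by rewrite gE; have := sqr_ge0 (ux z); have := sqr_ge0 (Vx z); have := sqr_ge0 (uy z); lra.
have hw : I2 (x0 - 2) (x0 + 2) m (y0 + 2) (fun z => w z ^+ 2) <= 2 * D.
  apply: (@le_trans _ _ (2 * I2 (x0 - 2) (x0 + 2) m (y0 + 2) g)); last by rewrite ler_pM2l.
  rewrite -(I2Zl oO KO _ cg); apply: (I2_le oO KO cw2 c2g) => z _; exact: w_le_g.
have n1 : 1 <= N.+1%:R :> R by rewrite ler1n.
have Dn : D <= D * N.+1%:R by rewrite ler_peMr.
have C_1 : 1 <= C by rewrite /C lerDr !addr_ge0.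
have T1 : 1 <= C * N.+1%:R by rewrite -[X in X <= _]mulr1; apply: ler_pM.
have hT : (Ca + Cb + D + 1) * N.+1%:R = Ca * N.+1%:R + Cb * N.+1%:R + D * N.+1%:R + N.+1%:R by ring.
have [p1 p2] : 0 <= Ca * N.+1%:R /\ 0 <= Cb * N.+1%:R by split; rewrite mulr_ge0.
have uT : I2 (x0 - 2) (x0 + 2) m (y0 + 2) (fun z => u z ^+ 2 + uy z ^+ 2) <= C * N.+1%:R.
  by rewrite (I2D oO KO cu2 cuy2) /C hT; move: ha huy Dn p2 n1; lra.
have VT : I2 (x0 - 2) (x0 + 2) m (y0 + 2) (fun z => V z ^+ 2 + Vy z ^+ 2) <= C * N.+1%:R.
  by rewrite (I2D oO KO cV2 cVy2) /C hT; move: hb hVy Dn p1 n1; lra.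
have := unit_box_velocity m0 my ym far2 (@ler01 R) bot T1 uT VT.
have hTW : 273 * (C * N.+1%:R) * I2 (x0 - 2) (x0 + 2) m (y0 + 2) (fun z => w z ^+ 2) <= 273 * (C * N.+1%:R) * (2 * D).
  apply: ler_wpM2l hw; apply: mulr_ge0; first by rewrite ler0n.
  exact: le_trans ler01 T1.
move/le_trans; apply.
have -> : (4 * (C + 4 * (2 * (546 * C * D + 16) + 16 * D + 8)) + 1) * N.+1%:R =
  4 * (C * N.+1%:R + 4 * (2 * (273 * (C * N.+1%:R) * (2 * D) + 16 * N.+1%:R) + 16 * (D * N.+1%:R) + 8 * N.+1%:R)) + N.+1%:R.
  by ring.
move: hTW; move: (_ * I2 _ _ _ _ _) (273 * _ * (2 * D)) => b1 b2.
have hCN : C * N.+1%:R = Ca * N.+1%:R + Cb * N.+1%:R + D * N.+1%:R + N.+1%:R by rewrite /C hT.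
move: ha hb hg huy hCN Dn p1 p2 n1.
move: (I2 _ _ _ _ _) (I2 _ _ _ _ _) (I2 _ _ _ _ _) (I2 _ _ _ _ _) => a1 a2 a3 a4.
lra.
Qed.

(** * Decay of the vorticity at the centre of a large box *)

Section DecayBox.
Variables x0 y0 l m e A W : R.
Hypothesis l4 : 4 <= l.
Hypothesis m0 : 0 < m.
Hypothesis my : m < y0.
Hypothesis ym : y0 - l <= m.
Hypothesis far : r0 + l < `|x0| \/ r0 + l < y0.
Hypothesis e0 : 0 <= e.
Hypothesis bot : m = y0 - l \/
  forall x, x0 - l <= x <= x0 + l ->
        `|w (x, m) * (wy (x, m) - V (x, m) * w (x, m) / 2)| <= e /\
        `|uxx (x, m) * uy (x, m)| <= e.
Hypothesis A1 : 1 <= A.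
Hypothesis eA : 4 * (e * l) <= A * W / l.
Local Notation K := (rect (x0 - l) (x0 + l) m (y0 + l)).
Local Notation IK := (I2 (x0 - l) (x0 + l) m (y0 + l)).
Hypothesis uA : forall z, K z -> u z ^+ 2 + V z ^+ 2 <= A ^+ 2.
Hypothesis wW : IK (fun z => w z ^+ 2) <= W.

Let l0 : 0 < l. Proof. exact: lt_le_trans l4. Qed.
Let A0 : 0 < A. Proof. exact: lt_le_trans A1. Qed.
(** The balancing weight: as the cut-off gradient energy is of order [s^2 W], both [s w^2] and
    [s^-1 |grad w|^2] integrate to order [s W] on the half box. *)
Let s := Num.sqrt (A / l).
Let s0 : 0 < s. Proof. by rewrite sqrtr_gt0 divr_gt0. Qed.
Let s2 : s ^+ 2 = A / l. Proof. by rewrite sqr_sqrtr// divr_ge0 ?ltW. Qed.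

(** As [1 / l <= 1 <= A], diffusion contributes at most 32 units of [A W / l], transport 8, and the
    bottom side 1. *)
Lemma box_energy_le : IK (fun z => zeta x0 y0 l z ^+ 2 * (wx z ^+ 2 + wy z ^+ 2)) <=
  41 * (s ^+ 2 * W).
Proof.
have := box_energy l0 m0 my ym far e0 bot (ltW A0) uA.
move=> /le_trans; apply.
have h1 : 32 / l ^+ 2 <= 32 * (A / l).
  have -> : 32 / l ^+ 2 = 32 * (l^-1 / l) by field; rewrite gt_eqF.
  rewrite ler_pM2l// ler_pM2r ?invr_gt0//.
  apply: le_trans A1; rewrite invf_le1//; apply: le_trans l4; lra.
have h2 : (32 / l ^+ 2 + 8 * A / l) * IK (fun z => w z ^+ 2) <= 40 * (A / l) * W.
  apply: ler_pM => //.
  - by rewrite addr_ge0// divr_ge0 ?mulr_ge0 ?exprn_ge0 ?(ltW l0) ?(ltW A0).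
  - by apply: I2_ge0 => z _; exact: sqr_ge0.
  - by rewrite -(mulrA 8); lra.
move: eA h2; rewrite s2 (mulrAC A) -!mulrA; move: (A * _) (_ * IK _) => a1 a2; lra.
Qed.

(** Here [165 = 1 + 4 * 41], the 4 being the price of removing the cutoff on the half box. *)
Lemma half_box_energy (m' : R) : m <= m' -> y0 - l / 2 <= m' ->
  I2 (x0 - l / 2) (x0 + l / 2) m' (y0 + l / 2)
    (fun z => s * w z ^+ 2 + s^-1 * (wx z ^+ 2 + wy z ^+ 2)) <= 165 * (s * W).
Proof.
move=> mm' ym'; have KO : K `<=` Omega := box_sub m0 ym far.
pose S := rect (x0 - l / 2) (x0 + l / 2) m' (y0 + l / 2).
have [xa _ _ _ [_ xb]] := quarter_points x0 l0; have [_ _ _ _ [_ yb]] := quarter_points y0 l0.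
have SK : S `<=` K by apply: rectS => //; exact: ltW.
have Cz := C1_zeta x0 y0 l0 Omega.
have cw2 : cts Omega (fun z => w z ^+ 2) by cts_tac.
have cE : cts Omega (fun z => zeta x0 y0 l z ^+ 2 * (wx z ^+ 2 + wy z ^+ 2)) by cts_tac.
have c1 : cts Omega (fun z => s * w z ^+ 2 + s^-1 * (wx z ^+ 2 + wy z ^+ 2)) by cts_tac.
have c3 : cts Omega (fun z => s * w z ^+ 2) by cts_tac.
have c4 : cts Omega (fun z => 4 / s * (zeta x0 y0 l z ^+ 2 * (wx z ^+ 2 + wy z ^+ 2))) by cts_tac.
have c2 := ctsD c3 c4.
apply: (@le_trans _ _ (I2 (x0 - l / 2) (x0 + l / 2) m' (y0 + l / 2)
    (fun z => s * w z ^+ 2 + 4 / s * (zeta x0 y0 l z ^+ 2 * (wx z ^+ 2 + wy z ^+ 2))))).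
  apply: (I2_le oO (subset_trans SK KO) c1 c2) => z Sz.
  have z4 : 4^-1 <= zeta x0 y0 l z ^+ 2.
    move: Sz => /rectP[zx /andP[za zb]]; apply: zeta_half => //.
    by rewrite zb andbT (le_trans ym').
  rewrite lerD2l (_ : 4 / s * (_ * _) = s^-1 * (4 * zeta x0 y0 l z ^+ 2 * (wx z ^+ 2 + wy z ^+ 2))); last by ring.
  apply: ler_wpM2l; first by rewrite invr_ge0 ltW.
  by apply: ler_peMl; [rewrite addr_ge0 ?sqr_ge0|move: z4; lra].
apply: (@le_trans _ _ (IK (fun z => s * w z ^+ 2 + 4 / s * (zeta x0 y0 l z ^+ 2 * (wx z ^+ 2 + wy z ^+ 2))))).
  apply: (I2_subset oO KO) => //; try exact: ltW.
  move=> z _; apply: addr_ge0; apply: mulr_ge0; try exact: sqr_ge0; try exact: ltW.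
  - exact: divr_ge0 (ltW s0).
  - by apply: mulr_ge0; [exact: sqr_ge0|apply: addr_ge0; exact: sqr_ge0].
rewrite (I2D oO KO c3 c4) (I2Zl oO KO _ cw2) (I2Zl oO KO _ cE).
have h1 : s * IK (fun z => w z ^+ 2) <= s * W by rewrite ler_pM2l.
have h2 : 4 / s * IK (fun z => zeta x0 y0 l z ^+ 2 * (wx z ^+ 2 + wy z ^+ 2)) <= 164 * (s * W).
  have -> : 164 * (s * W) = 4 / s * (41 * (s ^+ 2 * W)) by field; rewrite gt_eqF.
  by apply: ler_wpM2l box_energy_le; rewrite divr_ge0// ltW.
by move: h1 h2; move: (_ * IK _) (_ * IK _) => a1 a2; lra.
Qed.

(** For a fixed velocity the system is linear in [(w, P)], so the one-sided principle also applies
    to [(- w, - P)]. *)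
Lemma max_principle_abs (x1 x2 y1 y2 k : R) : rect x1 x2 y1 y2 `<=` Omega -> x1 < x2 -> y1 < y2 ->
  (forall y, y1 <= y <= y2 -> `|w (x1, y)| <= k) ->
  (forall y, y1 <= y <= y2 -> `|w (x2, y)| <= k) ->
  (forall x, x1 <= x <= x2 -> `|w (x, y1)| <= k) ->
  (forall x, x1 <= x <= x2 -> `|w (x, y2)| <= k) ->
  forall z, rect x1 x2 y1 y2 z -> `|w z| <= k.
Proof.
move=> KO x12 y12 hl hr hb ht z Kz.
have up t : `|w t| <= k -> w t <= k by move=> h; exact: le_trans (ler_norm _) h.
have dn t : `|w t| <= k -> - w t <= k.
  by move=> h; rewrite -normrN in h; exact: le_trans (ler_norm _) h.
have CwN := C1N Cw.
have CPN : C1 Omega (fun z => - P z) (fun z => - wy z - V z * - w z) (fun z => - - wx z + u z * - w z).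
  by have := C1N CP; move/eq_C1; apply => t; rewrite ?mulrN; ring.
have h1 := max_principle oO Cu CV Cw CP div0 KO x12 y12 (fun y yy => up _ (hl y yy))
  (fun y yy => up _ (hr y yy)) (fun x xx => up _ (hb x xx)) (fun x xx => up _ (ht x xx)) Kz.
have h2 := max_principle oO Cu CV CwN CPN div0 KO x12 y12 (fun y yy => dn _ (hl y yy))
  (fun y yy => dn _ (hr y yy)) (fun x xx => dn _ (hb x xx)) (fun x xx => dn _ (ht x xx)) Kz.
by rewrite ler_norml h1 andbT lerNl.
Qed.

(** A good line in a strip of width [l / 4] satisfies [w^2 * (l / 4) <= 2 * 165 * (s * W)], whence
    1320. Four such lines, or three and the bottom side, enclose the centre. *)
Lemma decay_box_max (k : R) : 0 <= k -> k ^+ 2 = 1320 * (s * W / l) ->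
  (m = y0 - l \/ forall x, x0 - l <= x <= x0 + l -> `|w (x, m)| <= k) ->
  `|w (x0, y0)| <= k.
Proof.
move=> k0 k2 wbot.
have KO : K `<=` Omega := box_sub m0 ym far.
pose m' := Num.max m (y0 - l / 2).
have mm' : m <= m' by rewrite le_max lexx.
have ym' : y0 - l / 2 <= m' by rewrite le_max lexx orbT.
have [xa1 xa2 xa3 xa4 [xa5 xa6]] := quarter_points x0 l0.
have [ya1 ya2 ya3 ya4 [ya5 ya6]] := quarter_points y0 l0.
have m'y : m' < y0 by rewrite gt_max my/= (lt_trans ya2).
have hH := half_box_energy mm' ym'.
have HO : rect (x0 - l / 2) (x0 + l / 2) m' (y0 + l / 2) `<=` Omega.
  by apply: subset_trans KO; apply: rectS => //; exact: ltW.
pose h z := s * w z ^+ 2 + s^-1 * (wx z ^+ 2 + wy z ^+ 2).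
have ch : cts Omega h by rewrite /h; cts_tac.
have h0 z : 0 <= h z.
  by rewrite addr_ge0// mulr_ge0 ?addr_ge0 ?sqr_ge0 ?invr_ge0 ?(ltW s0).
have lek (t I : R) : t ^+ 2 * (l / 4) <= 2 * I -> I <= 165 * (s * W) -> `|t| <= k.
  move=> h1 h2; rewrite -ler_sqr ?nnegrE// real_normK ?num_real// k2.
  have -> : 1320 * (s * W / l) = 330 * (s * W) / (l / 4) by field; rewrite gt_eqF.
  rewrite ler_pdivlMr ?divr_gt0//; apply: (le_trans h1); move: h2; lra.
have sub x1 x2 y1 y2 : x0 - l / 2 <= x1 -> x2 <= x0 + l / 2 -> m' <= y1 -> y2 <= y0 + l / 2 ->
   rect x1 x2 y1 y2 `<=` Omega /\ I2 x1 x2 y1 y2 h <= 165 * (s * W).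
  move=> a1 a2 a3 a4; split.
    by apply: subset_trans HO; exact: rectS.
  by apply: le_trans hH; apply: (I2_subset oO HO).
(* The square of the right side is [A * l / 4]: [4 <= l] makes the sides long enough for the weight
   [s]. *)
have sl : 1 <= s * (l / 2).
  rewrite -(@ler_pXn2r _ 2)// ?nnegrE ?mulr_ge0 ?divr_ge0 ?(ltW s0) ?(ltW l0)//.
  rewrite expr1n exprMn s2 (_ : A / l * _ = A * l / 4); last by field; rewrite gt_eqF.
  by rewrite ler_pdivlMr// mul1r; apply: le_trans l4 _; rewrite ler_peMl// ltW.
have sl2 (q : R) : l / 2 <= q -> 1 <= s * q by move=> ql; apply: (le_trans sl); rewrite ler_pM2l.
have lq : 0 < l / 4 by rewrite divr_gt0.
have x12 : x0 - l / 2 < x0 + l / 2 by rewrite (lt_trans xa2)// (lt_trans xa3)// (lt_trans xa4).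
have m'h : m' < y0 + l / 4 := lt_trans m'y ya4.
have m'h2 : m' < y0 + l / 2 := lt_trans m'h ya5.
have lenx : x0 + l / 2 - (x0 - l / 2) = l by field.
have len1 : 1 <= s * (y0 + l / 2 - m').
  by apply: sl2; rewrite -(addrA y0) (addrC (l / 2)) addrA lerDr subr_ge0 ltW.
have len2 : 1 <= s * (x0 + l / 2 - (x0 - l / 2)).
  by apply: sl2; rewrite lenx ler_pdivrMr// ler_peMr ?ler1n// ltW.
have [S1 J1] := sub (x0 - l / 2) (x0 - l / 4) m' (y0 + l / 2) (lexx _) (ltW (lt_trans xa3 (lt_trans xa4 xa5))) (lexx _) (lexx _).
have [xl /andP[xl1 xl2] hxl] := good_line_x oO S1 s0 Cw xa2 m'h2 len1.
have [S2 J2] := sub (x0 + l / 4) (x0 + l / 2) m' (y0 + l / 2) (ltW (lt_trans xa2 (lt_trans xa3 xa4))) (lexx _) (lexx _) (lexx _).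
have [xr /andP[xr1 xr2] hxr] := good_line_x oO S2 s0 Cw xa5 m'h2 len1.
have [S3 J3] := sub (x0 - l / 2) (x0 + l / 2) (y0 + l / 4) (y0 + l / 2) (lexx _) (lexx _) (ltW m'h) (lexx _).
have [yt /andP[yt1 yt2] hyt] := good_line_y oO S3 s0 Cw x12 ya5 len2.
(* If the box reaches down to [y0 - l / 2], the lower strip provides a good line; otherwise the
   bottom side was moved up near the flat boundary, and [w] is small on it. *)
have [yb [yb1 yb2 hyb]] : exists yb, [/\ m' <= yb, yb < y0 &
    forall x, x0 - l / 2 <= x <= x0 + l / 2 -> `|w (x, yb)| <= k].
  have [mh|mh] := leP m (y0 - l / 2).
    have m'E : m' = y0 - l / 2 by rewrite /m' max_r.
    have m'q : m' <= y0 - l / 2 by rewrite m'E.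
    have [S4 J4] := sub (x0 - l / 2) (x0 + l / 2) (y0 - l / 2) (y0 - l / 4) (lexx _) (lexx _) m'q (ltW (lt_trans ya3 (lt_trans ya4 ya5))).
    have [yb /andP[yb1 yb2] hyb] := good_line_y oO S4 s0 Cw x12 ya2 len2.
    exists yb; split; [by rewrite m'E|exact: le_lt_trans yb2 ya3|].
    move=> x xx; have := hyb x xx; rewrite (_ : y0 - l / 4 - _ = l / 4); last by field.
    by move/lek; apply; exact: J4.
  exists m; split => //; first by rewrite /m' max_l// ltW.
  case: wbot => [mE|wb x /andP[xa xb]].
    by have := lt_trans ya1 mh; rewrite mE ltxx.
  by apply: wb; rewrite (le_trans (ltW xa1) xa) (le_trans xb (ltW xa6)).
have Rsub y : yb <= y <= yt -> m' <= y <= y0 + l / 2.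
  by move=> /andP[h1 h2]; rewrite (le_trans yb1 h1) (le_trans h2 yt2).
have xrb : x0 - l / 2 <= xr := le_trans (ltW (lt_trans xa2 (lt_trans xa3 xa4))) xr1.
have xlb : xl <= x0 + l / 2 := le_trans xl2 (ltW (lt_trans xa3 (lt_trans xa4 xa5))).
have Tsub x : xl <= x <= xr -> x0 - l / 2 <= x <= x0 + l / 2.
  by move=> /andP[h1 h2]; rewrite (le_trans xl1 h1) (le_trans h2 xr2).
have xl0 : xl < x0 := le_lt_trans xl2 xa3.
have xr0 : x0 < xr := lt_le_trans xa4 xr1.
have yt0 : y0 < yt := lt_le_trans ya4 yt1.
apply: (@max_principle_abs xl xr yb yt k).
- by have [] := sub xl xr yb yt xl1 xr2 yb1 yt2.
- exact: lt_trans xl0 xr0.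
- exact: lt_trans yb2 yt0.
- move=> y yy; have := hxl y (Rsub y yy); rewrite (_ : x0 - l / 4 - _ = l / 4); last by field.
  by move/lek; apply; exact: J1.
- move=> y yy; have := hxr y (Rsub y yy); rewrite (_ : x0 + l / 2 - _ = l / 4); last by field.
  by move/lek; apply; exact: J2.
- by move=> x xx; exact: hyb (Tsub x xx).
- move=> x xx; have := hyt x (Tsub x xx); rewrite (_ : y0 + l / 2 - _ = l / 4); last by field.
  by move/lek; apply; exact: J3.
by apply/rectP; rewrite /= !ltW.
Qed.

End DecayBox.

(** The bounds [A] and [W] are assumed for every bottom height [m], because the height at which the
    box is cut is selected afterwards, from a tolerance that depends on them. *)
Lemma decay_box : exists2 C : R, 0 < C & forall x0 y0 l A W : R,
  0 < y0 -> 4 <= l -> 1 <= A -> 0 < W ->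
  r0 + l < `|x0| \/ r0 + l < y0 ->
  (forall m, 0 < m -> y0 - l <= m -> m < y0 ->
    (forall z, rect (x0 - l) (x0 + l) m (y0 + l) z -> u z ^+ 2 + V z ^+ 2 <= A ^+ 2) /\
    I2 (x0 - l) (x0 + l) m (y0 + l) (fun z => w z ^+ 2) <= W) ->
  w (x0, y0) ^+ 8 * l ^+ 6 <= C * (A ^+ 2 * W ^+ 4).
Proof.
(* The constant is kept abstract so that its fourth power is never computed. *)
have [c c0 cE] : exists2 c : R, 0 < c & c = 1320 by exists 1320; rewrite ?ltr0n.
exists (c ^+ 4); first exact: exprn_gt0.
move=> x0 y0 l A W y00 l4 A1 W0 far hyp.
have l0 : 0 < l by exact: lt_le_trans l4.
have A0 : 0 < A by exact: lt_le_trans A1.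
pose s := Num.sqrt (A / l).
have s0 : 0 < s by rewrite sqrtr_gt0 divr_gt0.
have s2 : s ^+ 2 = A / l by rewrite sqr_sqrtr// divr_ge0 ?ltW.
have S0 : 0 < c * (s * W / l) by rewrite mulr_gt0// divr_gt0// mulr_gt0.
pose k := Num.sqrt (c * (s * W / l)).
have k0 : 0 < k by rewrite sqrtr_gt0.
have k2 : k ^+ 2 = c * (s * W / l) by rewrite sqr_sqrtr// ltW.
have k2' := k2; rewrite cE in k2'.
(* The tolerance keeps [w] below [k] on a moved bottom side and makes the bottom term of the energy
   estimate at most [A * W / l]. *)
pose e := Num.min k (A * W / l / (4 * l)).
have e0 : 0 < e by rewrite lt_min k0/= !divr_gt0// mulr_gt0.
have ek : e <= k by rewrite ge_min lexx.
have eA : 4 * (e * l) <= A * W / l.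
  have : e <= A * W / l / (4 * l) by rewrite ge_min lexx orbT.
  by rewrite ler_pdivlMr ?mulr_gt0// mulrCA.
have [m [m0 my ym bot]] := bottom y00 l0 ltr01 e0 far.
have [uA wW] := hyp m m0 ym my.
have bot1 : m = y0 - l \/ forall x, x0 - l <= x <= x0 + l ->
        `|w (x, m) * (wy (x, m) - V (x, m) * w (x, m) / 2)| <= e /\
        `|uxx (x, m) * uy (x, m)| <= e.
  by case: bot => [|[_ _ h]]; [left|right => x /h[]].
have bot2 : m = y0 - l \/ forall x, x0 - l <= x <= x0 + l -> `|w (x, m)| <= k.
  by case: bot => [|[_ _ h]]; [left|right => x /h[h1 _ _]; exact: le_trans ek].
have := decay_box_max l4 m0 my ym far (ltW e0) bot1 A1 eA uA wW (ltW k0) k2' bot2.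
move=> wk.
have -> : w (x0, y0) ^+ 8 = `|w (x0, y0)| ^+ 8.
  by rewrite (exprM _ 2 4) -(real_normK (num_real (w (x0, y0)))) -exprM.
apply: (@le_trans _ _ (k ^+ 8 * l ^+ 6)).
  by apply: ler_wpM2r; [rewrite exprn_ge0// ltW|apply: lerXn2r; rewrite ?nnegrE// ltW].
rewrite (exprM k 2 4) k2.
(* The fourth power of [k^2] contains [s^4 = A^2 / l^2], which clears the square root and cancels
   the remaining [l^2]. *)
have -> : (c * (s * W / l)) ^+ 4 * l ^+ 6 = c ^+ 4 * ((s ^+ 2) ^+ 2 * W ^+ 4 * l ^+ 2).
  by field; rewrite gt_eqF.
rewrite s2 le_eqVlt; apply/orP; left; apply/eqP; field; rewrite gt_eqF//.
Qed.

Lemma pow2_large (B : R) : exists N0 : nat, forall N, (N0 <= N)%N -> B <= 2 ^+ N.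
Proof.
exists (Num.bound B) => N hN.
apply: (@le_trans _ _ (Num.bound B)%:R).
  by have [B0|/ltW B0] := leP 0 B; [exact/ltW/archi_boundP|exact: le_trans B0 _].
by rewrite -natrX ler_nat (leq_trans hN)// ltnW// ltn_expl.
Qed.

Lemma vorticity_decay (eps : R) : 0 < eps -> exists N0 : nat, forall N x0 y0,
  (N0 <= N)%N -> 0 < y0 -> `|x0| <= 2 ^+ N -> y0 <= 2 ^+ N ->
  2 ^+ N <= 2 * `|x0| \/ 2 ^+ N <= 2 * y0 ->
  w (x0, y0) ^+ 8 * (2 ^+ N) ^+ 6 <= eps * N.+1%:R.
Proof.
move=> eps0; have [K K1 hK] := velocity_growth; have [c1 c10 decay] := decay_box.
have [p p0 pE] : exists2 p : R, 0 < p & p = 8 ^+ 6 by exists (8 ^+ 6); rewrite ?exprn_gt0 ?ltr0n.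
have K0 : 0 < K by exact: lt_le_trans K1.
(* [32 = 2 * 2^4]: one factor from [N.+2 <= 2 * N.+1], the others from [(2 * tau) ^+ 4]; [p = 8^6]
   comes from [l = rho / 8]. *)
pose c : R := p * c1 * 32 * K.
have c0 : 0 < c by rewrite !mulr_gt0// ltr0n.
pose tau := Num.min 1 (eps / c).
have tau0 : 0 < tau by rewrite lt_min ltr01 divr_gt0.
have tau1 : tau <= 1 by rewrite ge_min lexx.
have tauc : c * tau ^+ 4 <= eps.
  have : tau <= eps / c by rewrite ge_min lexx orbT.
  rewrite ler_pdivlMr// mulrC; apply: le_trans; rewrite ler_pM2l//.
  by rewrite ler_iXnr// ltW.
have g0 z : Omega z -> 0 <= g z by move=> _; exact: g_ge0.
have [r rr hr] := mass_tail oO cg g0 gfin tau0.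
(* Large enough that [4 <= l], that [3 * l] exceeds the tail radius [r], and that the velocity bound
   holds at distance [3 * l]. *)
have [N0 hN0] := pow2_large (32 + 3 * r + 3 * (4 * r0 + 4)).
exists N0 => N x0 y0 /hN0 hN y00 xN yN far.
set rho : R := 2 ^+ N in hN xN yN far *.
have r4 : 0 < 4 * r0 by rewrite mulr_gt0.
pose l := rho / 8.
have rhoE : rho = 8 * l by rewrite /l; field.
have l4 : 4 <= l by rewrite /l ler_pdivlMr//; move: hN rr r4; lra.
have rl : r < 3 * l by move: hN rr r4; rewrite rhoE; lra.
have r0l : 4 * r0 + 4 <= 3 * l by move: hN rr r4; rewrite rhoE; lra.
have x4 : 4 * l <= `|x0| \/ 4 * l <= y0.
  by case: far => h; [left|right]; move: h; rewrite rhoE; lra.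
have far1 : r0 + l < `|x0| \/ r0 + l < y0.
  by case: x4 => h; [left|right]; move: h r0l r4; lra.
(* Points of the box may lie beyond [2 ^+ N], so the velocity bound is taken at the next dyadic
   scale. *)
pose A := Num.sqrt (K * N.+2%:R).
have KN0 : 1 <= K * N.+2%:R by rewrite -[leLHS]mulr1 ler_pM// ler1n.
have A2 : A ^+ 2 = K * N.+2%:R by rewrite sqr_sqrtr// (le_trans ler01).
have A1 : 1 <= A by rewrite -[leLHS]sqrtr1 ler_wsqrtr.
have l0 : 0 < l by exact: lt_le_trans l4.
have far2 m z : y0 - l <= m -> rect (x0 - l) (x0 + l) m (y0 + l) z -> 3 * l <= `|z.1| \/ 3 * l <= z.2.
  move=> ym /rectP[/andP[z1 z2] /andP[z3 z4]]; case: x4 => h; [left|right]; last first.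
    by move: h ym z3; lra.
  have d : `|x0 - z.1| <= l by rewrite ler_norml; apply/andP; split; move: z1 z2; lra.
  have := ler_normD (x0 - z.1) z.1; rewrite subrK; move: d h; lra.
have hyp m : 0 < m -> y0 - l <= m -> m < y0 ->
    (forall z, rect (x0 - l) (x0 + l) m (y0 + l) z -> u z ^+ 2 + V z ^+ 2 <= A ^+ 2) /\
    I2 (x0 - l) (x0 + l) m (y0 + l) (fun z => w z ^+ 2) <= 2 * tau.
  move=> m0 ym my; have KO : rect (x0 - l) (x0 + l) m (y0 + l) `<=` Omega by exact: box_sub.
  split=> [[x y] Kz|].
    have fz := far2 m _ ym Kz; move: Kz => /rectP[/= /andP[z1 z2] /andP[z3 z4]].
    rewrite A2; apply: hK; rewrite ?exprS -/rho.
    - rewrite ler_norml; move: xN; rewrite ler_norml => /andP[n1 n2].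
      by apply/andP; split; move: n1 n2 z1 z2 l0; rewrite rhoE; lra.
    - exact: lt_le_trans z3.
    - by move: yN z4 l0; rewrite rhoE; lra.
    - by case: fz => h; [left|right]; exact: le_trans h.
  have cw2 : cts Omega (fun z => w z ^+ 2) by cts_tac.
  have c2g : cts Omega (fun z => 2 * g z) by cts_tac.
  apply: (@le_trans _ _ (2 * I2 (x0 - l) (x0 + l) m (y0 + l) g)).
    by rewrite -(I2Zl oO KO _ cg); apply: (I2_le oO KO cw2 c2g) => z _; exact: w_le_g.
  rewrite ler_pM2l//; apply: hr => // z Kz; case: (far2 m z ym Kz) => h; [left|right].
    exact: lt_le_trans h.
  by rewrite (lt_le_trans rl)// (le_trans h)// ler_norm.
have := decay _ _ _ _ _ y00 l4 A1 (mulr_gt0 (ltr0Sn R 1) tau0) far1 hyp.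
rewrite A2 rhoE => H.
have N2 : N.+2%:R <= 2 * N.+1%:R :> R by rewrite -natrM ler_nat mul2n -addnn addSn -addn1 leq_add2l.
have -> : w (x0, y0) ^+ 8 * (8 * l) ^+ 6 = p * (w (x0, y0) ^+ 8 * l ^+ 6).
  by rewrite (exprMn _ 8 l) -pE mulrCA.
apply: (@le_trans _ _ (p * (c1 * (K * N.+2%:R * (2 * tau) ^+ 4)))).
  by rewrite ler_pM2l.
apply: (@le_trans _ _ (c * tau ^+ 4 * N.+1%:R)); last by rewrite ler_wpM2r.
have -> : c * tau ^+ 4 * N.+1%:R = p * (c1 * (K * (2 * N.+1%:R) * (2 * tau) ^+ 4)).
  by rewrite /c; ring.
rewrite ler_pM2l// ler_pM2l//.
by rewrite ler_wpM2r ?exprn_ge0 ?mulr_ge0 ?(ltW tau0)// ler_pM2l.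
Qed.

End Vorticity.

(** * Boundary values on the flat part of the boundary *)

Section Boundary.
Variable R : realType.
Variable r0 : R.
Hypothesis r0_gt0 : 0 < r0.
Local Notation Omega := (Omega0 r0).
Implicit Types (f h : R * R -> R) (z : R * R).

Let oO : open Omega := @open_Omega R r0.

Lemma extends_cvg f z : extends_continuously Omega f -> closure Omega z ->
  exists l : R, f @ within Omega (nbhs z) --> l.
Proof.
move=> [g [/subspace_continuousP cg gf]] clz; exists (g z) => B /(cg z clz) gB.
have {}gB : \forall t \near z, closure Omega t -> B (g t) := gB.
suff : \forall t \near z, Omega t -> B (f t) by [].
apply: filterS gB => t gt Ot; rewrite -gf//; apply: gt; exact: subset_closure.
Qed.

Lemma extends_cts f : extends_continuously Omega f -> cts Omega f.
Proof.
move=> [g [/subspace_continuousP cg gf]] z Oz B.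
rewrite /= -gf// => /(cg z (subset_closure Oz)) gB.
have {}gB : \forall t \near z, closure Omega t -> B (g t) := gB.
suff : \forall t \near z, B (f t) by [].
have : nbhs z Omega by exact: open_nbhs_nbhs.
move: gB; apply: filterS2 => t gt Ot; rewrite -gf//; apply: gt; exact: subset_closure.
Qed.

Lemma closure_valueE f z (l : R) : closure Omega z ->
  f @ within Omega (nbhs z) --> l -> closure_value Omega f z = l.
Proof.
move=> clz fl; have := within_nbhs_proper clz => PF.
exact: cvg_lim fl.
Qed.

Lemma closure_Omega z : 0 <= z.2 -> r0 < Defs.radius z -> closure Omega z.
Proof.
move=> z2 zr B /nbhs_ballP[e /= e0 eB].
exists (z.1, z.2 + e / 2); split.
  split => /=; first by rewrite ltr_wpDl// divr_gt0.
  apply: (lt_le_trans zr); rewrite ler_wsqrtr// lerD2l.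
  have e2 : 0 < e / 2 by rewrite divr_gt0.
  by apply: lerXn2r; rewrite ?nnegrE ?addr_ge0 ?(ltW e2)// lerDl ltW.
apply: eB; split => /=; first exact: ballxx.
rewrite /ball/= opprD addrA subrr sub0r normrN ger0_norm ?divr_ge0 ?(ltW e0)//.
by rewrite ltr_pdivrMr// ltr_pMr// ltr1n.
Qed.

Lemma closure_Gamma (x : R) : r0 < `|x| -> closure Omega (x, 0).
Proof.
by move=> rx; apply: closure_Omega => //=; exact: lt_le_trans rx (norm1_le_radius (x, 0)).
Qed.

Definition null_trace h := forall x : R, r0 < `|x| -> h @ within Omega (nbhs (x, 0 : R)) --> (0 : R).

Lemma null_trace_value f : extends_continuously Omega f ->
  (forall z, Gamma r0 z -> closure_value Omega f z = 0) -> null_trace f.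
Proof.
move=> ef f0 x rx; have clx := closure_Gamma rx.
have [l fl] := extends_cvg ef clx.
by have := f0 (x, 0) (conj (erefl _) rx); rewrite (closure_valueE clx fl) => l0; rewrite l0 in fl.
Qed.

Lemma null_traceD f h : null_trace f -> null_trace h -> null_trace (fun z => f z + h z).
Proof. by move=> nf nh x rx; have H := cvgD (nf x rx) (nh x rx); rewrite addr0 in H; exact: H. Qed.

Lemma null_traceN f : null_trace f -> null_trace (fun z => - f z).
Proof. by move=> nf x rx; have H := cvgN (nf x rx); rewrite oppr0 in H; exact: H. Qed.

Lemma null_traceM f h : null_trace f -> extends_continuously Omega h ->
  null_trace (fun z => f z * h z).
Proof.
move=> nf eh x rx; have [l hl] := extends_cvg eh (closure_Gamma rx).
by have H := cvgM (nf x rx) hl; rewrite mul0r in H; exact: H.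
Qed.

Lemma extendsD f h : extends_continuously Omega f -> extends_continuously Omega h ->
  extends_continuously Omega (fun z => f z + h z).
Proof.
move=> [f' [cf ff]] [h' [ch hh]]; exists (fun z => f' z + h' z); split.
  by move=> z; apply: cvgD; [exact: cf|exact: ch].
by move=> z Oz; rewrite ff// hh.
Qed.

Lemma extendsM f h : extends_continuously Omega f -> extends_continuously Omega h ->
  extends_continuously Omega (fun z => f z * h z).
Proof.
move=> [f' [cf ff]] [h' [ch hh]]; exists (fun z => f' z * h' z); split.
  by move=> z; apply: cvgM; [exact: cf|exact: ch].
by move=> z Oz; rewrite ff// hh.
Qed.

Lemma extends_cst (c : R) : extends_continuously Omega (fun=> c).
Proof. by exists (fun=> c); split => // z; exact: cvg_cst. Qed.

Lemma extendsN f : extends_continuously Omega f -> extends_continuously Omega (fun z => - f z).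
Proof.
move=> [f' [cf ff]]; exists (fun z => - f' z); split.
  by move=> z; apply: cvgN; exact: cf.
by move=> z Oz; rewrite ff.
Qed.

Lemma null_trace_near h (x e : R) : null_trace h -> r0 < `|x| -> 0 < e ->
  exists2 d : R, 0 < d & forall s m : R, `|s - x| < d -> 0 < m < d -> `|h (s, m)| <= e.
Proof.
move=> nh rx e0; have := nh x rx => /cvgrPdist_le/(_ _ e0) /nbhs_ballP[d /= d0 dB].
pose d' := Num.min d (`|x| - r0); have d'0 : 0 < d' by rewrite lt_min d0 subr_gt0.
exists d' => // s m; rewrite lt_min => /andP[sd sx] /andP[m0]; rewrite lt_min => /andP[md _].
have := dB (s, m); rewrite sub0r normrN; apply.
  by split => /=; rewrite /ball/= ?sub0r ?normrN ?(gtr0_norm m0)// distrC.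
split => //; apply: lt_le_trans (norm1_le_radius (s, m)); rewrite /=.
have := ler_normD (x - s) s; rewrite subrK distrC; move: sx; rewrite ltrBrDl; lra.
Qed.

(** Compactness of the segment upgrades the limit at each boundary point to a uniform one. *)
Lemma null_trace_vanish h : null_trace h -> vanish r0 h.
Proof.
move=> nh x1 x2 side e e0.
have /compact_near_coveringP : compact `[x1, x2] by exact: segment_compact.
move=> /(_ R (0 : R)^'+ (fun m x => `|h (x, m)| <= e) _)[].
  move=> x /=; rewrite in_itv/= => /andP[xa xb].
  have rx : r0 < `|x|.
    case: side => s; first by rewrite (lt_le_trans s)// (le_trans xa)// ler_norm.
    by rewrite -normrN (lt_le_trans _ (ler_norm _))// ltrNr (le_lt_trans xb).
  have [d d0 hd] := null_trace_near nh rx e0.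
  exists (ball x d, [set m | 0 < m < d]) => /=.
    split; first exact: nbhsx_ballx.
    near=> m; apply/andP; split; near: m; [exact: nbhs_right_gt|exact: nbhs_right_lt].
  by move=> [s m] /= [sx md]; apply: hd => //; rewrite distrC.
move=> d /= d0 hd; exists d => // x m xx /andP[m0 md]; apply: (hd m) => //=.
  by rewrite sub0r normrN gtr0_norm.
Unshelve. all: end_near. Qed.

(** Tangential differentiation preserves zero boundary values. On a short segment of fixed length
    [t] the derivative stays close to its boundary limit, while the increment of [v] tends to zero
    as the segment is lowered; the mean value theorem then forces the limit to be zero. *)
Lemma null_trace_dx v (vx vy : R * R -> R) : C1 Omega v vx vy ->
  extends_continuously Omega vx -> null_trace v -> null_trace vx.
Proof.
move=> Cv evx nv x rx; have [l vl] := extends_cvg evx (closure_Gamma rx).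
suff l0 : l = 0 by rewrite l0 in vl.
apply/eqP; rewrite -normr_le0; apply/ler_addgt0Pr => e e0; rewrite add0r.
have /cvgrPdist_le/(_ (e / 2)) : vx @ within Omega (nbhs (x, 0 : R)) --> l by [].
move=> /(_ ltac:(by rewrite divr_gt0)) /nbhs_ballP[d /= d0 dB].
pose t := Num.min d (`|x| - r0) / 2.
have M0 : 0 < Num.min d (`|x| - r0) by rewrite lt_min d0 subr_gt0.
have t0 : 0 < t by rewrite divr_gt0.
have : t < Num.min d (`|x| - r0) by rewrite /t; move: M0; lra.
rewrite lt_min => /andP[td tx].
have far s : x <= s <= x + t -> r0 < `|s|.
  move=> /andP[sa sb]; have := ler_normD (x - s) s; rewrite subrK distrC.
  rewrite (ger0_norm (_ : 0 <= s - x)) ?subr_ge0//; move: tx; rewrite ltrBrDl; lra.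
have et : 0 < e * t / 4 by rewrite divr_gt0// mulr_gt0.
have rxt : r0 < `|x + t| by apply: far; apply/andP; split; move: t0; lra.
have [d1 d10 h1] := null_trace_near nv rx et.
have [d2 d20 h2] := null_trace_near nv rxt et.
pose m := Num.min d (Num.min d1 d2) / 2.
have N0 : 0 < Num.min d (Num.min d1 d2) by rewrite !lt_min d0 d10.
have m0 : 0 < m by rewrite divr_gt0.
have : m < Num.min d (Num.min d1 d2) by rewrite /m; move: N0; lra.
rewrite !lt_min => /and3P[md md1 md2].
have Os s : x <= s <= x + t -> Omega (s, m).
  by move=> /far rs; split => //; exact: lt_le_trans rs (norm1_le_radius (s, m)).
have xxt : x < x + t by rewrite ltrDl.
have [c cx] := @MVT _ (fun s => v (s, m)) (fun s => vx (s, m)) x (x + t) xxt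
  (fun s ss => C1_slicex Cv (Os s (subset_itv_oo_cc ss)))
  (cts1_at (fun s ss => cts_slicex (C1c Cv) (Os s ss))).
have cc : x <= c <= x + t := subset_itv_oo_cc cx.
rewrite (_ : x + t - x = t); last by ring.
move=> E.
have b1 : `|v (x, m)| <= e * t / 4 by apply: h1; rewrite ?subrr ?normr0// m0.
have b2 : `|v (x + t, m)| <= e * t / 4 by apply: h2; rewrite ?subrr ?normr0// m0.
have b3 : `|l - vx (c, m)| <= e / 2.
  apply: dB; last exact: Os.
  split => /=; rewrite /ball/= ?sub0r ?normrN ?(gtr0_norm m0)//.
  move: cc => /andP[c1 c2]; rewrite distrC ger0_norm ?subr_ge0//; move: td; lra.
have b4 : `|vx (c, m)| * t <= e / 2 * t.
  rewrite -{1}(gtr0_norm t0) -normrM -E; apply: (le_trans (ler_normB _ _)); lra.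
move: b4; rewrite ler_pM2r// => b4.
have := ler_normD (l - vx (c, m)) (vx (c, m)); rewrite subrK; lra.
Qed.

End Boundary.

Lemma C1_of_Ck (R : realType) (r0 : R) (f : R * R -> R) (k : nat) :
  Ck_closure k.+1 (Omega0 r0) f -> C1 (Omega0 r0) f (dx f) (dy f).
Proof.
move=> [ef [df Dx Dy]]; split.
- by move=> z /df[? _]; exact: DeriveDef.
- by move=> z /df[_ ?]; exact: DeriveDef.
- exact: extends_cts.
- by apply: extends_cts; case: k Dx {Dy} => [|k] [].
- by apply: extends_cts; case: k Dy {Dx} => [|k] [].
Qed.

Lemma Ck_partials (R : realType) (D : set (R * R)) (f : R * R -> R) (k : nat) :
  Ck_closure k.+1 D f -> Ck_closure k D (dx f) /\ Ck_closure k D (dy f).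
Proof. by move=> [_ [_ ? ?]]. Qed.

Lemma Ck_extends (R : realType) (D : set (R * R)) (f : R * R -> R) (k : nat) :
  Ck_closure k D f -> extends_continuously D f.
Proof. by case: k => [|k] []. Qed.

Lemma navier_stokes_vorticity (R : realType) (r0 b : R) (u v p : R * R -> R) :
  0 < r0 -> Ck_closure 2 (Omega0 r0) u -> Ck_closure 2 (Omega0 r0) v ->
  navier_stokes 0 b (Omega0 r0) u v p -> navier_slip r0 u v ->
  finite_dirichlet (Omega0 r0) u v ->
  forall eps : R, 0 < eps -> exists N0 : nat, forall N x0 y0,
  (N0 <= N)%N -> 0 < y0 -> `|x0| <= 2 ^+ N -> y0 <= 2 ^+ N ->
  2 ^+ N <= 2 * `|x0| \/ 2 ^+ N <= 2 * y0 ->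
  vorticity u v (x0, y0) ^+ 8 * (2 ^+ N) ^+ 6 <= eps * N.+1%:R.
Proof.
move=> r0_gt0 u2 v2 NS slip fin.
have oO := @open_Omega R r0.
have [ux1 uy1] := Ck_partials u2; have [vx1 vy1] := Ck_partials v2.
have [uxx0 _] := Ck_partials ux1; have [_ uyy0] := Ck_partials uy1.
have [_ vxy0] := Ck_partials vx1.
have Cu := C1_of_Ck u2; have Cux := C1_of_Ck ux1; have Cuy := C1_of_Ck uy1.
have Cv := C1_of_Ck v2; have Cvx := C1_of_Ck vx1; have Cvy := C1_of_Ck vy1.
have CV : C1 (Omega0 r0) (fun z => v z + b) (dx v) (dy v).
  by have := C1D Cv (C1_cst (Omega0 r0) b); move/eq_C1; apply => z; rewrite addr0.
have div0 z : Omega0 r0 z -> dx u z + dy v z = 0 by case/NS.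
have lapu := laplacian_u (dy (dy u)) Cux CV Cvx Cvy div0.
have lapv z : Omega0 r0 z -> dx (dx v) z + dy (dy v) z = dx (dx v) z - dx (dy u) z.
  move=> Oz; have E t : Omega0 r0 t -> dy v t = - dx u t by move=> Ot; have := div0 t Ot; lra.
  have [_ h] := C1_unique oO Cvy (C1N Cux) E.
  by rewrite (h z Oz) (clairaut oO Cu Cux Cuy Oz).
(* The pressure gradient in Lamb form: the Laplacians of [u] and [v] are [w_y] and [- w_x], and
   convection is the gradient of [(u^2 + v^2) / 2] plus the rotated velocity times [w]. *)
pose Qx z := wy (dy (dy u)) (dy (dx v)) z - (u z * dx u z + v z * dx v z) - v z * w (dy u) (dx v) z - b * dy u z.
pose Qy z := - wx (dx (dy u)) (dx (dx v)) z - (u z * dy u z + v z * dy v z) + u z * w (dy u) (dx v) z - b * dy v z.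
have cQx : cts (Omega0 r0) Qx by rewrite /Qx /wy /w; cts_tac.
have cQy : cts (Omega0 r0) Qy by rewrite /Qy /wx /w; cts_tac.
have px z : Omega0 r0 z -> is_derive z ((1, 0) : R * R) p (Qx z).
  move=> Oz; have [[d1 d2] e1 e2 _] := NS z Oz; apply: DeriveDef => //.
  rewrite -/(dx p z) -e1 /laplacian (lapu _ Oz) /Qx /w; move: (wy _ _ _) => s.
  by move: (dx u z) (dy u z) (dx v z) => s1 s2 s3; ring.
have py z : Omega0 r0 z -> is_derive z ((0, 1) : R * R) p (Qy z).
  move=> Oz; have [[d1 d2] e1 e2 _] := NS z Oz; apply: DeriveDef => //.
  rewrite -/(dy p z) -e2 /laplacian (lapv z Oz) /Qy /w /wx.
  move: (dx (dx v) z) (dx (dy u) z) (dy u z) (dx v z) (dy v z) => s1 s2 s3 s4 s5; ring.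
have Cp : C1 (Omega0 r0) p Qx Qy by split => //; exact: (continuous_of_partials oO px py).
have CP : C1 (Omega0 r0) (fun z => p z + (2^-1 * (u z * u z + v z * v z) + b * v z))
   (fun z => wy (dy (dy u)) (dy (dx v)) z - (v z + b) * w (dy u) (dx v) z)
   (fun z => - wx (dx (dy u)) (dx (dx v)) z + u z * w (dy u) (dx v) z).
  have := C1D Cp (C1D (C1M (C1_cst (Omega0 r0) 2^-1) (C1D (C1M Cu Cu) (C1M Cv Cv)))
    (C1M (C1_cst (Omega0 r0) b) Cv)).
  move/eq_C1; apply => z.
    rewrite /Qx /w; move: (wy _ _ _) => s.
    by move: (dx u z) (dy u z) (dx v z) => s1 s2 s3; field.
  rewrite /Qy /w; move: (wx _ _ _) => s.
  by move: (dy u z) (dx v z) (dy v z) => s1 s2 s3; field.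
have gE z : grad_sq u v z = dx u z ^+ 2 + dy u z ^+ 2 + dx v z ^+ 2 + dy v z ^+ 2 by [].
have nv : null_trace r0 v by apply: null_trace_value (Ck_extends v2) _ => z /slip[].
have nuy : null_trace r0 (dy u) by apply: null_trace_value (Ck_extends uy1) _ => z /slip[].
(* Slip gives [v = 0] and [u_y = 0]; the tangential derivative of the first completes the zero trace
   of the vorticity. *)
have nvx : null_trace r0 (dx v) := null_trace_dx Cv (Ck_extends vx1) nv.
have nw : null_trace r0 (w (dy u) (dx v)) := null_traceD nuy (null_traceN nvx).
have ew := extendsD (Ck_extends uy1) (extendsN (Ck_extends vx1)).
have ewy := extendsD (Ck_extends uyy0) (extendsN (Ck_extends vxy0)).
have eVw := extendsM (extendsM (extendsD (Ck_extends v2) (extends_cst r0 b)) ew) (extends_cst r0 2^-1).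
have nb1 : null_trace r0 (fun z => w (dy u) (dx v) z *
    (wy (dy (dy u)) (dy (dx v)) z - (v z + b) * w (dy u) (dx v) z / 2)).
  exact: (null_traceM nw (extendsD ewy (extendsN eVw))).
have nb2 : null_trace r0 (fun z => dx (dx u) z * dy u z).
  have -> : (fun z => dx (dx u) z * dy u z) = (fun z => dy u z * dx (dx u) z).
    by apply/funext => z; rewrite mulrC.
  exact: (null_traceM nuy (Ck_extends uxx0)).
exact: (vorticity_decay r0_gt0 Cu Cux Cuy CV Cvx Cvy div0 CP gE fin
  (null_trace_vanish nw) (null_trace_vanish nb1) (null_trace_vanish nb2)).
Qed.

(** * From dyadic scales to polar coordinates *)

Section Conversion.
Variable R : realType.

Lemma pow2_between (q : R) : 1 <= q -> exists N : nat, q <= 2 ^+ N <= 2 * q.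
Proof.
move=> q1; have [N0 hN0] := pow2_large q.
have ex : exists N, q <= 2 ^+ N by exists N0; exact: hN0.
case: (ex_minnP ex) => -[|N] qN minN.
  by exists 0%N; rewrite qN/= expr0; lra.
exists N.+1; rewrite qN/= exprS ler_pM2l//.
by rewrite leNgt; apply/negP => /ltW /minN; rewrite ltnn.
Qed.

Lemma half_le_ln2 : 2^-1 <= ln 2 :> R.
Proof.
rewrite -[leLHS]expRK ler_ln ?posrE ?expR_gt0//.
have := expR_ge1Dx (- 2^-1 : R); rewrite expRN => h.
rewrite -[leRHS]invrK -[leLHS]invrK lef_pV2 ?posrE ?invr_gt0 ?expR_gt0//.
by apply: le_trans h; lra.
Qed.

(** Take logarithms in [2 ^+ N.+1 <= 8 * r <= r ^+ 2] and use [1 / 2 <= ln 2]. *)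
Lemma log_le (r : R) (N : nat) : 8 <= r -> 2 ^+ N <= 4 * r -> N.+1%:R <= 4 * ln r.
Proof.
move=> r8 Nr; have r0 : 0 < r by exact: lt_le_trans r8.
have : ln (2 ^+ N.+1 : R) <= ln (r ^+ 2).
  rewrite ler_ln ?posrE ?exprn_gt0// exprS expr2.
  apply: (@le_trans _ _ (2 * (4 * r))); first by rewrite ler_pM2l.
  by rewrite mulrA ler_pM2r//; lra.
have -> : ln (2 ^+ N.+1 : R) = N.+1%:R * ln 2 by rewrite lnXn// mulr_natl.
have -> : ln (r ^+ 2) = ln r + ln r by rewrite lnXn// mulr2n.
have := ler_wpM2l (ler0n R N.+1) half_le_ln2; lra.
Qed.

Lemma powR_frac (a s : R) (n k : nat) : 0 <= a -> s * n%:R = k%:R -> (a `^ s) ^+ n = a ^+ k.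
Proof. by move=> a0 E; rewrite -powR_mulrn ?powR_ge0// -powRrM E powR_mulrn. Qed.

Lemma max_radius (z : R * R) : 0 <= z.2 ->
  Num.max `|z.1| z.2 <= Defs.radius z /\ Defs.radius z ^+ 2 <= 2 * Num.max `|z.1| z.2 ^+ 2.
Proof.
move=> z2; split.
  by rewrite ge_max norm1_le_radius/= -{1}(ger0_norm z2) norm2_le_radius.
rewrite sqr_sqrtr ?addr_ge0 ?sqr_ge0// -(real_normK (num_real z.1)) mulr_natl mulr2n.
by apply: lerD; apply: lerXn2r; rewrite ?nnegrE ?le_max ?normr_ge0 ?z2 ?lexx ?orbT.
Qed.

Lemma radius_polar (r theta : R) : 0 <= r -> Defs.radius (polar r theta) = r.
Proof.
move=> r0; rewrite /Defs.radius /polar/= !exprMn -mulrDr cos2Dsin2 mulr1.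
by rewrite sqrtr_sqr ger0_norm.
Qed.

(** Only interior points near [z] are tested, which transfers the decay to the angles 0 and pi,
    where the vorticity exists as a limit. *)
Lemma closure_value_le (r0 : R) (f : R * R -> R) (z : R * R) (M : R) : 0 < r0 ->
  extends_continuously (Omega0 r0) f -> closure (Omega0 r0) z ->
  (\forall t \near z, Omega0 r0 t -> `|f t| <= M) -> `|closure_value (Omega0 r0) f z| <= M.
Proof.
move=> r00 ef clz fM; have [l fl] := extends_cvg ef clz.
rewrite (closure_valueE clz fl); apply/ler_addgt0Pr => e e0.
have /cvgrPdist_le/(_ _ e0) fe := fl.
have {}fe : \forall t \near z, Omega0 r0 t -> `|l - f t| <= e := fe.
have [t [Ot []]] := clz _ (filterI fM fe).
move=> /(_ Ot) h1 /(_ Ot) h2.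
have := ler_normD (l - f t) (f t); rewrite subrK; lra.
Qed.

Lemma uniform_cvg0 (A : set R) (F : R -> R -> R) :
  (forall e : R, 0 < e -> \forall r \near +oo, forall t, A t -> `|F r t| < e) ->
  {uniform A, F @ +oo --> (fun=> 0)}.
Proof.
move=> h B /uniform_nbhs[E [entE sub]].
move: entE; rewrite -entourage_ballE => -[e /= e0 eE].
suff : \forall r \near +oo, B (F r) by [].
have := h e e0; apply: filterS => r hr; apply: sub => t At; apply: eE => /=.
by rewrite /ball/= sub0r normrN; exact: hr.
Qed.

End Conversion.

Lemma closure_vorticity_le (R : realType) (r0 eps : R) (u v : R * R -> R) :
  0 < r0 -> 0 < eps -> extends_continuously (Omega0 r0) (vorticity u v) ->
  (exists N0 : nat, forall N x0 y0,
    (N0 <= N)%N -> 0 < y0 -> `|x0| <= 2 ^+ N -> y0 <= 2 ^+ N ->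
    2 ^+ N <= 2 * `|x0| \/ 2 ^+ N <= 2 * y0 ->
    vorticity u v (x0, y0) ^+ 8 * (2 ^+ N) ^+ 6 <= eps * N.+1%:R) ->
  exists2 B : R, 8 <= B & forall r theta : R, B <= r -> 0 <= theta <= pi ->
    `|closure_value (Omega0 r0) (vorticity u v) (polar r theta)| ^+ 8 * r ^+ 6
      <= 256 * (eps * ln r).
Proof.
move=> r00 eps0 ew [N0 hN0].
have p0 : 0 < 2 ^+ N0 :> R by rewrite exprn_gt0.
exists (8 + (2 * r0 + 2 * 2 ^+ N0)); first by rewrite lerDl addr_ge0// mulr_ge0// ltW.
move=> r theta Br tpi.
have r8 : 8 <= r by lra.
have r0r : r0 < r by lra.
have rN : 2 ^+ N0 <= r / 2 by lra.
have rpos : 0 < r by lra.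
have lnr : 0 < ln r by rewrite ln_gt0//; lra.
have clz : closure (Omega0 r0) (polar r theta).
  apply: closure_Omega; last by rewrite radius_polar// ltW.
  by rewrite /polar/= mulr_ge0 ?sin_ge0_pi// ltW.
set Q := 256 * (eps * ln r).
have Q0 : 0 < Q by rewrite mulr_gt0 ?ltr0n// mulr_gt0.
(* The eighth root is needed because the passage to the closure is stated for a bound on the
   absolute value itself. *)
pose M := (Q / r ^+ 6) `^ (1 / 8).
have M8 : M ^+ 8 = Q / r ^+ 6.
  rewrite (@powR_frac _ _ _ 8 1)//; first by rewrite divr_ge0 ?exprn_ge0 ?ltW.
  by field.
suff cM : `|closure_value (Omega0 r0) (vorticity u v) (polar r theta)| <= M.
  rewrite -ler_pdivlMr ?exprn_gt0// -M8.
  by apply: lerXn2r cM; rewrite ?nnegrE ?powR_ge0.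
apply: closure_value_le => //.
have /cvgrPdist_le/(_ (r / 4)) := @radius_continuous R (polar r theta).
move=> /(_ ltac:(by rewrite divr_gt0)); apply: filterS => -[t1 t2].
rewrite radius_polar; last exact: ltW.
move=> rt [/= t20 _].
have [qle qge] := @max_radius R (t1, t2) (ltW t20); move: qle qge => /=.
set q := Num.max `|t1| t2; set s := Defs.radius (t1, t2) in rt * => qle qge.
move: rt; rewrite ler_norml => /andP[s1 s2].
have q0 : 0 < q by rewrite lt_max t20 orbT.
have sr : 3 / 4 * r <= s by lra.
have sq : (3 / 4 * r) ^+ 2 <= s ^+ 2 by apply: lerXn2r => //; rewrite nnegrE; lra.
(* Sup norm against Euclidean norm: [q^2 >= s^2 / 2 >= 9 / 32 * r^2], which exceeds [(r / 2)^2]. *)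
have rq : r / 2 <= q.
  rewrite -(@ler_pXn2r _ 2)// ?nnegrE ?divr_ge0 ?(ltW q0) ?(ltW rpos)//.
  move: sq qge; rewrite !exprMn; have := sqr_ge0 r; lra.
have q1 : 1 <= q by lra.
have [N /andP[qN Nq]] := pow2_between q1.
have N0N : (N0 <= N)%N.
  rewrite -(@ler_eXn2l R 2) ?ltr1n//.
  by apply: le_trans qN; exact: le_trans rN rq.
have : vorticity u v (t1, t2) ^+ 8 * (2 ^+ N) ^+ 6 <= eps * N.+1%:R.
  apply: hN0 => //.
  - by apply: le_trans qN; rewrite le_max lexx.
  - by apply: le_trans qN; rewrite le_max lexx orbT.
  by move: Nq; rewrite /q maxEle; case: ifP => _ h; [right|left].
have Nr : 2 ^+ N <= 4 * r by lra.
have := log_le r8 Nr => hN h.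
have h2 : `|vorticity u v (t1, t2)| ^+ 8 * (r / 2) ^+ 6 <= eps * (4 * ln r).
  apply: (@le_trans _ _ (eps * N.+1%:R)); last by rewrite ler_pM2l.
  apply: le_trans h.
  have -> : `|vorticity u v (t1, t2)| ^+ 8 = vorticity u v (t1, t2) ^+ 8.
    by rewrite -normrX ger0_norm// (exprM _ 4 2) sqr_ge0.
  apply: ler_wpM2l; first by rewrite (exprM _ 4 2) sqr_ge0.
  apply: lerXn2r; rewrite ?nnegrE ?exprn_ge0 ?divr_ge0 ?(ltW rpos)//.
  exact: le_trans rq qN.
rewrite -(@ler_pXn2r _ 8)// ?nnegrE ?powR_ge0// M8 ler_pdivlMr ?exprn_gt0//.
have E : r ^+ 6 = 64 * (r / 2) ^+ 6 by field.
rewrite E mulrCA /Q (_ : 256 * (eps * ln r) = 64 * (eps * (4 * ln r))); last by ring.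
by rewrite ler_pM2l// ltr0n.
Qed.

Unset Implicit Arguments.
Set Strict Implicit.
Set Printing Implicit Defensive.

Theorem theorem4 (R : realType) (r0 a b : R) (u v p : R * R -> R)
    (r0_gt0 : 0 < r0)
    (w_C2 : Ck_closure 2 (Omega0 r0) u /\ Ck_closure 2 (Omega0 r0) v)
    (w_NS : navier_stokes a b (Omega0 r0) u v p)
    (w_slip : navier_slip r0 u v)
    (w_dirichlet : finite_dirichlet (Omega0 r0) u v)
    (a_eq0 : a = 0) :
  {uniform `[0, pi], (fun r theta : R =>
      r `^ (3 / 4) / ln r `^ (1 / 8) *
      `|closure_value (Omega0 r0) (vorticity u v) (polar r theta)|)
    @ +oo --> (fun=> 0)}.
Proof.
have [u2 v2] := w_C2; rewrite a_eq0 in w_NS.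
have ew : extends_continuously (Omega0 r0) (vorticity u v).
  have [_ uy1] := Ck_partials u2; have [vx1 _] := Ck_partials v2.
  exact: (extendsD (Ck_extends uy1) (extendsN (Ck_extends vx1))).
apply: uniform_cvg0 => e e0.
(* With the factor 256 of the polar estimate this leaves [e ^+ 8 / 2], hence a strict inequality. *)
have eps0 : 0 < e ^+ 8 / 512 by rewrite divr_gt0 ?exprn_gt0 ?ltr0n.
have decay := navier_stokes_vorticity r0_gt0 u2 v2 w_NS w_slip w_dirichlet eps0.
have [B B8 hB] := closure_vorticity_le r0_gt0 eps0 ew decay.
near=> r => t; rewrite /= in_itv/= => tpi.
have Br : B <= r by near: r; apply: nbhs_pinfty_ge; exact: num_real.
have rpos : 0 < r by apply: lt_le_trans Br; apply: lt_le_trans B8.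
have lnr : 0 < ln r by rewrite ln_gt0//; apply: lt_le_trans Br; apply: lt_le_trans B8; rewrite ltr1n.
have := hB r t Br tpi; set c := `|closure_value _ _ _| => hc.
have X0 : 0 <= r `^ (3 / 4) / ln r `^ (1 / 8) * c.
  by apply: mulr_ge0; [apply: divr_ge0; exact: powR_ge0|exact: normr_ge0].
(* Eighth powers turn the weight into [r ^+ 6 / ln r], the form in which the decay was proved. *)
rewrite ger0_norm// -(@ltr_pXn2r _ 8)// ?nnegrE ?(ltW e0)//.
rewrite !exprMn exprVn (@powR_frac _ r _ 8 6) ?(ltW rpos)//; last by field.
rewrite (@powR_frac _ (ln r) _ 8 1) ?(ltW lnr)//; last by field.
rewrite expr1 mulrAC ltr_pdivrMr// mulrC (le_lt_trans hc)//.
have := mulr_gt0 (exprn_gt0 8 e0) lnr; move: (e ^+ 8) (ln r) => e8 L h.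
rewrite (_ : 256 * (e8 / 512 * L) = e8 * L / 2); last by field.
lra.
Unshelve. all: end_near. Qed.
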